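(* Fix $\alpha\in[0,1)$. For each $\theta>1$ let $(V_i^{(\alpha,\theta)})_{i\ge1}$ be $\mathrm{PD}(\alpha,\theta)$-distributed and put $Z_i^{(\alpha,\theta)}=\theta V_i^{(\alpha,\theta)}-\beta_{\alpha,\theta}$, where $\beta_{\alpha,\theta}=\log\theta-(\alpha+1)\log\log\theta-\log\Gamma(1-\alpha)$. Then as $\theta\to\infty$, $(Z_1^{(\alpha,\theta)},Z_2^{(\alpha,\theta)},\dots)$ converges in joint (finite-dimensional) distribution to $(Z_1^*,Z_2^*,\dots)$, the decreasing order statistics of a Poisson point process on $\mathbf R$ with mean measure $e^{-z}\,dz$.
   Context: $\mathrm{PD}(\alpha,\theta)$ (for $0\le\alpha<1$, $\theta>-\alpha$): let $Y_1,Y_2,\dots$ be independent with $Y_i\sim\mathrm{Beta}(1-\alpha,\theta+i\alpha)$, put $\tilde V_1=Y_1$, $\tilde V_i=(1-Y_1)\cdots(1-Y_{i-1})Y_i$, and let $V_1\ge V_2\ge\cdots$ be the decreasing rearrangement of $(\tilde V_i)$; $\mathrm{PD}(\alpha,\theta)$ is the law of $(V_i)$. *)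

(* Defs.v *)
From HB Require Import structures.
From mathcomp Require Import all_boot all_order all_algebra.
From mathcomp Require Import all_classical all_reals all_analysis.
Set Implicit Arguments. Unset Strict Implicit. Unset Printing Implicit Defensive.
Import Order.TTheory GRing.Theory Num.Theory.
Import numFieldNormedType.Exports.
Local Open Scope classical_set_scope.
Local Open Scope ring_scope.

Section PD_defs.
Context {R : realType}.

Definition Gamma_fun (s : R) : R :=
  Rintegral lebesgue_measure `]0%R, +oo[%classic
    (fun x : R => x `^ (s - 1) * expR (- x)).

Definition Beta_fun (a b : R) : R :=
  Rintegral lebesgue_measure `]0%R, 1%R[%classic
    (fun x : R => x `^ (a - 1) * (1 - x) `^ (b - 1)).

Definition beta_density (a b : R) (x : R) : R :=
  x `^ (a - 1) * (1 - x) `^ (b - 1) / Beta_fun a b.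

Definition is_beta_rv d (T : measurableType d) (P : probability T R)
    (Y : T -> R) (a b : R) : Prop :=
  measurable_fun setT Y /\
  forall B : set R, measurable B ->
    P (Y @^-1` B) =
    (\int[lebesgue_measure]_(x in B `&` `]0%R, 1%R[%classic)
        (beta_density a b x)%:E)%E.

Definition mutually_independent d (T : measurableType d) (P : probability T R)
    (Y : nat -> T -> R) : Prop :=
  forall (s : seq nat) (B : nat -> set R), uniq s ->
    (forall i, measurable (B i)) ->
    P (\bigcap_(i in [set` s]) (Y i @^-1` B i)) =
    (\prod_(i <- s) P (Y i @^-1` B i))%E.

(** Stick-breaking weights: Ṽ_1 = Y_1, Ṽ_i = (1-Y_1)...(1-Y_{i-1}) Y_i
    (indices shifted to start at 0). *)
Definition stick_breaking (y : nat -> R) (i : nat) : R :=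
  (\prod_(j < i) (1 - y j)) * y i.

(** The (k+1)-th largest term (k = 0 gives the largest) of a real sequence
    with finitely many terms above each positive level: the decreasing
    rearrangement, 0-indexed. *)
Definition kth_largest (v : nat -> R) (k : nat) : R :=
  sup [set t : R | exists s : seq nat,
         [/\ uniq s, size s = k.+1 & forall i, i \in s -> t <= v i]].

Definition poisson_mass (r : R) (n : nat) : R :=
  r ^+ n / (n`!)%:R * expR (- r).

(** The point configuration p (enumerated with multiplicity) has exactly
    n points in A. *)
Definition count_eq (p : nat -> R) (A : set R) (n : nat) : Prop :=
  exists s : seq nat,
    [/\ uniq s, size s = n & forall i, (i \in s) <-> A (p i)].

(** Poisson point process on R with mean measure mu, realised as a random
    enumerated point configuration p : T -> nat -> R: for pairwise disjoint
    Borel sets A_1..A_m of finite mean measure, the counts N(A_j) are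
    independent Poisson(mu(A_j)). *)
Definition is_PPP d (T : measurableType d) (P : probability T R)
    (p : T -> nat -> R) (mu : set R -> \bar R) : Prop :=
  (forall i, measurable_fun setT (fun w => p w i)) /\
  forall (m : nat) (A : 'I_m -> set R) (n : 'I_m -> nat),
    (forall j, measurable (A j)) ->
    (forall j k, j != k -> A j `&` A k = set0) ->
    (forall j, (mu (A j) < +oo)%E) ->
    P (\bigcap_(j in [set: 'I_m]) [set w | count_eq (p w) (A j) (n j)]) =
    (\prod_(j < m) poisson_mass (fine (mu (A j))) (n j))%:E.

Definition gumbel_intensity (A : set R) : \bar R :=
  (\int[lebesgue_measure]_(z in A) (expR (- z))%:E)%E.

Definition beta_const (alpha theta : R) : R :=
  ln theta - (alpha + 1) * ln (ln theta) - ln (Gamma_fun (1 - alpha)).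

End PD_defs.

(* Main.v *)
(* The residual mass prod_{j<i} (1 - Y_j) of the stick is replaced, for the first
   I = theta / (ln theta)^(3/4) indices, by its deterministic limit
   rho_i = (theta + (i+1) alpha) / (theta + i).  The variables theta rho_i Y_i - beta are
   independent, and sharp beta tails give, uniformly in i < I,
     P(theta rho_i Y_i - beta > z) ~ e^-z (ln theta / theta) e^(-i ln theta / theta),
   so these probabilities are uniformly small and sum up to e^-z: the exceedances of the
   comparison array are asymptotically Poisson.  The exact moments of the weights beyond I
   and a second moment bound for the residual before I show that, at each fixed level, the
   weights and the comparison array have the same exceedances with probability tending to 1.
   Now cut a large window into small cells.  The law of the set of hit cells is determined
   by void probabilities, hence converges to that for the Poisson process; when no cell is
   hit twice, this set locates the n largest points up to the mesh of the grid, so the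
   expectation of a function that is uniformly continuous on the window converges. *)

Require Import Defs.
From HB Require Import structures.
From mathcomp Require Import all_boot all_order all_algebra.
From mathcomp Require Import all_classical all_reals all_analysis.
From mathcomp Require Import measurable_realfun ring lra.
Set Implicit Arguments. Unset Strict Implicit. Unset Printing Implicit Defensive.
Import Order.TTheory GRing.Theory Num.Theory.
Import numFieldNormedType.Exports.
Local Open Scope classical_set_scope.
Local Open Scope ring_scope.

(** Write b_i = theta + (i+1) alpha for the second parameter of [Y_i]. The comparison variable
    exceeds a level x exactly when [Y_i] exceeds u with b_i u = x (1 + i / theta): the numerator of
    rho_i is chosen so that alpha leaves the exponent of (1 - u)^b_i ~ e^(-b_i u), and x ~ ln theta
    then yields the decay e^(-i ln theta / theta). The prefactor u^(-alpha) / (b_i B(1 - alpha,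
    b_i)) behaves like (ln theta)^(-alpha) / Gamma(1 - alpha), and about theta / ln theta indices
    contribute; these two facts account for alpha and for 1 in the coefficient alpha + 1 of ln ln
    theta. Levels grow like ln theta while cells have fixed width, so the residual must be known to
    a relative precision finer than 1 / ln theta. This dictates the cutoff. [kth_largest] is a
    supremum, meaningful only for well-behaved configurations, and its measurability is not
    established. Expectations are therefore enclosed between integrals of step functions built from
    hit patterns and one event of small probability. *)

Section real_valued_probability.
Context {R : realType} {d : measure_display} {T : measurableType d}.
Variable P : probability T R.
Implicit Types A B : set T.

Lemma fine_probE A : measurable A -> P A = (fine (P A))%:E.
Proof. by move=> mA; rewrite fineK// fin_num_measure. Qed.

Lemma le_fine_prob A B : measurable A -> measurable B -> A `<=` B ->
  fine (P A) <= fine (P B).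
Proof.
by move=> mA mB AB; rewrite fine_le ?fin_num_measure//; apply: le_measure; rewrite ?inE.
Qed.

Lemma fine_probU A B : measurable A -> measurable B ->
  fine (P (A `|` B)) <= fine (P A) + fine (P B).
Proof.
move=> mA mB; rewrite -lee_fin EFinD -!fine_probE//; last exact: measurableU.
exact: measureU2.
Qed.

Lemma fine_prob_bigU (I : Type) (r : seq I) (Q : pred I) (A : I -> set T) :
  (forall i, measurable (A i)) ->
  fine (P (\big[setU/set0]_(i <- r | Q i) A i)) <= \sum_(i <- r | Q i) fine (P (A i)).
Proof.
move=> mA; elim: r => [|i r ih]; first by rewrite !big_nil measure0.
rewrite !big_cons; case: ifP => // _.
apply: le_trans (fine_probU _ _) _ => //; last by rewrite lerD2l.
exact: bigsetU_measurable.
Qed.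

Lemma fine_prob_split A B : measurable A -> measurable B ->
  fine (P A) = fine (P (A `&` B)) + fine (P (A `&` ~` B)).
Proof.
move=> mA mB; have mAB := measurableI _ _ mA mB.
have mAC := measurableI _ _ mA (measurableC mB).
apply: EFin_inj; rewrite EFinD -!fine_probE// -measureU//.
  by rewrite -setIUr setUv setIT.
by rewrite setIACA setICr setI0.
Qed.

End real_valued_probability.

(** * Extension of weighted integrals from indicators to nonnegative functions *)

Section weighted_integrals.
Context {R : realType}.
Import HBNNSimple.

Lemma measurable_preimage d (T : measurableType d) (X : T -> R) (B : set R) :
  measurable_fun setT X -> measurable B -> measurable (X @^-1` B).
Proof. by move=> mX mB; rewrite -[_ @^-1` _]setTI; exact: mX. Qed.

Lemma measurable_superlevel d (T : measurableType d) (X : T -> R) (x : R) :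
  measurable_fun setT X -> measurable [set w | x < X w].
Proof.
move=> mX; rewrite (_ : [set w | _] = X @^-1` `]x, +oo[).
  exact: measurable_preimage.
by apply/seteqP; split => w /=; rewrite in_itv/= andbT.
Qed.

Lemma integral_nnsfun_weighted d (T : measurableType d)
    (mu : {measure set T -> \bar R}) (X w : T -> R) (h : {nnsfun R >-> R}) :
  measurable_fun setT X -> measurable_fun setT w -> (forall x, 0 <= w x) ->
  (\int[mu]_x (h (X x) * w x)%:E =
   \sum_(r \in range h) r%:E * \int[mu]_(x in X @^-1` (h @^-1` [set r])) (w x)%:E)%E.
Proof.
move=> mX mw w0.
have mA r : measurable (X @^-1` (h @^-1` [set r])).
  by apply: measurable_preimage => //; exact: measurable_funPTI.
have mwA r : measurable_fun setT (EFin \o (fun x => w x * \1_(X @^-1` (h @^-1` [set r])) x)).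
  by apply/measurable_EFinP; apply: measurable_funM => //; exact: measurable_indic.
have rw0 r x : (0 <= r%:E * (w x * \1_(X @^-1` (h @^-1` [set r])) x)%:E)%E.
  rewrite -EFinM lee_fin indicE; case: (boolP (x \in _)) => [|_].
    by rewrite inE/= mulr1 => <-; rewrite mulr_ge0.
  by rewrite !mulr0.
transitivity (\int[mu]_x \sum_(r \in range h)
    (r%:E * (w x * \1_(X @^-1` (h @^-1` [set r])) x)%:E))%E.
  apply: eq_integral => x _; rewrite fimfunE.
  rewrite fsbig_finite//= [in RHS]fsbig_finite//=.
  by rewrite mulr_suml -sumEFin; apply: eq_bigr => r _; rewrite -EFinM mulrA (mulrAC r).
rewrite ge0_integral_fsum//; last first.
  by move=> r; apply: (measurable_funeM r%:E (mwA r)).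
apply: eq_fsbigr => r; rewrite inE => -[x _ <-].
rewrite ge0_integralZl//; [|exact: mwA|by move=> y _; rewrite lee_fin mulr_ge0|by rewrite lee_fin].
congr (_ * _)%E; rewrite [RHS]integral_mkcond; apply: eq_integral => y _.
by rewrite patchE indicE; case: ifPn; rewrite ?mulr1 ?mulr0.
Qed.

(** Standard extension from indicators to simple functions to monotone limits. Two weighted spaces
    are allowed so that it serves twice: with both variables equal to [Y k], to pull one factor out
    of a product, and with the identity on the Lebesgue line, to turn a law into a density
    integral. *)
Lemma eq_weighted_integral d1 d2 (T1 : measurableType d1) (T2 : measurableType d2)
    (mu1 : {measure set T1 -> \bar R}) (mu2 : {measure set T2 -> \bar R})
    (X1 w1 : T1 -> R) (X2 w2 : T2 -> R) (c : R) (g : R -> R) :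
  measurable_fun setT X1 -> measurable_fun setT X2 ->
  measurable_fun setT w1 -> measurable_fun setT w2 ->
  (forall x, 0 <= w1 x) -> (forall x, 0 <= w2 x) -> 0 <= c ->
  (forall B, measurable B ->
    \int[mu1]_(x in X1 @^-1` B) (w1 x)%:E =
    c%:E * \int[mu2]_(x in X2 @^-1` B) (w2 x)%:E)%E ->
  measurable_fun setT g -> (forall x, 0 <= g x) ->
  (\int[mu1]_x (g (X1 x) * w1 x)%:E = c%:E * \int[mu2]_x (g (X2 x) * w2 x)%:E)%E.
Proof.
move=> mX1 mX2 mw1 mw2 w10 w20 c0 eqB mg g0.
have mgE : measurable_fun setT (EFin \o g) by exact/measurable_EFinP.
pose h := nnsfun_approx measurableT mgE.
have lim d (T : measurableType d) (mu : {measure set T -> \bar R}) (X w : T -> R) :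
    measurable_fun setT X -> measurable_fun setT w -> (forall x, 0 <= w x) ->
    (\int[mu]_x (h n (X x) * w x)%:E @[n --> \oo] --> \int[mu]_x (g (X x) * w x)%:E)%E.
  move=> mX mw w0.
  rewrite (_ : (\int[mu]_x (g (X x) * w x)%:E =
      \int[mu]_x (limn (fun n => (h n (X x) * w x)%:E)))%E); last first.
    apply: eq_integral => x _; apply/esym/cvg_lim => //.
    under eq_fun do rewrite EFinM.
    rewrite EFinM; apply: cvgeZr => //.
    by apply: cvg_nnsfun_approx => // y _; rewrite lee_fin.
  apply: cvg_monotone_convergence => //.
  - move=> n; apply/measurable_EFinP; apply: measurable_funM => //.
    by apply: measurableT_comp => //; exact: measurable_funP.
  - by move=> n x _; rewrite lee_fin mulr_ge0.
  - move=> x _ m n mn; rewrite lee_fin ler_wpM2r//.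
    exact/lefP/nd_nnsfun_approx.
have e n : (\int[mu1]_x (h n (X1 x) * w1 x)%:E =
            c%:E * \int[mu2]_x (h n (X2 x) * w2 x)%:E)%E.
  rewrite !integral_nnsfun_weighted// fsbig_finite//= [in RHS]fsbig_finite//=.
  rewrite ge0_sume_distrr; last first.
    (* Distributing [c] over the sum asks for nonnegative terms; a negative [r] has empty
       preimage. *)
    move=> r _; have [r0|r0] := ltP r 0.
      by rewrite preimage_nnfun0// preimage_set0 integral_set0 mule0.
    by rewrite mule_ge0 ?lee_fin// integral_ge0// => y _; rewrite lee_fin.
  apply: eq_bigr => r _; rewrite eqB; last exact: measurable_funPTI.
  by rewrite muleCA.
have l1 := lim _ _ mu1 X1 w1 mX1 mw1 w10.
suff l2 : (\int[mu1]_x (h n (X1 x) * w1 x)%:E @[n --> \oo] -->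
    c%:E * \int[mu2]_x (g (X2 x) * w2 x)%:E)%E by exact: cvg_unique l1 l2.
by rewrite (funext e); apply: cvgeZl => //; exact: lim.
Qed.

End weighted_integrals.

(** * Expectations of products of independent factors *)

Section independence.
Context {R : realType} d (T : measurableType d) (P : probability T R)
  (Y : nat -> T -> R).
Hypothesis mY : forall i, measurable_fun setT (Y i).
Hypothesis indY : mutually_independent P Y.

(** Induction on the number [k] of factors allowed to be general; the others are indicators, and
    [k = 0] is the definition of independence. The step applies [eq_weighted_integral] to the k-th
    factor, weighted by the product of the others; the induction hypothesis checks the identity on
    indicators. *)
Let indep_prod_partial (n k : nat) (h : nat -> R -> R) :
  (forall j, measurable_fun setT (h j)) -> (forall j x, 0 <= h j x) ->
  (forall j, \int[P]_w (h j (Y j w))%:E < +oo)%E ->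
  (forall j, (k <= j < n)%N -> exists2 B, measurable B & h j = \1_B) ->
  (\int[P]_w (\prod_(j < n) h j (Y j w))%:E =
   \prod_(j < n) \int[P]_w (h j (Y j w))%:E)%E.
Proof.
elim: k h => [|k ih] h mh h0 hoo hB.
  (* Indices beyond the product receive the dummy set [setT]. *)
  have /choice[B BE] j : exists B : set R, measurable B /\ ((j < n)%N -> h j = \1_B).
    have [jn|nj] := ltnP j n; last by exists setT; split.
    by have [B mB ->] := hB j jn; exists B.
  have mB j : measurable (B j) by have [] := BE j.
  have hE (j : 'I_n) : h j = \1_(B j) by have [_] := BE j; apply.
  transitivity (P (\bigcap_(i in [set` iota 0 n]) Y i @^-1` B i)); last first.
    rewrite indY ?iota_uniq// (_ : iota 0 n = index_iota 0 n); last by rewrite /index_iota subn0.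
    rewrite big_mkord.
    apply: eq_bigr => j _; rewrite hE.
    have mYB : measurable (Y j @^-1` B j) by exact: measurable_preimage.
    by rewrite -[in LHS](setIT (Y j @^-1` B j)) -integral_indic.
  have mI : measurable (\bigcap_(i in [set` iota 0 n]) Y i @^-1` B i).
    by apply: bigcap_measurableType => // i _; exact: measurable_preimage.
  rewrite -[in RHS](setIT (\bigcap_(i in _) _)) -integral_indic//.
  apply: eq_integral => w _; congr EFin.
  rewrite indicE; case: (boolP (w \in _)).
    rewrite inE/= => wB; rewrite big1// => i _.
    by rewrite hE indicE mem_set//; apply: wB; rewrite /= mem_iota/= add0n.
  rewrite notin_setE => wB; apply/eqP.
  apply: contra_notT wB => /prodf_neq0 nz i /=; rewrite mem_iota/= add0n => iin.
  apply: contrapT => nB; have := nz (Ordinal iin) isT.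
  by rewrite hE/= indicE memNset ?eqxx.
have [kn|nk] := ltnP k n; last first.
  by apply: ih => // j /andP[kj jn]; move: (leq_trans nk kj); rewrite leqNgt jn.
pose k' := Ordinal kn.
pose w0 := fun w => \prod_(j < n | j != k') h j (Y j w).
pose c := (\prod_(j < n | j != k') \int[P]_w (h j (Y j w))%:E)%E.
have i0 j : (0 <= \int[P]_w (h j (Y j w))%:E)%E.
  by apply: integral_ge0 => w _; rewrite lee_fin.
have c0 : (0 <= c)%E by apply: prode_ge0 => j _.
have mw0 : measurable_fun setT w0.
  rewrite (_ : w0 = fun w => \prod_(j < n) (if j != k' then h j (Y j w) else 1)); last first.
    by apply/funext => w; rewrite /w0 big_mkcond.
  apply: measurable_prod => j _; case: (j != k') => //.
  by apply: measurableT_comp => //; exact: mY.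
have w00 w : 0 <= w0 w by rewrite prodr_ge0.
have cE : c = (fine c)%:E.
  rewrite fineK//; apply: prode_fin_num => j _.
  by rewrite ge0_fin_numE.
have eqB A : measurable A ->
    (\int[P]_(w in Y k @^-1` A) (w0 w)%:E =
     (fine c)%:E * \int[P]_(w in Y k @^-1` A) (cst 1 w)%:E)%E.
  move=> mA; have mYA : measurable (Y k @^-1` A) by exact: measurable_preimage.
  have -> : (\int[P]_(w in Y k @^-1` A) (cst 1 w)%:E = P (Y k @^-1` A))%E.
    by etransitivity; [exact: (integral_cst P mYA 1%:E)|rewrite mul1e].
  rewrite -{1}cE.
  have IA : (\int[P]_w (\1_A (Y k w))%:E = P (Y k @^-1` A))%E.
    by rewrite -[in RHS](setIT (Y k @^-1` A)) -integral_indic.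
  have := ih (fun j => if j == k then \1_A else h j) _ _ _ _.
  rewrite (bigD1 k')//= eqxx IA muleC.
  rewrite [X in (X * _)%E](_ : _ = c); last first.
    by apply: eq_bigr => j jk; rewrite ifN.
  move=> <-.
  - rewrite integral_mkcond; apply: eq_integral => w _.
    rewrite (bigD1 k')//= eqxx patchE indicE.
    rewrite (_ : (w \in Y k @^-1` A) = (Y k w \in A)); last first.
      by apply/idP/idP; rewrite !inE.
    case: ifPn => _; rewrite ?mul0r// mul1r; congr EFin.
    by apply: eq_bigr => j jk; rewrite ifN.
  - by move=> j; case: ifP => // _; exact: measurable_indic.
  - by move=> j x; case: ifP => // _; rewrite indicE.
  - move=> j; case: ifP => // /eqP ->.
    by rewrite IA (le_lt_trans (probability_le1 _ _))// ltry.
  - move=> j /andP[kj jn]; case: eqP => [_|/eqP jk]; first by exists A.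
    by apply: hB; rewrite ltn_neqAle eq_sym jk kj.
have := @eq_weighted_integral R _ _ _ _ P P (Y k) w0 (Y k) (cst 1) (fine c) (h k)
  (mY k) (mY k) mw0 (measurable_cst _) w00 _ _ eqB (mh k) (h0 k).
rewrite -cE => eqh.
rewrite [RHS](bigD1 k')//= muleC -/c.
transitivity (\int[P]_x (h k (Y k x) * w0 x)%:E)%E.
  by apply: eq_integral => w _; rewrite (bigD1 k').
rewrite eqh//; last exact: fine_ge0.
by congr (_ * _)%E; apply: eq_integral => w _; rewrite mulr1.
Qed.

Lemma indep_prod (n : nat) (g : nat -> R -> R) :
  (forall j, measurable_fun setT (g j)) -> (forall j x, 0 <= g j x) ->
  (forall j, \int[P]_w (g j (Y j w))%:E < +oo)%E ->
  (\int[P]_w (\prod_(j < n) g j (Y j w))%:E =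
   \prod_(j < n) \int[P]_w (g j (Y j w))%:E)%E.
Proof.
move=> mg g0 goo; apply: (indep_prod_partial (k := n)) => // j.
by case: (leqP n j).
Qed.

End independence.

(** * Beta and Gamma integrals *)

Section powR_calculus.
Context {R : realType}.
Implicit Types (x s t u : R).
Notation mu := (@lebesgue_measure R).

Lemma powR_le1 x t : 0 <= x <= 1 -> 0 <= t -> x `^ t <= 1.
Proof.
move=> /andP[x0 x1] t0.
by have := ge0_ler_powR t0 (_ : x \in Num.nneg) (_ : 1 \in Num.nneg) x1; rewrite powR1 !nnegrE; apply.
Qed.

Lemma is_derive_onem_powR t x : x < 1 ->
  is_derive x 1 (fun y : R => (1 - y) `^ t) (- (t * (1 - x) `^ (t - 1))).
Proof.
move=> x1; have x0 : 0 < 1 - x by rewrite subr_gt0.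
have d1 : is_derive x 1 (fun y : R => 1 - y : R) (-1).
  apply: (is_derive_eq (is_deriveB (is_derive_cst (1 : R) x 1) (is_derive_id x 1))).
  by rewrite sub0r.
have := @is_derive1_comp R (fun y => y `^ t) (fun y => 1 - y) x _ _ (is_derive1_powR t x0) d1.
by rewrite mulrN1.
Qed.

Lemma continuous_powR_pos s x : 0 < x -> {for x, continuous (fun y : R => y `^ s)}.
Proof.
move=> x0; apply: differentiable_continuous; apply/derivable1_diffP.
by have [] := is_derive1_powR s x0.
Qed.

Lemma continuous_onem_powR t x :
  x < 1 -> {for x, continuous (fun y : R => (1 - y) `^ t)}.
Proof.
move=> x1; apply: differentiable_continuous; apply/derivable1_diffP.
by have [] := is_derive_onem_powR t x1.
Qed.

Lemma cvg_left1_onem_powR t : 0 < t -> (1 - x) `^ t @[x --> 1^'-] --> (0 : R).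
Proof.
move=> t0.
suff h : (1 - x : R) @[x --> (1:R)^'-] --> (0:R)^'+.
  exact: (@cvg_comp _ _ _ (fun x : R => 1 - x) (fun y => y `^ t) _ _ _ h (powR_cvg0 t0)).
move=> A [e /= e0 eA]; exists e => //= x xe x1.
apply: eA => /=; last by rewrite subr_gt0.
by rewrite sub0r normrN.
Qed.

(** The left end stays away from 0 because [s] may be negative; at 1 the positive power [t] makes
    the integrand continuous with value 0. *)
Lemma within_continuous_beta_integrand s t u : 0 < u < 1 -> 0 < t ->
  {within `[u, 1], continuous (fun x : R => x `^ s * (1 - x) `^ t)}.
Proof.
move=> /andP[u0 u1] t0; apply/continuous_within_itvP => //; split.
- move=> x; rewrite in_itv/= => /andP[ux x1].
  apply: cvgM; first by apply: continuous_powR_pos; exact: lt_trans ux.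
  exact: continuous_onem_powR.
- apply: cvg_at_right_filter.
  apply: cvgM; first exact: continuous_powR_pos.
  exact: continuous_onem_powR.
- apply: cvgM.
    by apply: cvg_at_left_filter; exact: continuous_powR_pos.
  by rewrite subrr powR0 ?gt_eqF//; exact: cvg_left1_onem_powR.
Qed.

Lemma integrable_beta_integrand s t u : 0 < u < 1 -> 0 < t ->
  mu.-integrable `[u, 1] (EFin \o (fun x : R => x `^ s * (1 - x) `^ t)).
Proof.
move=> u01 t0; apply: continuous_compact_integrable; first exact: segment_compact.
exact: within_continuous_beta_integrand.
Qed.

(** Integration by parts, as the fundamental theorem for [F]: the boundary term at 1 vanishes and
    the one at [u] remains. *)
Lemma parts_beta_integrand s t u : 0 < u < 1 -> 1 < t ->
  t * \int[mu]_(x in `[u, 1]) (x `^ s * (1 - x) `^ (t - 1)) =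
  s * \int[mu]_(x in `[u, 1]) (x `^ (s - 1) * (1 - x) `^ t) + u `^ s * (1 - u) `^ t.
Proof.
move=> u01 t1; have [u0 u1] := andP u01.
have t0 : 0 < t by exact: lt_trans t1.
have t10 : 0 < t - 1 by rewrite subr_gt0.
pose F := fun x : R => x `^ s * (1 - x) `^ t.
pose A := fun x : R => s * (x `^ (s - 1) * (1 - x) `^ t).
pose B := fun x : R => t * (x `^ s * (1 - x) `^ (t - 1)).
have iA : mu.-integrable `[u, 1] (EFin \o A).
  apply: (integrableZl _ s (integrable_beta_integrand (s-1) u01 t0)) => //.
have iB : mu.-integrable `[u, 1] (EFin \o B).
  apply: (integrableZl _ t (integrable_beta_integrand s u01 t10)) => //.
have dF x : x \in `]u, 1[ -> is_derive x 1 F (A x - B x).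
  rewrite in_itv/= => /andP[ux x1]; have x0 := lt_trans u0 ux.
  have d1 := is_derive1_powR s x0; have d2 := is_derive_onem_powR t x1.
  apply: is_derive_eq; rewrite /A /B /GRing.scale/=; ring.
have FTC : (\int[mu]_(x in `[u, 1%R]) ((A \- B) x)%:E = (F 1)%:E - (F u)%:E)%E.
  apply: continuous_FTC2 => //.
  - have cM (c : R) (g : R -> R) : {within `[u, 1], continuous g} ->
        {within `[u, 1], continuous (fun x => c * g x)}.
      by move=> cg x; apply: cvgM; [exact: cvg_cst|exact: cg].
    have cA := cM s _ (within_continuous_beta_integrand (s := s - 1) u01 t0).
    have cB := cM t _ (within_continuous_beta_integrand (s := s) u01 t10).
    by move=> x; apply: cvgB; [exact: cA|exact: cB].
  - have cF := within_continuous_beta_integrand (s := s) u01 t0.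
    have /continuous_within_itvP [] := cF => // _ Fu F1.
    by split => // x /dF[].
  - by move=> x xu1; rewrite derive1E; have [_ ->] := dF _ xu1.
have : \int[mu]_(x in `[u, 1]) (A x - B x) = F 1 - F u.
  by rewrite /Rintegral FTC.
rewrite RintegralB// RintegralZl//; last exact: integrable_beta_integrand.
rewrite RintegralZl//; last exact: integrable_beta_integrand.
rewrite /F subrr powR0 ?gt_eqF// mulr0 sub0r => /eqP.
by rewrite subr_eq => /eqP ->; ring.
Qed.

(** Parts with [s = - al] express the boundary term as [b * K + al * K'], and [0 <= K' <= K / u]
    since (1 - x) / x <= 1 / u on the interval. *)
Lemma tail_beta_integrand al b u : 0 <= al -> 0 < u < 1 -> 1 < b ->
  let K := \int[mu]_(x in `[u, 1]) (x `^ (- al) * (1 - x) `^ (b - 1)) in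
  b * K <= u `^ (- al) * (1 - u) `^ b <= (b + al / u) * K.
Proof.
move=> al0 u01 b1 /=; have [u0 u1] := andP u01.
have b0 : 0 < b by exact: lt_trans b1.
have b10 : 0 < b - 1 by rewrite subr_gt0.
set K := \int[mu]_(x in _) _.
pose K' := \int[mu]_(x in `[u, 1]) (x `^ (- al - 1) * (1 - x) `^ b).
have KE : b * K = - al * K' + u `^ (- al) * (1 - u) `^ b by exact: parts_beta_integrand.
have K'0 : 0 <= K' by apply: Rintegral_ge0 => x _; rewrite mulr_ge0 ?powR_ge0.
have K'K : K' <= u^-1 * K.
  rewrite /K -RintegralZl//; last exact: integrable_beta_integrand.
  apply: le_Rintegral => //.
  - exact: integrable_beta_integrand.
  - apply: (integrableZl _ u^-1 (integrable_beta_integrand (- al) u01 b10)) => //.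
  - move=> x /=; rewrite in_itv/= => /andP[ux x1].
    have x0 : 0 < x by exact: lt_le_trans ux.
    rewrite mulrA ler_pM ?powR_ge0//.
      rewrite powRD; last by rewrite (gt_eqF x0) implybT.
      rewrite mulrC ler_wpM2r ?powR_ge0// powR_inv1; last exact: ltW.
      by rewrite lef_pV2 ?posrE.
    have [->|x1'] := eqVneq x 1; first by rewrite subrr !powR0 ?gt_eqF.
    apply: ger_powR; last by rewrite gerBl.
    by rewrite subr_gt0 lt_neqAle x1' x1 gerBl ltW.
rewrite KE; apply/andP; split.
  by rewrite gerDr mulNr oppr_le0 mulr_ge0.
rewrite mulrDl KE -addrA addrCA lerDl mulNr.
by rewrite addrC subr_ge0 -mulrA ler_wpM2l.
Qed.

(** Improper integrals are reached from truncations at 1 / (n + 2), which lie strictly between 0 and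
    1 for every [n]. *)
Let trunc_cvg (f : R -> R) : measurable_fun setT f ->
    (forall x, 0 < x < 1 -> 0 <= f x) ->
  (\int[mu]_(x in `[n.+2%:R^-1%R, 1%R]) (f x)%:E @[n --> \oo] -->
   \int[mu]_(x in `]0%R, 1%R[) (f x)%:E)%E.
Proof.
move=> mf f0.
have mfE D : measurable_fun D (EFin \o f).
  exact/measurable_EFinP/measurable_funTS.
have E n : (\int[mu]_(x in `[n.+2%:R^-1%R, 1%R]) (f x)%:E =
    \int[mu]_(x in `[n.+2%:R^-1%R, 1%R[) (f x)%:E)%E.
  by rewrite integral_itv_bndo_bndc.
have U : `]0%R, 1%R[%classic = \bigcup_n `[n.+2%:R^-1, (1 : R)[%classic.
  apply/seteqP; split => x /=; rewrite in_itv/=.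
    move=> /andP[x0 x1]; exists (Num.truncn x^-1) => //=.
    rewrite in_itv/= x1 andbT invf_ple ?posrE//.
    have := truncnS_gt x^-1; rewrite -natr1 => /ltW /le_trans; apply.
    by rewrite -(natr1 _.+1) -natr1 lerDl.
  move=> [n _ /=]; rewrite in_itv/= => /andP[nx ->]; rewrite andbT.
  by apply: lt_le_trans nx; rewrite invr_gt0.
rewrite (funext E) U.
apply: ge0_nondecreasing_set_cvg_integral => //.
- move=> m n mn; rewrite subsetEset => x /=; rewrite !in_itv/= => /andP[mx ->].
  rewrite andbT (le_trans _ mx)// lef_pV2 ?posrE// ler_nat !ltnS; exact: mn.
- by move=> n; exact: mfE.
- move=> n x /=; rewrite in_itv/= => /andP[nx x1]; rewrite lee_fin f0// x1 andbT.
  by apply: lt_le_trans nx; rewrite invr_gt0.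
Qed.

Lemma measurable_beta_integrand s t : measurable_fun setT (fun x : R => x `^ s * (1 - x) `^ t).
Proof.
apply: measurable_funM; first exact: measurable_powR.
apply: (measurableT_comp (measurable_powR t)).
exact: measurable_funB.
Qed.

Let mbetaE s t (D : set R) : measurable_fun D (EFin \o (fun x : R => x `^ s * (1 - x) `^ t)).
Proof. by apply/measurable_EFinP/measurable_funTS; exact: measurable_beta_integrand. Qed.

Let u01 n : 0 < (n.+2%:R^-1 : R) < 1.
Proof. by rewrite invr_gt0 ltr0n/= invf_lt1// ltr1n. Qed.

Let J s t := (\int[mu]_(x in `]0%R, 1%R[) (x `^ s * (1 - x) `^ t)%:E)%E.

Let J0 s t : (0 <= J s t)%E.
Proof. by apply: integral_ge0 => x _; rewrite lee_fin mulr_ge0 ?powR_ge0. Qed.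

Let J_cvg s t : (J s t < +oo)%E -> 0 < t ->
  \int[mu]_(x in `[n.+2%:R^-1%R, 1%R]) (x `^ s * (1 - x) `^ t) @[n --> \oo] --> fine (J s t).
Proof.
move=> Joo t0; rewrite /Rintegral; apply: fine_cvg.
rewrite fineK ?ge0_fin_numE//.
by apply: (trunc_cvg (measurable_beta_integrand _ _)) => x _; rewrite mulr_ge0 ?powR_ge0.
Qed.

Let J_bound s t c : 0 < t ->
  (forall n, \int[mu]_(x in `[n.+2%:R^-1%R, 1%R]) (x `^ s * (1 - x) `^ t) <= c) ->
  (J s t <= c%:E)%E.
Proof.
move=> t0 h.
have f0 x : 0 < x < 1 -> 0 <= x `^ s * (1 - x) `^ t by rewrite mulr_ge0 ?powR_ge0.
have := trunc_cvg (measurable_beta_integrand s t) f0; apply: cvge_le; near=> n.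
have := h n; rewrite -lee_fin /Rintegral fineK//.
exact: (integrable_fin_num _ (integrable_beta_integrand s (u01 n) t0)).
Unshelve. all: end_near. Qed.

Let J_bounded s t : 0 <= s -> 0 < t -> (J s t <= 1)%E.
Proof.
move=> s0 t0; apply: (@le_trans _ _ (\int[mu]_(x in `]0%R, 1%R[) (cst 1%E x))%E).
  apply: ge0_le_integral => //.
  - by move=> x _; rewrite lee_fin mulr_ge0 ?powR_ge0.
  - exact: mbetaE.
  - move=> x /=; rewrite in_itv/= => /andP[x0 x1]; rewrite lee_fin.
    rewrite mulr_ile1 ?powR_ge0//.
      by rewrite powR_le1// !ltW.
    by rewrite powR_le1 ?(ltW t0)// subr_ge0 (ltW x1) gerBl ltW.
rewrite integral_cst// mul1e.
have := @lebesgue_measure_itv R `]0%R, 1%R[; rewrite /= lte_fin ltr01 oppr0 adde0 => ->.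
exact: lexx.
Qed.

(** The truncated parts formula bounds the integral with the singular power [s - 1] by [t / s],
    hence its finiteness; the boundary term is at most u^s and vanishes as the truncation is
    removed. *)
Let J_parts s t : 0 < s -> 1 < t ->
  (J (s - 1) t < +oo)%E /\ t * fine (J s (t - 1)) = s * fine (J (s - 1) t).
Proof.
move=> s0 t1; have t0 : 0 < t by exact: lt_trans t1.
have t10 : 0 < t - 1 by rewrite subr_gt0.
have B1 : (J s (t - 1) <= 1)%E by apply: J_bounded => //; exact: ltW.
have B1oo : (J s (t - 1) < +oo)%E by rewrite (le_lt_trans B1)// ltry.
have F1 : fine (J s (t - 1)) <= 1.
  by rewrite -lee_fin fineK// ge0_fin_numE.
have K1 n : \int[mu]_(x in `[n.+2%:R^-1%R, 1%R]) (x `^ s * (1 - x) `^ (t - 1)) <= 1.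
  apply: le_trans F1; rewrite /Rintegral fine_le//.
  - exact: (integrable_fin_num _ (integrable_beta_integrand s (u01 n) t10)).
  - by rewrite ge0_fin_numE.
  - rewrite -integral_itv_bndo_bndc; last exact: mbetaE.
    apply: ge0_subset_integral => //.
    + exact: mbetaE.
    + by move=> x _; rewrite lee_fin mulr_ge0 ?powR_ge0.
    + move=> x /=; rewrite !in_itv/= => /andP[nx ->]; rewrite andbT.
      by apply: lt_le_trans nx; have /andP[] := u01 n.
have Jle : (J (s - 1) t <= (t / s)%:E)%E.
  apply: J_bound => // n; rewrite ler_pdivlMr// mulrC.
  have := parts_beta_integrand s (u01 n) t1 => E.
  apply: (@le_trans _ _ (t * 1)); last by rewrite mulr1.
  apply: le_trans (ler_wpM2l (ltW t0) (K1 n)).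
  by rewrite E lerDl mulr_ge0 ?powR_ge0.
have Joo : (J (s - 1) t < +oo)%E by rewrite (le_lt_trans Jle)// ltry.
split; first exact: Joo.
have c1 : t * \int[mu]_(x in `[n.+2%:R^-1, 1%R]) (x `^ s * (1 - x) `^ (t - 1)) @[n --> \oo]
    --> t * fine (J s (t - 1)).
  by apply: cvgMr; exact: J_cvg.
have hu : n.+2%:R^-1 @[n --> \oo] --> (0 : R)^'+.
  have h : (n.+2%:R^-1 : R) @[n --> \oo] --> (0 : R).
    by have := @cvg_harmonic R; rewrite -cvg_shiftS.
  move=> A [e /= e0 eA]; have /cvgrPdist_lt /(_ e e0) [m _ hm] := h.
  exists m => // n mn /=; apply: eA; last by have /andP[] := u01 n.
  exact: hm.
have us : (n.+2%:R^-1 : R) `^ s @[n --> \oo] --> (0 : R).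
  exact: (@cvg_comp _ _ _ (fun n : nat => n.+2%:R^-1 : R) (fun y => y `^ s) _ _ _ hu (powR_cvg0 s0)).
have c3 : (n.+2%:R^-1 : R) `^ s * (1 - n.+2%:R^-1) `^ t @[n --> \oo] --> (0 : R).
  apply: (@squeeze_cvgr _ _ _ _ (cst 0) (fun n => n.+2%:R^-1 `^ s)); last exact: us.
    near=> n; rewrite mulr_ge0 ?powR_ge0//= ler_piMr ?powR_ge0//.
    by have /andP[n0 n1] := u01 n; rewrite powR_le1 ?(ltW t0)// subr_ge0 (ltW n1) gerBl ltW.
  exact: cvg_cst.
have c2 : t * \int[mu]_(x in `[n.+2%:R^-1, 1%R]) (x `^ s * (1 - x) `^ (t - 1)) @[n --> \oo]
    --> s * fine (J (s - 1) t) + 0.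
  rewrite (_ : (fun n => _) =
    (fun n => s * \int[mu]_(x in `[n.+2%:R^-1, 1%R]) (x `^ (s - 1) * (1 - x) `^ t) +
     n.+2%:R^-1 `^ s * (1 - n.+2%:R^-1) `^ t)); last first.
    by apply/funext => n; exact: parts_beta_integrand.
  by apply: cvgD; [apply: cvgMr; exact: J_cvg|exact: c3].
by have := cvg_unique _ c1 c2; rewrite addr0; apply.
Unshelve. all: end_near. Qed.

(** [Beta_fun] is a real-valued integral and would read 0 if the integral were infinite. Finiteness
    comes from multiplying the integrand by x + (1 - x): one part has integrand at most 1, the other
    is finite by [J_parts]. *)
Lemma Beta_fun_int s t : 0 < s -> 1 < t ->
  (\int[mu]_(x in `]0%R, 1%R[) (x `^ (s - 1) * (1 - x) `^ (t - 1))%:E =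
   (Beta_fun s t)%:E)%E.
Proof.
move=> s0 t1.
have t10 : 0 < t - 1 by rewrite subr_gt0.
have e x : x \in `]0%R, 1%R[%classic -> ((x `^ (s - 1) * (1 - x) `^ (t - 1))%:E =
  (x `^ s * (1 - x) `^ (t - 1))%:E + (x `^ (s - 1) * (1 - x) `^ t)%:E)%E.
  rewrite inE/= in_itv/= => /andP[x0 x1]; rewrite -EFinD; congr EFin.
  by rewrite -(mulr_powRB1 (ltW x0) s0) -(mulr_powRB1 _ (lt_trans ltr01 t1)) ?subr_ge0 ?(ltW x1)//; ring.
rewrite /Beta_fun /Rintegral fineK// ge0_fin_numE; last exact: (J0 (s-1) (t-1)).
rewrite (_ : \int[mu]_(x in `]0%R, 1%R[) (x `^ (s - 1) * (1 - x) `^ (t - 1))%:E =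
  \int[mu]_(x in `]0%R, 1%R[) ((x `^ s * (1 - x) `^ (t - 1))%:E + (x `^ (s - 1) * (1 - x) `^ t)%:E))%E; last first.
  by apply: eq_integral => x; exact: e.
rewrite ge0_integralD//.
- rewrite lte_add_pinfty//.
    by rewrite (le_lt_trans (J_bounded (ltW s0) t10))// ltry.
  by have [] := J_parts s0 t1.
- by move=> x _; rewrite lee_fin mulr_ge0 ?powR_ge0.
- exact: mbetaE.
- by move=> x _; rewrite lee_fin mulr_ge0 ?powR_ge0.
- exact: mbetaE.
Qed.

Lemma Beta_fun_splitD s t : 0 < s -> 1 < t ->
  Beta_fun s t = Beta_fun (s + 1) t + Beta_fun s (t + 1).
Proof.
move=> s0 t1.
have s10 : 0 < s + 1 by rewrite addr_gt0.
have t10 : 1 < t + 1 by rewrite ltrDr (lt_trans _ t1).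
apply: EFin_inj; rewrite EFinD -!Beta_fun_int// -ge0_integralD//.
- apply: eq_integral => x; rewrite inE/= in_itv/= => /andP[x0 x1]; rewrite -EFinD; congr EFin.
  rewrite !addrK -(mulr_powRB1 (ltW x0) s0) -(mulr_powRB1 _ (lt_trans ltr01 t1)) ?subr_ge0 ?(ltW x1)//.
  by ring.
- by move=> x _; rewrite lee_fin mulr_ge0 ?powR_ge0.
- exact: mbetaE.
- by move=> x _; rewrite lee_fin mulr_ge0 ?powR_ge0.
- exact: mbetaE.
Qed.

Lemma Beta_fun_parts s t : 0 < s -> 1 < t ->
  t * Beta_fun (s + 1) t = s * Beta_fun s (t + 1).
Proof.
move=> s0 t1; have [_] := J_parts s0 t1.
by rewrite /Beta_fun !addrK.
Qed.

(** Bounded below by the part over [1/2, 1], which is positive because its boundary term in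
    [tail_beta_integrand] is. *)
Lemma Beta_fun_gt0 s t : 0 < s <= 1 -> 1 < t -> 0 < Beta_fun s t.
Proof.
move=> /andP[s0 s1] t1; have t10 : 0 < t - 1 by rewrite subr_gt0.
have t0 : 0 < t by exact: lt_trans t1.
have al0 : 0 <= 1 - s by rewrite subr_ge0.
have := tail_beta_integrand al0 (u01 0) t1; rewrite opprB /=.
set K := \int[mu]_(x in _) _ => /andP[_ h].
have K0 : 0 < K.
  have : 0 < (t + (1 - s) / 2^-1) * K.
    apply: lt_le_trans h; rewrite mulr_gt0// powR_gt0//.
    by rewrite subr_gt0; have /andP[] := u01 0.
  by rewrite pmulr_rgt0// ltr_pwDl// mulr_ge0.
apply: (lt_le_trans K0).
rewrite -lee_fin -Beta_fun_int// /K /Rintegral fineK; last first.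
  exact: (integrable_fin_num _ (integrable_beta_integrand (s - 1) (u01 0) t10)).
rewrite -integral_itv_bndo_bndc; last exact: mbetaE.
apply: ge0_subset_integral => //.
- exact: mbetaE.
- by move=> x _; rewrite lee_fin mulr_ge0 ?powR_ge0.
- move=> x /=; rewrite !in_itv/= => /andP[nx ->]; rewrite andbT.
  by apply: lt_le_trans nx; have /andP[] := u01 0.
Qed.

End powR_calculus.

(** * Gamma integrals and the asymptotics of the beta function *)

Section Gamma.
Context {R : realType}.
Implicit Types (x s t u c a b : R).
Notation mu := (@lebesgue_measure R).

Lemma measurable_Gamma_integrand s c :
  measurable_fun setT (fun x : R => x `^ s * expR (- (c * x))).
Proof.
apply: measurable_funM; first exact: measurable_powR.
apply: measurableT_comp => //; apply: measurableT_comp => //.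
Qed.

Let mG s c (D : set R) : measurable_fun D (EFin \o (fun x : R => x `^ s * expR (- (c * x)))).
Proof.
by apply/measurable_EFinP/measurable_funTS; exact: measurable_Gamma_integrand.
Qed.

Let G s c := (\int[mu]_(x in `]0%R, +oo[) (x `^ s * expR (- (c * x)))%:E)%E.

(** The parameter [c] matches truncations under the substitution x -> c x, which carries the ray
    from 1 / (n + 1) to the ray from c / (n + 1). *)
Let trunc_cvg (f : R -> R) c : 0 < c -> measurable_fun setT f ->
    (forall x, 0 < x -> 0 <= f x) ->
  (\int[mu]_(x in `[(c * n.+1%:R^-1)%R, +oo[) (f x)%:E @[n --> \oo] -->
   \int[mu]_(x in `]0%R, +oo[) (f x)%:E)%E.
Proof.
move=> c0 mf f0.
have cn n : 0 < c * n.+1%:R^-1 by rewrite mulr_gt0.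
have U : `]0%R, +oo[%classic = \bigcup_n `[(c * n.+1%:R^-1)%R, +oo[%classic.
  apply/seteqP; split => x /=; rewrite in_itv/= andbT.
    move=> x0; exists (Num.truncn (c / x)) => //=.
    rewrite in_itv/= andbT ler_pdivrMr// mulrC -ler_pdivrMr//.
    exact/ltW/truncnS_gt.
  by move=> [n _ /=]; rewrite in_itv/= andbT; exact: lt_le_trans.
rewrite U; apply: ge0_nondecreasing_set_cvg_integral => //.
- move=> m n mn; rewrite subsetEset => x /=; rewrite !in_itv/= !andbT => mx.
  by rewrite (le_trans _ mx)// ler_wpM2l ?(ltW c0)// lef_pV2 ?posrE// ler_nat; exact: mn.
- by move=> n; apply/measurable_EFinP; exact: measurable_funTS.
- move=> n x /=; rewrite in_itv/= andbT => nx; rewrite lee_fin f0//.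
  exact: lt_le_trans nx.
Qed.

(** The change of variables is done on closed rays away from 0, where the integrand is continuous
    even for negative [s]; both sides then converge. *)
Lemma Gamma_integral_scale s c : 0 < c ->
  (\int[mu]_(x in `]0%R, +oo[) (x `^ s * expR (- x))%:E =
   (c `^ (s + 1))%:E * \int[mu]_(x in `]0%R, +oo[) (x `^ s * expR (- (c * x)))%:E)%E.
Proof.
move=> c0.
pose f x := x `^ s * expR (- x).
have fE : f = (fun x => x `^ s * expR (- (1 * x))) by apply/funext => x; rewrite mul1r.
have mf : measurable_fun setT f by rewrite fE; exact: measurable_Gamma_integrand.
have f0 x : 0 < x -> 0 <= f x by rewrite mulr_ge0 ?powR_ge0// expR_ge0.
pose g x := c `^ (s + 1) * (x `^ s * expR (- (c * x))).
have mg : measurable_fun setT g.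
  by apply: measurable_funM => //; exact: measurable_Gamma_integrand.
have g0 x : 0 < x -> 0 <= g x by rewrite !mulr_ge0 ?powR_ge0// expR_ge0.
rewrite -ge0_integralZl//; last 2 first.
- by move=> x _; rewrite lee_fin mulr_ge0 ?powR_ge0// expR_ge0.
- by rewrite lee_fin powR_ge0.
have l1 := trunc_cvg c0 mf f0.
have l2 := trunc_cvg ltr01 mg g0.
apply: cvg_unique l1 _ => //.
rewrite (_ : (fun n => _) = (fun n => \int[mu]_(x in `[(1 * n.+1%:R^-1)%R, +oo[) (g x)%:E)%E)//.
apply/funext => n; rewrite mul1r.
have n0 : 0 < (n.+1%:R^-1 : R) by rewrite invr_gt0.
have dF x : is_derive x 1 (fun y => c * y : R) c.
  by apply: is_derive_eq; rewrite /GRing.scale/= mulr1.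
have dFE : (fun y => c * y : R)^`()%classic = cst c.
  by apply/funext => x; rewrite derive1E; have [_ ->] := dF x.
have cF : continuous (fun y => c * y : R).
  by move=> x; apply: cvgM; [exact: cvg_cst|exact: cvg_id].
rewrite (@increasing_ge0_integration_by_substitutiony R (fun y => c * y) f n.+1%:R^-1).
- apply: eq_integral => x; rewrite inE/= in_itv/= andbT => nx.
  have x0 : 0 < x by exact: lt_le_trans nx.
  transitivity (f (c * x) * c)%:E; first by rewrite -[in RHS](_ : (fun y : R => c * y)^`()%classic x = c) ?dFE.
  congr EFin; rewrite /f /g powRM ?(ltW c0) ?(ltW x0)//.
  rewrite powRD; last by rewrite (gt_eqF c0) implybT.
  by rewrite powRr1 ?(ltW c0)//; ring.
- by move=> x y _ _ xy; rewrite ltr_pM2l.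
- by rewrite dFE => x _; exact: cvg_cst.
- by rewrite dFE; exact: is_cvg_cst.
- by rewrite dFE; exact: is_cvg_cst.
- split; first by move=> x _; have [] := dF x.
  exact/cvg_at_right_filter/cF.
- by apply: gt0_cvgMry => //; exact: cvg_id.
- apply/continuous_within_itvcyP; split.
    move=> x; rewrite in_itv/= andbT => nx.
    have x0 : 0 < x by apply: lt_trans nx; rewrite mulr_gt0.
    apply: cvgM; first exact: continuous_powR_pos.
    by apply: continuous_comp; [exact: continuousN|exact: continuous_expR].
  apply: cvg_at_right_filter.
  apply: cvgM; first by apply: continuous_powR_pos; rewrite mulr_gt0.
  by apply: continuous_comp; [exact: continuousN|exact: continuous_expR].
- move=> x; rewrite in_itv/= andbT => nx; apply: f0.
  by apply: lt_trans nx; rewrite mulr_gt0.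
exact: mG.
Qed.

Lemma powR_le_expR_half r x : - 1 <= r <= 2 -> 2^-1 <= x -> x `^ r <= 10 * expR (x / 2).
Proof.
move=> /andP[r1 r2] hx; have x0 : 0 < x by apply: lt_le_trans hx; rewrite invr_gt0.
have e1 : 1 <= expR (x / 2) by rewrite -expR0 ler_expR divr_ge0// ltW.
have [x1|x1] := leP 1 x.
  apply: (@le_trans _ _ (x `^ 2)); first exact: ler_powR.
  have := expR_ge1Dxn 1 (divr_ge0 (ltW x0) (ler0n R 2)).
  have -> : x `^ 2 = x ^+ 2 by apply: powR_mulrn; exact: ltW.
  by rewrite expr_div_n (_ : 2`!%:R = 2 :> R)//; lra.
apply: (@le_trans _ _ (x `^ (-1))); first by apply: ger_powR => //; rewrite x0 ltW.
rewrite powR_inv1 ?(ltW x0)//.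
have : x^-1 <= 2 by rewrite invf_ple ?posrE.
lra.
Qed.

Let patch_beta s t x : 0 <= ((fun x : R => x `^ s * (1 - x) `^ t) \_ `]0, 1[) x.
Proof. by rewrite patchE; case: ifP => // _; rewrite mulr_ge0 ?powR_ge0. Qed.

Let mpatch_beta s t : measurable_fun setT ((fun x : R => x `^ s * (1 - x) `^ t) \_ `]0, 1[).
Proof.
by apply/measurable_restrict => //; apply: measurable_funTS; exact: measurable_beta_integrand.
Qed.

Let integral_patch_beta s t : 0 < s -> 1 < t ->
  (\int[mu]_(x in `]0%R, +oo[)
     (((fun x : R => x `^ (s - 1) * (1 - x) `^ (t - 1)) \_ `]0%R, 1%R[) x)%:E
   = (Beta_fun s t)%:E)%E.
Proof.
move=> s0 t1; rewrite -Beta_fun_int// integral_mkcond [RHS]integral_mkcond.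
apply: eq_integral => x _; rewrite !patchE.
case: ifPn => [|xn]; first by case: ifP.
rewrite memNset//= in_itv/= => /andP[x0 x1].
by move: xn; rewrite notin_setE/= in_itv/= x0.
Qed.

(** Dominated below 1/2 by 4 times a beta integrand, as (1 - x)^2 >= 1/4 there, and beyond 1/2 by 20
    times the exponential density of rate 1/2, through [powR_le_expR_half]. *)
Lemma Gamma_integral_fin s : -1 < s <= 2 ->
  (\int[mu]_(x in `]0%R, +oo[) (x `^ s * expR (- x))%:E < +oo)%E.
Proof.
move=> /andP[s1 s2].
have s0 : 0 < s + 1 by rewrite -ltrBlDr sub0r.
pose A := (fun x : R => x `^ (s + 1 - 1) * (1 - x) `^ (3 - 1)) \_ `]0, 1[.
pose B := exponential_pdf (2^-1 : R).
have mB : measurable_fun setT B by exact: measurable_exponential_pdf.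
have B0 x : 0 <= B x by exact: exponential_pdf_ge0.
have fE : (fun x : R => x `^ s * expR (- x)) = (fun x => x `^ s * expR (- (1 * x))).
  by apply/funext => x; rewrite mul1r.
apply: (@le_lt_trans _ _
   (\int[mu]_(x in `]0%R, +oo[) (4%:E * (A x)%:E + 20%:E * (B x)%:E))%E).
  apply: ge0_le_integral => //.
  - by move=> x _; rewrite lee_fin mulr_ge0 ?powR_ge0// expR_ge0.
  - by apply/measurable_EFinP/measurable_funTS; rewrite fE; exact: measurable_Gamma_integrand.
  - apply: measurable_funTS; apply: emeasurable_funD; apply: measurable_funeM;
      by apply/measurable_EFinP => //; exact: mpatch_beta.
  - move=> x /=; rewrite in_itv/= andbT => x0.
    rewrite -!EFinM -EFinD lee_fin.
    have hB : B x = 2^-1 * expR (- (x / 2)).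
      rewrite /B /exponential_pdf patchE mem_set/= ?in_itv/= ?(ltW x0)//; congr (_ * expR _).
      by rewrite mulNr mulrC.
    have [hx|hx] := leP 2^-1 x.
      apply: ler_wpDl; first by rewrite mulr_ge0 ?patch_beta.
      rewrite hB.
      have -> : expR (- x) = expR (- (x / 2)) * expR (- (x / 2)).
        by rewrite -expRD; congr expR; lra.
      have := @powR_le_expR_half s x _ hx; rewrite (ltW s1) s2 => /(_ isT) h.
      have e0 := expR_gt0 (- (x / 2)).
      have ee : expR (x / 2) * expR (- (x / 2)) = 1 by rewrite expRxMexpNx_1.
      rewrite mulrA (_ : 20 * (2^-1 * expR (- (x / 2))) = 10 * expR (- (x / 2))); last lra.
      rewrite ler_wpM2r ?(ltW e0)//.
      apply: (@le_trans _ _ (10 * expR (x / 2) * expR (- (x / 2)))).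
        by rewrite ler_wpM2r// ltW.
      by rewrite -mulrA ee mulr1.
    apply: ler_wpDr; first by rewrite mulr_ge0.
    rewrite /A patchE mem_set/= ?in_itv/= ?x0 ?(lt_trans hx)//; last lra.
    rewrite addrK mulrCA ler_wpM2l ?powR_ge0//.
    apply: (@le_trans _ _ 1); first by rewrite expR_le1 oppr_le0 ltW.
    rewrite (_ : 3 - 1 = 2%:R); last lra.
    rewrite powR_mulrn; nra.
rewrite ge0_integralD//; last 4 first.
- by move=> x _; rewrite mule_ge0 ?lee_fin ?patch_beta.
- by apply: measurable_funTS; apply: measurable_funeM; apply/measurable_EFinP; exact: mpatch_beta.
- by move=> x _; rewrite mule_ge0 ?lee_fin.
- by apply: measurable_funTS; apply: measurable_funeM; apply/measurable_EFinP.
rewrite !ge0_integralZl//; last 4 first.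
- by apply: measurable_funTS; apply/measurable_EFinP.
- by move=> x _; rewrite lee_fin.
- by apply: measurable_funTS; apply/measurable_EFinP; exact: mpatch_beta.
- by move=> x _; rewrite lee_fin patch_beta.
rewrite integral_patch_beta// ?ltr1n//.
rewrite lte_add_pinfty ?lte_mul_pinfty ?ltry//.
apply: (@le_lt_trans _ _ (\int[mu]_x (B x)%:E)%E).
  apply: ge0_subset_integral => //; first exact/measurable_EFinP.
  by move=> x _; rewrite lee_fin.
by rewrite integral_exponential_pdf ?invr_gt0// ltry.
Qed.

Lemma Gamma_fun_int s : 0 < s <= 3 ->
  (\int[mu]_(x in `]0%R, +oo[) (x `^ (s - 1) * expR (- x))%:E = (Gamma_fun s)%:E)%E.
Proof.
move=> /andP[s0 s3]; rewrite /Gamma_fun /Rintegral fineK// ge0_fin_numE.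
  by apply: Gamma_integral_fin; lra.
by apply: integral_ge0 => x _; rewrite lee_fin mulr_ge0 ?powR_ge0 ?expR_ge0.
Qed.

(** Counterpart of 1 - x <= e^(-x), from e^(-y) <= 1 / (1 + y) with y = x + 2 x^2. Together they
    turn (1 - u)^b and products of terms 1 - p into exponentials with a quadratic error. *)
Lemma expR_le_onem x : 0 <= x <= 2^-1 -> expR (- (x + 2 * x ^+ 2)) <= 1 - x.
Proof.
move=> /andP[x0 x1].
rewrite expRN; have y0 : 0 < 1 + (x + 2 * x ^+ 2) by nra.
apply: (@le_trans _ _ (1 + (x + 2 * x ^+ 2))^-1).
  by rewrite lef_pV2 ?posrE ?expR_gt0// expR_ge1Dx.
by rewrite invf_ple ?posrE//; [rewrite -[leLHS]mul1r ler_pdivrMr; nra|lra].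
Qed.

(** Rescale the Gamma integral by [b - 1] and use 1 - x <= e^(-x) on ]0, 1[. *)
Lemma Beta_fun_le_Gamma a b : 0 < a <= 1 -> 1 < b ->
  (b - 1) `^ a * Beta_fun a b <= Gamma_fun a.
Proof.
move=> /andP[a0 a1] b1; have b10 : 0 < b - 1 by rewrite subr_gt0.
rewrite -lee_fin EFinM -Gamma_fun_int; last lra.
rewrite (Gamma_integral_scale _ b10) subrK lee_wpmul2l// ?lee_fin ?powR_ge0//.
rewrite -Beta_fun_int//.
apply: (@le_trans _ _ (\int[mu]_(x in `]0%R, 1%R[) (x `^ (a - 1) * expR (- ((b - 1) * x)))%:E)%E).
  apply: ge0_le_integral => //.
  - by move=> x _; rewrite lee_fin mulr_ge0 ?powR_ge0.
  - by apply/measurable_EFinP/measurable_funTS; exact: measurable_beta_integrand.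
  - exact: mG.
  - move=> x /=; rewrite in_itv/= => /andP[x0 x1]; rewrite lee_fin.
    rewrite ler_wpM2l ?powR_ge0//.
    rewrite (_ : - ((b - 1) * x) = - x * (b - 1)); last by ring.
    rewrite expRM ge0_ler_powR ?nnegrE ?(ltW b10) ?expR_ge0//.
      by rewrite subr_ge0 ltW.
    by have := expR_ge1Dx (- x).
apply: ge0_subset_integral => //.
- exact: mG.
- by move=> x _; rewrite lee_fin mulr_ge0 ?powR_ge0 ?expR_ge0.
- by move=> x /=; rewrite !in_itv/= => /andP[->].
Qed.

(** Rescale by [b]. For x < 1/2, (1 - x)^b >= e^(-bx - 2bx^2) >= (1 - 2bx^2) e^(-bx), and the loss
    2bx^2 integrates to the second term. For x >= 1/2 the loss alone dominates, as 2bx^2 >= 1. *)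
Lemma Gamma_le_Beta_fun a b : 0 < a <= 1 -> 4 <= b ->
  Gamma_fun a <= b `^ a * Beta_fun a b + 2 / b * Gamma_fun (a + 2).
Proof.
move=> /andP[a0 a1] b4.
have b0 : 0 < b by lra.
have b1 : 1 < b by lra.
rewrite -lee_fin EFinD !EFinM -!Gamma_fun_int; [|lra|lra].
rewrite !(Gamma_integral_scale _ b0) subrK.
have -> : a + 2 - 1 + 1 = a + 2 by ring.
have -> : ((2 / b)%:E * ((b `^ (a + 2))%:E * \int[mu]_(x in `]0%R, +oo[)
     (x `^ (a + 2 - 1) * expR (- (b * x)))%:E) =
   (b `^ a)%:E * ((2 * b)%:E * \int[mu]_(x in `]0%R, +oo[)
     (x `^ (a + 2 - 1) * expR (- (b * x)))%:E))%E.
  rewrite !muleA -!EFinM; congr (_%:E * _)%E.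
  rewrite powRD; last by rewrite (gt_eqF b0) implybT.
  have -> : b `^ 2 = b ^+ 2 by apply: powR_mulrn; exact: ltW.
  by field; rewrite gt_eqF.
rewrite -integral_patch_beta// -ge0_muleDr; last 2 first.
- by apply: integral_ge0 => x _; rewrite lee_fin patch_beta.
- rewrite mule_ge0 ?lee_fin ?mulr_ge0 ?(ltW b0)//.
  by apply: integral_ge0 => x _; rewrite lee_fin mulr_ge0 ?powR_ge0 ?expR_ge0.
rewrite lee_wpmul2l ?lee_fin ?powR_ge0//.
rewrite -ge0_integralZl//; last 2 first.
- by move=> x _; rewrite lee_fin mulr_ge0 ?powR_ge0 ?expR_ge0.
- by rewrite lee_fin mulr_ge0 ?(ltW b0).
rewrite -ge0_integralD//; last 4 first.
- by move=> x _; rewrite lee_fin patch_beta.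
- by apply/measurable_EFinP/measurable_funTS; exact: mpatch_beta.
- by move=> x _; rewrite -EFinM lee_fin !mulr_ge0 ?powR_ge0 ?expR_ge0 ?(ltW b0).
- by apply: measurable_funeM; exact: mG.
apply: ge0_le_integral => //.
- by move=> x _; rewrite lee_fin mulr_ge0 ?powR_ge0 ?expR_ge0.
- exact: mG.
- apply: emeasurable_funD.
    by apply/measurable_EFinP/measurable_funTS; exact: mpatch_beta.
  by apply: measurable_funeM; exact: mG.
move=> x /=; rewrite in_itv/= andbT => x0.
rewrite -EFinM -EFinD lee_fin.
have -> : a + 2 - 1 = (a - 1) + 2 by ring.
rewrite [x `^ (a - 1 + 2)]powRD; last by rewrite (gt_eqF x0) implybT.
have -> : x `^ 2 = x ^+ 2 by apply: powR_mulrn; exact: ltW.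
have p0 : 0 <= x `^ (a - 1) by exact: powR_ge0.
have e0 := expR_gt0 (- (b * x)).
have [hx|hx] := leP 2^-1 x.
  apply: ler_wpDl; first exact: patch_beta.
  have -> : 2 * b * (x `^ (a - 1) * x ^+ 2 * expR (- (b * x))) =
    (2 * b * x ^+ 2) * (x `^ (a - 1) * expR (- (b * x))) by ring.
  rewrite ler_peMl ?mulr_ge0 ?(ltW e0)//; nra.
rewrite patchE mem_set/= ?in_itv/= ?x0 ?(lt_trans hx)//; last lra.
have -> : 2 * b * (x `^ (a - 1) * x ^+ 2 * expR (- (b * x))) =
    x `^ (a - 1) * ((2 * b * x ^+ 2) * expR (- (b * x))) by ring.
rewrite -mulrDr ler_wpM2l// -lerBlDr.
rewrite -[leLHS](_ : (1 - 2 * b * x ^+ 2) * expR (- (b * x)) = _); last by ring.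
have x1 : 0 <= 1 - x by lra.
apply: (@le_trans _ _ ((1 - x) `^ b)); last first.
  apply: ger_powR; lra.
apply: (@le_trans _ _ (expR (- (x + 2 * x ^+ 2)) `^ b)); last first.
  rewrite ge0_ler_powR ?nnegrE ?(ltW b0) ?expR_ge0//.
  by apply: expR_le_onem; rewrite (ltW x0) (ltW hx).
rewrite -expRM (_ : - (x + 2 * x ^+ 2) * b = - (2 * b * x ^+ 2) + - (b * x)); last by ring.
by rewrite expRD ler_wpM2r ?(ltW e0)// expR_ge1Dx.
exact: mG.
Qed.

Lemma Gamma_fun_gt0 a : 0 < a <= 1 -> 0 < Gamma_fun a.
Proof.
move=> a01; apply: lt_le_trans (Beta_fun_le_Gamma a01 (ltr1n R 2)).
by rewrite mulr_gt0 ?powR_gt0 ?Beta_fun_gt0 ?ltr1n//; lra.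
Qed.

Lemma cvgy_inv : x^-1 @[x --> +oo] --> (0 : R).
Proof.
apply/cvgrPdist_le => e e0; near=> x.
have x0 : 0 < x by near: x; apply: nbhs_pinfty_gt; rewrite num_real.
rewrite sub0r normrN normfV gtr0_norm// invf_ple ?posrE//.
Unshelve. all: end_near. Qed.

(** Squeeze between the two previous bounds. In the upper one (b / (b - 1))^a is replaced by b / (b
    - 1), which is at least as large because [a <= 1]. *)
Lemma cvg_powR_Beta_fun a : 0 < a <= 1 ->
  b `^ a * Beta_fun a b @[b --> +oo] --> Gamma_fun a.
Proof.
move=> /[dup] a01 /andP[a0 a1].
apply: (@squeeze_cvgr _ _ _ _ (fun b => Gamma_fun a - 2 / b * Gamma_fun (a + 2))
  (fun b => (1 - b^-1)^-1 * Gamma_fun a)).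
- near=> b; have b4 : 4 <= b by near: b; apply: nbhs_pinfty_ge; rewrite num_real.
  apply/andP; split; first by rewrite lerBlDr; exact: Gamma_le_Beta_fun.
  have b1 : 1 < b by lra.
  have b0 : 0 < b by lra.
  have bV1 : b^-1 < 1 by rewrite invf_lt1.
  have bb : (1 - b^-1)^-1 = b / (b - 1).
    by field; rewrite subr_eq0 gt_eqF//= gt_eqF.
  rewrite bb; have B0 : 0 < Beta_fun a b by exact: Beta_fun_gt0.
  apply: (@le_trans _ _ (b / (b - 1) * ((b - 1) `^ a * Beta_fun a b))); last first.
    rewrite ler_wpM2l// ?divr_ge0 ?Beta_fun_le_Gamma//; lra.
  rewrite mulrA ler_wpM2r ?(ltW B0)//.
  have -> : b `^ a = (b / (b - 1)) `^ a * (b - 1) `^ a.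
    rewrite -powRM ?divr_ge0//; [|lra|lra].
    by congr (_ `^ _); field; rewrite subr_eq0 gt_eqF.
  rewrite ler_wpM2r ?powR_ge0// ler1_powR// ler_pdivlMr; lra.
- rewrite -[X in _ --> X]subr0; apply: cvgB; first exact: cvg_cst.
  rewrite -[X in _ --> X](mul0r (Gamma_fun (a + 2))); apply: cvgMl.
  rewrite -[X in _ --> X](mulr0 2); apply: cvgMr.
  exact: cvgy_inv.
- rewrite -[X in _ --> X]mul1r; apply: cvgMl.
  rewrite -[X in _ --> X]invr1; apply: cvgV => //.
  rewrite -[X in _ --> X]subr0; apply: cvgB; first exact: cvg_cst.
  exact: cvgy_inv.
Unshelve. all: end_near. Qed.

End Gamma.

(** * Moments and tails of beta variables *)

Section beta_rv.
Context {R : realType} d (T : measurableType d) (P : probability T R).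
Variables (Y : T -> R) (a b : R).
Hypothesis a01 : 0 < a <= 1.
Hypothesis b1 : 1 < b.
Hypothesis betaY : is_beta_rv P Y a b.
Hypothesis Y01 : forall w, 0 < Y w < 1.
Notation mu := (@lebesgue_measure R).

Let a0 : 0 < a. Proof. by have /andP[] := a01. Qed.
Let b0 : 0 < b. Proof. by apply: lt_trans b1. Qed.
Let mY : measurable_fun setT Y. Proof. by have [] := betaY. Qed.

Lemma measurable_beta_density (s t : R) (D : set R) :
  measurable_fun D (beta_density s t).
Proof.
apply: measurable_funTS; apply: measurable_funM => //.
exact: measurable_beta_integrand.
Qed.

Let dens0 x : 0 <= beta_density a b x.
Proof.
by rewrite /beta_density divr_ge0 ?mulr_ge0 ?powR_ge0// ltW// Beta_fun_gt0.
Qed.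

Lemma beta_expectation (g : R -> R) : measurable_fun setT g -> (forall x, 0 <= g x) ->
  (\int[P]_w (g (Y w))%:E = \int[mu]_(x in `]0%R, 1%R[) (g x * beta_density a b x)%:E)%E.
Proof.
move=> mg g0.
have [_ PY] := betaY.
have := @eq_weighted_integral R _ _ _ _ P mu Y (cst 1) id (beta_density a b \_ `]0, 1[) 1 g
  mY (@measurable_id _ _ _) (measurable_cst _) _ _ _ ler01.
rewrite mul1e => h.
transitivity (\int[P]_x (g (Y x) * cst 1 x)%:E)%E.
  by apply: eq_integral => w _; rewrite mulr1.
rewrite h//.
- rewrite [RHS]integral_mkcond; apply: eq_integral => x _; rewrite !patchE.
  by case: ifP => // _; rewrite mulr0.
- apply/measurable_restrict => //; exact: measurable_beta_density.
- by move=> x; rewrite patchE; case: ifP.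
- move=> B mB; rewrite mul1e /= -[LHS]/(\int[P]_(x in Y @^-1` B) (cst 1%E x))%E.
  rewrite integral_cst ?mul1e; last exact: measurable_preimage.
  transitivity (\int[mu]_(x in B `&` `]0%R, 1%R[) (beta_density a b x)%:E)%E; first exact: PY.
  rewrite integral_mkcondr; apply: eq_integral => x _.
  by rewrite !patchE; case: ifP.
Qed.

Lemma beta_moment (p q : nat) :
  (\int[P]_w (Y w ^+ p * (1 - Y w) ^+ q)%:E =
   (Beta_fun (a + p%:R) (b + q%:R) / Beta_fun a b)%:E)%E.
Proof.
(* [beta_expectation] asks for a function nonnegative on the whole line; absolute values change
   nothing because [Y] stays in ]0, 1[. *)
transitivity (\int[P]_w (`|Y w| ^+ p * `|1 - Y w| ^+ q)%:E)%E.
  apply: eq_integral => w _; have /andP[Y0 Y1] := Y01 w.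
  by rewrite !gtr0_norm// subr_gt0.
rewrite (beta_expectation (g := fun x => `|x| ^+ p * `|1 - x| ^+ q)); last 2 first.
- apply: measurable_funM; apply: measurable_funX; first exact: normr_measurable.
  by apply: measurableT_comp => //; exact: measurable_funB.
- by move=> x; rewrite mulr_ge0.
have ap : 0 < a + p%:R by rewrite ltr_pwDl.
have bq : 1 < b + q%:R by rewrite ltr_wpDr.
rewrite EFinM muleC -Beta_fun_int// -ge0_integralZl//.
- apply: eq_integral => x; rewrite inE/= in_itv/= => /andP[x0 x1].
  have y0 : 0 < 1 - x by rewrite subr_gt0.
  rewrite -EFinM; congr EFin.
  rewrite !gtr0_norm// /beta_density (addrAC a) (addrAC b) !powRD ?(gt_eqF x0) ?(gt_eqF y0) ?implybT//.
  by rewrite !powR_mulrn ?ltW//; ring.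
- by apply/measurable_EFinP/measurable_funTS; exact: measurable_beta_integrand.
- by move=> x _; rewrite lee_fin mulr_ge0 ?powR_ge0.
- by rewrite lee_fin invr_ge0 ltW// Beta_fun_gt0.
Qed.

(** [tail_beta_integrand] with [al = 1 - a], divided by the beta function. The two bounds agree to
    first order once [b * u] is large. *)
Lemma beta_tail_bounds (u : R) : 0 < u < 1 ->
  let G := u `^ (a - 1) * (1 - u) `^ b / (b * Beta_fun a b) in
  G / (1 + (1 - a) / (b * u)) <= fine (P [set w | u < Y w]) <= G.
Proof.
move=> u01; cbv zeta; set G := _ / (b * Beta_fun a b); have [u0 u1] := andP u01.
have a1 : 0 <= 1 - a by rewrite subr_ge0; have /andP[] := a01.
have := tail_beta_integrand a1 u01 b1; rewrite opprB /=.
set K := \int[mu]_(x in _) _ => /andP[Kle leK].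
have B0 : 0 < Beta_fun a b by exact: Beta_fun_gt0.
have b10 : 0 < b - 1 by rewrite subr_gt0.
suff -> : fine (P [set w | u < Y w]) = K / Beta_fun a b.
  have bu : 0 < b * u by rewrite mulr_gt0.
  have c0 : 0 < 1 + (1 - a) / (b * u) by rewrite ltr_pwDl// divr_ge0// ltW.
  rewrite /G; apply/andP; split.
    rewrite ler_pdivrMr// ler_pdivrMr ?mulr_gt0//.
    apply: (le_trans leK); rewrite le_eqVlt; apply/orP; left; apply/eqP; field.
    by rewrite !gt_eqF.
  apply: (@le_trans _ _ (b * K / (b * Beta_fun a b))).
    rewrite le_eqVlt; apply/orP; left; apply/eqP; field.
    by rewrite !gt_eqF.
  by rewrite ler_wpM2r// invr_ge0 mulr_ge0 ?ltW.
have [_ PY] := betaY.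
have -> : [set w | u < Y w] = Y @^-1` `]u, +oo[.
  by apply/seteqP; split => w /=; rewrite in_itv/= andbT.
rewrite PY//.
have -> : `]u, +oo[ `&` `]0%R, 1%R[ = `]u, 1%R[%classic.
  apply/seteqP; split => x /=; rewrite !in_itv/= ?andbT; first by move=> [-> /andP[_ ->]].
  by move=> /andP[ux ->]; split => //; rewrite (lt_trans u0).
have -> : (\int[mu]_(x in `]u, 1%R[) (beta_density a b x)%:E =
    \int[mu]_(x in `[u, 1%R]) ((Beta_fun a b)^-1%:E * (x `^ (a - 1) * (1 - x) `^ (b - 1))%:E))%E.
  transitivity (\int[mu]_(x in `[u, 1%R]) (beta_density a b x)%:E)%E; last first.
    by apply: eq_integral => x _; rewrite -EFinM /beta_density mulrC.
  have mD D : measurable_fun D (EFin \o beta_density a b).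
    by apply/measurable_EFinP; exact: measurable_beta_density.
  by rewrite integral_itv_obnd_cbnd// integral_itv_bndo_bndc.
have iK := integrable_beta_integrand (a - 1) u01 b10.
rewrite integralZl// fineM//; last exact: (integrable_fin_num _ iK).
by rewrite mulrC.
Qed.

End beta_rv.

Section beta_function_recurrence.
Context {R : realType}.
Implicit Types s t : R.

(** Splitting and integration by parts give two linear equations for B(s+1, t) and B(s, t+1); this
    solves them in terms of B(s, t). *)
Let solve_split (x y S T : R) : S + T != 0 -> T * x = S * y ->
  x = S / (S + T) * (x + y) /\ y = T / (S + T) * (x + y).
Proof.
move=> st e; split; apply: (mulfI st); rewrite mulrA mulrCA divff// mulr1 mulrDl mulrDr.
  by rewrite e.
by rewrite e.
Qed.

Lemma Beta_funS s t : 0 < s -> 1 < t -> Beta_fun (s + 1) t = s / (s + t) * Beta_fun s t.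
Proof.
move=> s0 t1; rewrite (Beta_fun_splitD s0 t1); apply: (solve_split _ _).1.
  by rewrite gt_eqF// addr_gt0// (lt_trans _ t1).
exact: Beta_fun_parts.
Qed.

Lemma Beta_fun_S s t : 0 < s -> 1 < t -> Beta_fun s (t + 1) = t / (s + t) * Beta_fun s t.
Proof.
move=> s0 t1; rewrite [in RHS](Beta_fun_splitD s0 t1); apply: (solve_split _ _).2.
  by rewrite gt_eqF// addr_gt0// (lt_trans _ t1).
exact: Beta_fun_parts.
Qed.

Lemma Beta_funDn s t p : 0 < s -> 1 < t ->
  Beta_fun (s + p%:R) t = \prod_(k < p) ((s + k%:R) / (s + t + k%:R)) * Beta_fun s t.
Proof.
move=> s0 t1; elim: p => [|p ih]; first by rewrite addr0 big_ord0 mul1r.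
have sp : 0 < s + p%:R by rewrite ltr_pwDl.
have -> : s + p.+1%:R = s + p%:R + 1 by rewrite -natr1 addrA.
rewrite (Beta_funS sp t1) ih big_ord_recr/= (addrAC s p%:R t) mulrA; congr (_ * _).
exact: mulrC.
Qed.

Lemma Beta_fun_Dn s t q : 0 < s -> 1 < t ->
  Beta_fun s (t + q%:R) = \prod_(k < q) ((t + k%:R) / (s + t + k%:R)) * Beta_fun s t.
Proof.
move=> s0 t1; elim: q => [|q ih]; first by rewrite addr0 big_ord0 mul1r.
have tq : 1 < t + q%:R by rewrite ltr_wpDr.
have -> : t + q.+1%:R = t + q%:R + 1 by rewrite -natr1 addrA.
rewrite (Beta_fun_S s0 tq) ih big_ord_recr/= (addrA s t) mulrA; congr (_ * _).
exact: mulrC.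
Qed.

End beta_function_recurrence.

(** * Stick-breaking weights for a fixed parameter *)

Section factorial_bound.
Context {R : realType}.

(** Induction; the step from q+1 to q+2 reduces to (1 - 1/(q+2))^(q+2) <= e^(-1). *)
Lemma fact_le_expR (q : nat) : (0 < q)%N ->
  (q`!%:R : R) <= q%:R ^+ q.+1 * expR (1 - q%:R).
Proof.
case: q => // q _; elim: q => [|q ih]; first by rewrite subrr expR0 expr1n mulr1.
rewrite factS natrM.
apply: (le_trans (ler_wpM2l (ler0n R q.+2) ih)).
rewrite (exprS (q.+2%:R : R) q.+2) -[leRHS]mulrA ler_wpM2l ?ler0n//.
rewrite (_ : 1 - q.+2%:R = (1 - q.+1%:R) + (-1) :> R); last by rewrite -[q.+2%:R]natr1; ring.
rewrite (expRD (1 - q.+1%:R) (-1)) [leRHS]mulrCA [leLHS]mulrC ler_wpM2l ?expR_ge0//.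
rewrite mulrC -ler_pdivrMr ?exprn_gt0 ?ltr0n// -expr_div_n.
have -> : (q.+1%:R / q.+2%:R : R) = 1 + (- q.+2%:R^-1).
  by rewrite -{1}[q.+1%:R](addrK 1) natr1 mulrBl divff ?pnatr_eq0// mul1r.
have h0 : 0 <= 1 + - (q.+2%:R^-1) :> R by rewrite subr_ge0 invf_le1// ler1n.
apply: (@le_trans _ _ (expR (- q.+2%:R^-1) ^+ q.+2)).
  by rewrite lerXn2r ?nnegrE ?expR_ge0// expR_ge1Dx.
by rewrite -expRM_natl mulrN divff// pnatr_eq0.
Qed.

(** With [q] the integer part of [x], the moment bound q! / x^(q+1) recovers exponential decay in
    [x]; this is why [tail_event] uses the moment of order q+1. *)
Lemma fact_div_expr_le (q : nat) (x : R) : 1 <= x -> q%:R <= x < q.+1%:R ->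
  q`!%:R / x ^+ q.+1 <= expR (2 - x).
Proof.
move=> x1 /andP[qx xq].
have q0 : (0 < q)%N by rewrite -ltnS -(ltr_nat R) (le_lt_trans x1).
have x0 : 0 < x by lra.
rewrite ler_pdivrMr ?exprn_gt0//.
apply: (le_trans (fact_le_expR q0)).
rewrite mulrC ler_pM ?exprn_ge0 ?expR_ge0 ?ler0n//.
  by rewrite ler_expR; move: xq; rewrite -natr1; lra.
by rewrite lerXn2r ?nnegrE ?ler0n ?(ltW x0).
Qed.

End factorial_bound.

Section products.
Context {R : realDomainType}.

(** Telescoping, one factor replaced at a time. It serves for the variance of the residual, which is
    a difference of two products. *)
Lemma prod_diff_le (n : nat) (x y : nat -> R) : (forall j, 0 <= y j <= x j) ->
  (forall j, x j <= 1) ->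
  \prod_(j < n) x j - \prod_(j < n) y j <= \sum_(j < n) (x j - y j).
Proof.
move=> yx x1; elim: n => [|n ih]; first by rewrite !big_ord0 subrr.
rewrite !big_ord_recr/=.
set X := \prod_(j < n) x j in ih *; set Z := \prod_(j < n) y j in ih *.
have x0 j : 0 <= x j by have /andP[a b] := yx j; exact: le_trans b.
have Z0 : 0 <= Z by apply: prodr_ge0 => j _; have /andP[] := yx j.
have X0 : 0 <= X by apply: prodr_ge0 => j _.
have Z1 : Z <= 1.
  apply: prodr_ile1 => j _; have /andP[a b] := yx j.
  by rewrite a (le_trans b).
have XZ : Z <= X by apply: ler_prod => j _; exact: yx.
have /andP[yn0 yn] := yx n.
have -> : X * x n - Z * y n = (X - Z) * x n + Z * (x n - y n) by ring.
apply: lerD.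
  by apply: le_trans ih; rewrite ler_piMr// subr_ge0.
by rewrite ler_piMl// subr_ge0.
Qed.

Lemma prod_onem_bounds (n : nat) (m : nat -> R) : (forall j, 0 <= m j <= 1) ->
  1 - \sum_(j < n) m j <= \prod_(j < n) (1 - m j) <=
  1 - \sum_(j < n) m j + (\sum_(j < n) m j) ^+ 2.
Proof.
move=> m01; elim: n => [|n /andP[l u]].
  by rewrite !big_ord0 expr0n/= addr0 subr0 lexx.
rewrite !big_ord_recr/=.
set X := \prod_(j < n) _ in l u *; set S := \sum_(j < n) _ in l u *.
have /andP[m0 m1] := m01 n.
have X0 : 0 <= X by apply: prodr_ge0 => j _; rewrite subr_ge0; have /andP[] := m01 j.
have X1 : X <= 1.
  by apply: prodr_ile1 => j _; have /andP[h0 h1] := m01 j; rewrite subr_ge0 h1 gerBl.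
have S0 : 0 <= S by apply: sumr_ge0 => j _; have /andP[] := m01 j.
by apply/andP; split; nra.
Qed.

End products.

(** * Residuals, late weights and the comparison with a deterministic residual *)

Section stick_breaking.
Context {R : realType} d (T : measurableType d) (P : probability T R).
Variables (al th : R) (Y : nat -> T -> R).
Hypothesis al01 : 0 <= al < 1.
Hypothesis th1 : 1 < th.
Hypothesis indY : mutually_independent P Y.
Hypothesis betaY : forall i, is_beta_rv P (Y i) (1 - al) (th + i.+1%:R * al).
Hypothesis Y01 : forall i w, 0 < Y i w < 1.

Let al0 : 0 <= al. Proof. by have /andP[] := al01. Qed.
Let a01 : 0 < 1 - al <= 1.
Proof. by have /andP[h1 h2] := al01; rewrite subr_gt0 h2 gerBl. Qed.
Let a0 : 0 < 1 - al. Proof. by have /andP[] := a01. Qed.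
Let ia (i : nat) : 0 <= i%:R * al. Proof. by rewrite mulr_ge0. Qed.
Let b1 (i : nat) : 1 < th + i%:R * al. Proof. by rewrite ltr_wpDr. Qed.
Let mY i : measurable_fun setT (Y i). Proof. by have [] := betaY i. Qed.

Definition residual (y : nat -> R) (i : nat) : R := \prod_(j < i) (1 - y j).

(** Sum of the two beta parameters of [Y i], hence the base of the denominators in its moments. *)
Let c (i : nat) : R := th + 1 + i%:R * al.
Let c0 i : 0 < c i. Proof. by rewrite /c; move: th1 (ia i); lra. Qed.

Let cE i : 1 - al + (th + i.+1%:R * al) = c i.
Proof. by rewrite /c -natr1; ring. Qed.

(** The inner product is the p-th moment of 1 - Y_j, see [onem_moment]; by independence the outer
    product is that of the residual. *)
Definition residual_moment (p i : nat) : R :=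
  \prod_(j < i) \prod_(k < p) ((c j - (1 - al) + k%:R) / (c j + k%:R)).

Let bp i : 0 < c i - (1 - al).
Proof. by rewrite -cE; move: th1 (ia i.+1); lra. Qed.

Let rf0 (j k : nat) : 0 <= (c j - (1 - al) + k%:R) / (c j + k%:R).
Proof. by rewrite divr_ge0// addr_ge0// ltW. Qed.

Let residual_momentS p i : residual_moment p i.+1 =
  residual_moment p i * \prod_(k < p) ((c i - (1 - al) + k%:R) / (c i + k%:R)).
Proof. by rewrite /residual_moment big_ord_recr. Qed.

Let R01 i w : 0 < residual (Y^~ w) i <= 1.
Proof.
rewrite /residual; apply/andP; split.
  by apply: prodr_gt0 => j _; rewrite subr_gt0; have /andP[] := Y01 j w.
apply: prodr_ile1 => j _; have /andP[y0 y1] := Y01 j w.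
by rewrite subr_ge0 (ltW y1) gerBl ltW.
Qed.

Lemma measurable_residual i : measurable_fun setT (fun w => residual (Y^~ w) i).
Proof. by apply: measurable_prod => j _; apply: measurable_funB => //; exact: mY. Qed.

Lemma onem_moment p i :
  (\int[P]_w ((1 - Y i w) ^+ p)%:E =
   (\prod_(k < p) ((c i - (1 - al) + k%:R) / (c i + k%:R)))%:E)%E.
Proof.
have := beta_moment a01 (b1 i.+1) (betaY i) (Y01 i) 0 p.
rewrite addr0 Beta_fun_Dn// mulfK; last by rewrite gt_eqF// Beta_fun_gt0.
rewrite cE (_ : th + i.+1%:R * al = c i - (1 - al)); last by rewrite -cE; ring.
by move=> <-; apply: eq_integral => w _; rewrite expr0 mul1r.
Qed.

Lemma factor_moment p i :
  (\int[P]_w ((Y i w) ^+ p)%:E =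
   (\prod_(k < p) ((1 - al + k%:R) / (c i + k%:R)))%:E)%E.
Proof.
have := beta_moment a01 (b1 i.+1) (betaY i) (Y01 i) p 0.
rewrite addr0 Beta_funDn// mulfK; last by rewrite gt_eqF// Beta_fun_gt0.
rewrite cE.
by move=> <-; apply: eq_integral => w _; rewrite expr0 mulr1.
Qed.

(** The residual involves only [Y j] with [j < i], so it is independent of [Y i]. The weight [g]
    lets later bounds keep the probability that [Y i] is large. *)
Lemma residual_expectation p i (g : R -> R) :
  measurable_fun setT g -> (forall x, 0 <= g x) ->
  (\int[P]_w (g (Y i w))%:E < +oo)%E ->
  (\int[P]_w (residual (Y^~ w) i ^+ p * g (Y i w))%:E =
   (residual_moment p i)%:E * \int[P]_w (g (Y i w))%:E)%E.
Proof.
move=> mg g0 goo.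
pose h (j : nat) (x : R) := if j == i then g x else `|1 - x| ^+ p.
have hE j w : j != i -> h j (Y j w) = (1 - Y j w) ^+ p.
  by move=> ji; rewrite /h ifN// gtr0_norm// subr_gt0; have /andP[] := Y01 j w.
have Eh j : j != i -> (\int[P]_w (h j (Y j w))%:E = \int[P]_w ((1 - Y j w) ^+ p)%:E)%E.
  by move=> ji; apply: eq_integral => w _; rewrite hE.
have hi : h i = g by rewrite /h eqxx.
have mh j : measurable_fun setT (h j).
  rewrite /h; case: eqP => // _.
  apply: measurable_funX; apply: measurableT_comp; first exact: normr_measurable.
  exact: measurable_funB.
have h0 j x : 0 <= h j x by rewrite /h; case: ifP => // _; rewrite exprn_ge0.
have hoo j : (\int[P]_w (h j (Y j w))%:E < +oo)%E.
  have [->|ji] := eqVneq j i; first by rewrite hi.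
  by rewrite Eh// onem_moment ltry.
have := indep_prod mY indY i.+1 mh h0 hoo.
rewrite big_ord_recr/= hi => E.
transitivity (\int[P]_w (\prod_(j < i.+1) h j (Y j w))%:E)%E.
  apply: eq_integral => w _; rewrite big_ord_recr/= hi /residual -prodrXl.
  congr (_ * _)%:E; apply: eq_bigr => j _.
  by rewrite hE// ltn_eqF.
rewrite E; congr (_ * _)%E; rewrite /residual_moment -prodEFin.
by apply: eq_bigr => j _; rewrite Eh ?ltn_eqF// onem_moment.
Qed.

Let tail_moment (q i : nat) : R :=
  residual_moment q.+1 i * \prod_(k < q) ((1 - al + k%:R) / (c i + k%:R)).

(* The telescoping form of [E v_i^(q+1)]: the sum over [i >= I] of these moments is,
   by size-biased sampling, [E R_I^(q+1)] times the [q]-th moment of a beta variable. *)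
Let stick_moment q i :
  (\int[P]_w (stick_breaking (Y^~ w) i ^+ q.+1)%:E = (tail_moment q i - tail_moment q i.+1)%:E)%E.
Proof.
pose g (x : R) := `|x| ^+ q.+1.
have gE w : g (Y i w) = Y i w ^+ q.+1.
  by rewrite /g gtr0_norm//; have /andP[] := Y01 i w.
have Eg : (\int[P]_w (g (Y i w))%:E = \int[P]_w (Y i w ^+ q.+1)%:E)%E.
  by apply: eq_integral => w _; rewrite gE.
have -> : (\int[P]_w (stick_breaking (Y^~ w) i ^+ q.+1)%:E =
    \int[P]_w (residual (Y^~ w) i ^+ q.+1 * g (Y i w))%:E)%E.
  by apply: eq_integral => w _; rewrite gE /stick_breaking exprMn.
rewrite residual_expectation.
- rewrite Eg factor_moment -EFinM; congr EFin.
  rewrite /tail_moment residual_momentS.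
  rewrite -[X in _ = _ - X]mulrA -mulrBr; congr (_ * _).
  rewrite [in LHS]big_ord_recr/=.
  set F := \prod_(k < q) ((1 - al + k%:R) / (c i + k%:R)).
  have cn k : c i + k%:R != 0 by rewrite gt_eqF// ltr_pwDl.
  have bn k : c i - (1 - al) + k%:R != 0.
    by rewrite gt_eqF// ltr_pwDl.
  (* Because [c i.+1 = c i + al], the denominators at [i.+1] are the numerators at [i] one index
     later, and the products cancel up to end terms. *)
  have key : \prod_(k < q.+1) ((c i - (1 - al) + k%:R) / (c i + k%:R)) *
      \prod_(k < q) ((1 - al + k%:R) / (c i.+1 + k%:R)) =
      F * ((c i - (1 - al)) / (c i + q%:R)).
    have cS k : c i.+1 + k%:R = c i - (1 - al) + k.+1%:R.
      by rewrite /c -!natr1; ring.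
    under [X in _ * X]eq_bigr do rewrite cS.
    rewrite /F; elim: (q) => [|m ih].
      by rewrite big_ord1 !big_ord0 mulr1 mul1r !addr0.
    rewrite big_ord_recr/= [X in _ * X]big_ord_recr/= mulrACA ih [in RHS]big_ord_recr/=.
    move: (cn m) (cn m.+1) (bn m.+1).
    move: (c i) (m%:R) (m.+1%:R : R) (\prod_(k < m) _) => z u v x h1 h2 h3.
    by field; rewrite h1 h2 h3.
  rewrite key; move: (F) (cn q); move: (c i) (q%:R : R) => z u G h.
  by field; rewrite h.
- by apply: measurable_funX; exact: normr_measurable.
- by move=> x; rewrite exprn_ge0.
- by rewrite Eg factor_moment ltry.
Qed.

Let tail_moment0 q i : 0 <= tail_moment q i.
Proof.
have cn k : 0 <= c i + k%:R by rewrite addr_ge0// ltW.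
rewrite mulr_ge0//; last first.
  by apply: prodr_ge0 => k _; rewrite divr_ge0// addr_ge0// ltW.
apply: prodr_ge0 => j _; apply: prodr_ge0 => k _.
exact: rf0.
Qed.

Lemma measurable_stick i : measurable_fun setT (fun w => stick_breaking (Y^~ w) i).
Proof. by apply: measurable_funM; [exact: measurable_residual|exact: mY]. Qed.

Let stick0 i w : 0 < stick_breaking (Y^~ w) i.
Proof. by rewrite mulr_gt0//; [have /andP[] := R01 i w|have /andP[] := Y01 i w]. Qed.

Let mstick_gt i x : measurable [set w | (x < th * stick_breaking (Y^~ w) i)%R].
Proof.
by apply: measurable_superlevel; apply: measurable_funM => //; exact: measurable_stick.
Qed.

Let markov_stick q i (x : R) : 0 < x ->
  (P [set w | (x < th * stick_breaking (Y^~ w) i)%R] <=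
   ((th / x) ^+ q.+1 * (tail_moment q i - tail_moment q i.+1))%:E)%E.
Proof.
move=> x0; have th0 : 0 < th by move: th1; lra.
set A := [set w | _].
have mA : measurable A by exact: mstick_gt.
rewrite EFinM -stick_moment -(setIT A) -integral_indic//.
rewrite -ge0_integralZl//; last 3 first.
- by apply/measurable_EFinP/measurable_funX; exact: measurable_stick.
- by move=> w _; rewrite lee_fin exprn_ge0// ltW.
- by rewrite lee_fin exprn_ge0// divr_ge0// ltW.
apply: ge0_le_integral => //.
- by apply/measurable_EFinP; exact: measurable_indic.
- apply/measurable_EFinP; apply: measurable_funM => //.
  by apply: measurable_funX; exact: measurable_stick.
move=> w _; rewrite -EFinM lee_fin -exprMn indicE.
case: (boolP (w \in A)) => [|_]; last first.
  by rewrite exprn_ge0// mulr_ge0 ?divr_ge0// ltW.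
rewrite inE /A /= => xw; rewrite exprn_ege1// mulrAC ler_pdivlMr// mul1r ltW//.
Qed.

(** Union bound over the late weights and Markov at order [q.+1], with [q] the integer part of [x];
    the moments telescope to [tail_moment q I]. Its factorial part leads to [th] times e^(2 - x),
    and the residual gives a factor e^(-(1 - al) / (4 th)) for each of the (q+1) I terms of its
    product. *)
Lemma tail_event (x : R) (I : nat) : 1 <= x -> x <= 2 * th - 1 -> I%:R <= th ->
  (P [set w | exists2 i, (I <= i)%N & (x < th * stick_breaking (Y^~ w) i)%R] <=
   (th * expR (2 - x - (1 - al) * x * I%:R / (4 * th)))%:E)%E.
Proof.
move=> x1 xth Ith.
have th0 : 0 < th by move: th1; lra.
have x0 : 0 < x by lra.
pose q := Num.truncn x.
have /andP[qx xq] : q%:R <= x < q.+1%:R.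
  by rewrite truncnS_gt andbT truncn_le; lra.
pose A n := [set w | x < th * stick_breaking (Y^~ w) (I + n)].
have mA n : measurable (A n) by exact: mstick_gt.
have -> : [set w | exists2 i, (I <= i)%N & (x < th * stick_breaking (Y^~ w) i)%R] = \bigcup_n A n.
  apply/seteqP; split => w /=.
    by move=> [i Ii xi]; exists (i - I)%N => //; rewrite /A/= subnKC.
  by move=> [n _ xn]; exists (I + n)%N => //; rewrite leq_addr.
apply: (@le_trans _ _ (\sum_(n <oo) P (A n))%E).
  by apply: measure_sigma_subadditive => //; exact: bigcup_measurable.
apply: (@le_trans _ _ ((th / x) ^+ q.+1 * tail_moment q I)%:E).
  apply: lime_le; first by apply: is_cvg_nneseries.
  apply: nearW => n.
  apply: (@le_trans _ _ (\sum_(0 <= i < n)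
      ((th / x) ^+ q.+1 * (tail_moment q (I + i) - tail_moment q (I + i).+1))%:E)%E).
    by apply: lee_sum => i _; exact: markov_stick.
  rewrite sumEFin lee_fin -mulr_sumr ler_wpM2l ?exprn_ge0 ?divr_ge0 ?(ltW th0) ?(ltW x0)//.
  have -> : \sum_(0 <= i < n) (tail_moment q (I + i) - tail_moment q (I + i).+1) =
      tail_moment q I - tail_moment q (I + n).
    elim: n => [|n ih]; first by rewrite big_geq// addn0 subrr.
    by rewrite big_nat_recr//= ih addnS; ring.
  by rewrite gerBl tail_moment0.
rewrite lee_fin.
have rm : residual_moment q.+1 I <= expR (- ((1 - al) * x * I%:R / (4 * th))).
  apply: (@le_trans _ _ (\prod_(j < I) \prod_(k < q.+1) expR (- ((1 - al) / (4 * th))))).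
    apply: ler_prod => j _; apply/andP; split.
      apply: prodr_ge0 => k _; exact: rf0.
    apply: ler_prod => k _; apply/andP; split.
      exact: rf0.
    have ck : 0 < c j + k%:R by rewrite ltr_pwDl.
    (* The parameter sum is at most 2 th + 1 as [j < I] and [I <= th], and [k] is at most x <= 2 th
       - 1. *)
    have ck4 : c j + k%:R <= 4 * th.
      have : j%:R * al <= I%:R.
        have /andP[_ al1] := al01.
        by rewrite -[leRHS]mulr1 ler_pM ?(ltW al1)// ler_nat ltnW.
      have : (k%:R : R) <= q%:R by rewrite ler_nat -ltnS.
      by rewrite /c; move: qx; lra.
    apply: le_trans (expR_ge1Dx _).
    have -> : (c j - (1 - al) + k%:R) / (c j + k%:R) = 1 - (1 - al) / (c j + k%:R).
      by field; rewrite gt_eqF.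
    rewrite lerD2l lerN2 ler_wpM2l ?(ltW a0)// lef_pV2 ?posrE//.
    by rewrite mulr_gt0.
  rewrite prodr_const !card_ord prodr_const card_ord -!expRM_natl ler_expR.
  rewrite !mulrN lerN2.
  have -> : (1 - al) * x * I%:R / (4 * th) = x * ((1 - al) / (4 * th) * I%:R) by ring.
  have -> : I%:R * (q.+1%:R * ((1 - al) / (4 * th))) = q.+1%:R * ((1 - al) / (4 * th) * I%:R) by ring.
  rewrite ler_wpM2r ?(ltW xq)// mulr_ge0// divr_ge0 ?mulr_ge0 ?ltW//.
(* Factor by factor, beta moments lie below those of an exponential variable of rate [th]. *)
have fm : \prod_(k < q) ((1 - al + k%:R) / (c I + k%:R)) <= q`!%:R / th ^+ q.
  elim: (q) => [|m ih]; first by rewrite big_ord0 fact0 expr0 divr1.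
  rewrite big_ord_recr/= factS natrM exprS.
  rewrite [leRHS](_ : _ = m`!%:R / th ^+ m * (m.+1%:R / th)); last first.
    by rewrite invfM; ring.
  apply: ler_pM => //.
  - by apply: prodr_ge0 => k _; rewrite divr_ge0// addr_ge0// ltW.
  - by rewrite divr_ge0// addr_ge0// ltW.
  have cm : 0 < c I + m%:R by rewrite ltr_pwDl.
  apply: ler_pM => //.
  - by rewrite addr_ge0// ltW.
  - by rewrite invr_ge0 ltW.
  - by rewrite -natr1 addrC lerD2l gerBl.
  - by rewrite lef_pV2 ?posrE// /c; move: (ia I) (ler0n R m); lra.
have rm0 : 0 <= residual_moment q.+1 I.
  apply: prodr_ge0 => j _; apply: prodr_ge0 => k _.
  exact: rf0.
apply: (@le_trans _ _ ((th / x) ^+ q.+1 * (expR (- ((1 - al) * x * I%:R / (4 * th))) *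
    (q`!%:R / th ^+ q)))).
  rewrite ler_wpM2l ?exprn_ge0 ?divr_ge0 ?(ltW th0) ?(ltW x0)//.
  apply: ler_pM => //.
  by apply: prodr_ge0 => k _; rewrite divr_ge0// addr_ge0// ltW.
have -> : (th / x) ^+ q.+1 * (expR (- ((1 - al) * x * I%:R / (4 * th))) * (q`!%:R / th ^+ q)) =
  th * (q`!%:R / x ^+ q.+1 * expR (- ((1 - al) * x * I%:R / (4 * th)))).
  rewrite expr_div_n (exprS th); field.
  by rewrite !expf_neq0 ?gt_eqF.
rewrite ler_wpM2l ?(ltW th0)// expRD ler_wpM2r ?expR_ge0//.
by apply: fact_div_expr_le => //; rewrite qx.
Qed.

Let mYgt i (x : R) : measurable [set w | (x < Y i w)%R].
Proof. exact: measurable_superlevel. Qed.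

(** Chebyshev for the residual, restricted to a large factor. By independence the probability of the
    latter stays as a prefactor; a union bound over the indices would be too weak without it. *)
Lemma residual_deviation i (u r k : R) : 0 <= r -> 0 < k ->
  (P [set w | (u < Y i w)%R /\ (k <= `|residual (Y^~ w) i - r|)%R] <=
   (fine (P [set w | (u < Y i w)%R]) *
    ((residual_moment 2 i - 2 * r * residual_moment 1 i + r ^+ 2) / k ^+ 2))%:E)%E.
Proof.
move=> r0 k0.
pose g : R -> R := \1_`]u, +oo[.
have mg : measurable_fun setT g by exact: measurable_indic.
have g0 x : 0 <= g x by rewrite /g indicE.
set pi := fine _.
have Eg : (\int[P]_w (g (Y i w))%:E = pi%:E)%E.
  rewrite /pi fineK; last first.
    by rewrite ge0_fin_numE// (le_lt_trans (probability_le1 _ _))// ltry.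
  rewrite -(setIT [set w | _]) -integral_indic//.
  apply: eq_integral => w _; rewrite /g !indicE; congr ((_ : bool)%:R)%:E.
  by apply/idP/idP; rewrite !inE/= in_itv/= andbT.
have goo : (\int[P]_w (g (Y i w))%:E < +oo)%E by rewrite Eg ltry.
have mR := measurable_residual i.
have mgY : measurable_fun setT (fun w => g (Y i w)) by exact: measurableT_comp.
have E1 := residual_expectation 1 mg g0 goo.
have E2 := residual_expectation 2 mg g0 goo.
pose X w := (residual (Y^~ w) i - r) ^+ 2 * g (Y i w).
have mX : measurable_fun setT X.
  by apply: measurable_funM => //; apply: measurable_funX; exact: measurable_funB.
have X0 w : 0 <= X w by rewrite mulr_ge0// sqr_ge0.
have EX : (\int[P]_w (X w)%:E =
    (pi * (residual_moment 2 i - 2 * r * residual_moment 1 i + r ^+ 2))%:E)%E.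
  (* The square is expanded with the cross term moved to the left, so that only nonnegative
     functions are integrated. *)
  have e : (\int[P]_w (X w)%:E +
      (2 * r)%:E * \int[P]_w (residual (Y^~ w) i ^+ 1 * g (Y i w))%:E =
     \int[P]_w (residual (Y^~ w) i ^+ 2 * g (Y i w))%:E +
      (r ^+ 2)%:E * \int[P]_w (g (Y i w))%:E)%E.
    rewrite -!ge0_integralZl//; last first.
    - by rewrite lee_fin mulr_ge0.
    - by move=> w _; rewrite lee_fin mulr_ge0// expr1; have /andP[/ltW] := R01 i w.
    - by apply/measurable_EFinP; apply: measurable_funM => //; exact: measurable_funX.
    - by rewrite lee_fin sqr_ge0.
    - by move=> w _; rewrite lee_fin.
    - exact/measurable_EFinP.
    rewrite -!ge0_integralD//.
    - apply: eq_integral => w _; rewrite -!EFinM -!EFinD; congr EFin.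
      by rewrite /X; ring.
    - by move=> w _; rewrite lee_fin mulr_ge0// sqr_ge0.
    - by apply/measurable_EFinP; apply: measurable_funM => //; exact: measurable_funX.
    - by move=> w _; rewrite -EFinM lee_fin mulr_ge0// sqr_ge0.
    - by apply: measurable_funeM; exact/measurable_EFinP.
    - by move=> w _; rewrite lee_fin.
    - exact/measurable_EFinP.
    - move=> w _; rewrite -EFinM lee_fin !mulr_ge0// expr1.
      by have /andP[/ltW] := R01 i w.
    - apply: measurable_funeM; apply/measurable_EFinP; exact: measurable_funM.
  move: e; rewrite E1 E2 Eg -!EFinM -EFinD => e.
  have Xfin : (\int[P]_w (X w)%:E)%E \is a fin_num.
    rewrite ge0_fin_numE; last by apply: integral_ge0 => w _; rewrite lee_fin.
    by move: e; case: (\int[P]_w (X w)%:E)%E => // x _; rewrite ltry.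
  move: e; rewrite -(fineK Xfin) -EFinD => -[e]; congr EFin.
  rewrite -[LHS](addrK (2 * r * (residual_moment 1 i * pi))) e; ring.
set A := [set w | _].
have mA : measurable A.
  rewrite (_ : A = [set w | (u < Y i w)%R] `&`
     ((fun w => `|residual (Y^~ w) i - r|) @^-1` `[k, +oo[)); last first.
    by apply/seteqP; split => w /=; rewrite in_itv/= andbT.
  apply: measurableI; first exact: mYgt.
  apply: measurable_preimage => //; apply: measurableT_comp; first exact: normr_measurable.
  exact: measurable_funB.
rewrite mulrA -(mulrC (k ^+ 2)^-1) EFinM -EX -(setIT A) -integral_indic//.
rewrite -ge0_integralZl//; last 3 first.
- exact/measurable_EFinP.
- by move=> w _; rewrite lee_fin.
- by rewrite lee_fin invr_ge0 sqr_ge0.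
apply: ge0_le_integral => //.
- by apply/measurable_EFinP; exact: measurable_indic.
- by apply/measurable_EFinP; apply: measurable_funM.
move=> w _; rewrite -EFinM lee_fin indicE.
case: (boolP (w \in A)) => [|_]; last by rewrite mulr_ge0 ?invr_ge0 ?sqr_ge0.
rewrite inE /A /= => -[uY kR].
rewrite mulrC ler_pdivlMr ?exprn_gt0// mul1r /X.
rewrite /g indicE mem_set/= ?in_itv/= ?uY// mulr1.
by rewrite -[leRHS]ger0_norm ?sqr_ge0// normrX lerXn2r ?nnegrE ?(ltW k0).
Qed.

(** Equal to 1 - (1 - al) i / th up to order (i / th)^2 + 1 / th, like the mean of the residual.
    This representative has the second parameter of [Y i] as numerator, which frees b u from [al] in
    the beta tail. *)
Definition residual_limit (i : nat) : R := (th + i.+1%:R * al) / (th + i%:R).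

Let th0 : 0 < th. Proof. by move: th1; lra. Qed.

Lemma residual_limit_bounds i : i%:R <= th ->
  2^-1 <= residual_limit i <= (th + 1) / th.
Proof.
move=> ith; have i0 : 0 <= i%:R :> R by [].
have thi : 0 < th + i%:R by rewrite ltr_pwDl.
have /andP[_ al1] := al01.
rewrite /residual_limit ler_pdivlMr// ler_pdivrMr//; apply/andP; split.
  by move: (ia i.+1); lra.
have h : i.+1%:R * al <= i%:R + 1.
  by rewrite natr1 -[leRHS]mulr1 ler_wpM2l// ltW.
have -> : (th + 1) / th * (th + i%:R) = th + 1 + i%:R + i%:R / th.
  by field; rewrite gt_eqF.
by have : 0 <= i%:R / th by [rewrite divr_ge0// ltW]; lra.
Qed.

(** Variance plus squared bias. Each factor adds at most 1 / th^2 to the variance; the mean and the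
    limit are both compared with 1 - (1 - al) i / th, by [prod_onem_bounds] and by the exact
    remainder [rE]. *)
Lemma residual_square_deviation i :
  residual_moment 2 i - 2 * residual_limit i * residual_moment 1 i + residual_limit i ^+ 2 <=
  i%:R / th ^+ 2 + (2 * (i%:R / th) ^+ 2 + th^-1) ^+ 2.
Proof.
have i0 : 0 <= i%:R :> R by [].
have /andP[_ al1] := al01.
set m1 := residual_moment 1 i; set m2 := residual_moment 2 i; set r := residual_limit i.
have m1E : m1 = \prod_(j < i) (1 - (1 - al) / c j).
  apply: eq_bigr => j _; rewrite big_ord1 !addr0 mulrBl divff//.
  by rewrite gt_eqF.
have cth j : th <= c j by rewrite /c; move: (ia j); lra.
have m01 (j : nat) : 0 <= (1 - al) / c j <= 1.
  rewrite divr_ge0 ?(ltW a0) ?(ltW (c0 j))//= ler_pdivrMr// mul1r.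
  by move: (cth j) th1 al0; lra.
have var : m2 - m1 ^+ 2 <= i%:R / th ^+ 2.
  pose x (j : nat) := \prod_(k < 2) ((c j - (1 - al) + k%:R) / (c j + k%:R)).
  pose y (j : nat) := ((c j - (1 - al)) / c j) ^+ 2.
  have xE j : x j = (c j - (1 - al)) / c j * ((c j - (1 - al) + 1) / (c j + 1)).
    by rewrite /x big_ord_recr big_ord1/= !addr0.
  have xy j : x j - y j = (c j - (1 - al)) / c j * ((1 - al) / (c j * (c j + 1))).
    rewrite xE /y; field.
    by apply/andP; split; rewrite gt_eqF// ltr_pwDl.
  have xy0 j : 0 <= x j - y j.
    rewrite xy mulr_ge0// divr_ge0//; [exact/ltW|exact/ltW|exact/ltW|].
    by rewrite mulr_ge0 ?addr_ge0// ltW.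
  have xy1 j : x j - y j <= (th ^+ 2)^-1.
    rewrite xy -[leRHS]mul1r ler_pM//.
    - by rewrite divr_ge0// ltW.
    - have cc : 0 < c j * (c j + 1) by apply: mulr_gt0 => //; rewrite ltr_pwDl.
      by apply: divr_ge0; exact: ltW.
    - by rewrite ler_pdivrMr// mul1r gerBl ltW.
    - rewrite ler_pdivrMr ?mulr_gt0//; last by rewrite ltr_pwDl.
      rewrite ler_pdivlMl ?exprn_gt0//.
      have h : th ^+ 2 <= c j * (c j + 1).
        by rewrite expr2 ler_pM ?(ltW th0)//; move: (cth j); lra.
      apply: le_trans h; rewrite ler_piMr ?sqr_ge0//.
      by move: al0; lra.
  have m1y : m1 ^+ 2 = \prod_(j < i) y j.
    rewrite -prodrXl; apply: eq_bigr => j _.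
    by rewrite big_ord1 !addr0.
  rewrite m1y (_ : m2 = \prod_(j < i) x j)//.
  apply: (@le_trans _ _ (\sum_(j < i) (x j - y j))).
    apply: prod_diff_le => j.
      by rewrite /y sqr_ge0/= -subr_ge0 -/(y j).
    rewrite xE -[leRHS]mul1r ler_pM//.
    - by rewrite divr_ge0// ltW.
    - by rewrite divr_ge0// addr_ge0// ltW.
    - by rewrite ler_pdivrMr// mul1r gerBl ltW.
    - rewrite ler_pdivrMr ?mul1r; last by rewrite ltr_pwDl.
      by rewrite lerD2r gerBl ltW.
  apply: (@le_trans _ _ (\sum_(j < i) (th ^+ 2)^-1)); first exact: ler_sum.
  by rewrite sumr_const card_ord mulr_natl.
have bias : (m1 - r) ^+ 2 <= (2 * (i%:R / th) ^+ 2 + th^-1) ^+ 2.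
  pose S := \sum_(j < i) (1 - al) / c j.
  have /andP[lm um] := prod_onem_bounds i m01.
  rewrite -m1E -/S in lm um.
  have S0 : 0 <= S by apply: sumr_ge0 => j _; have /andP[] := m01 j.
  pose t := (1 - al) * i%:R / th.
  have St : S <= t.
    apply: (@le_trans _ _ (\sum_(j < i) (1 - al) / th)).
      by apply: ler_sum => j _; rewrite ler_wpM2l ?(ltW a0)// lef_pV2 ?posrE.
    by rewrite sumr_const card_ord -mulr_natr /t mulrAC.
  have tS : t - (i%:R / th) ^+ 2 <= S.
    apply: (@le_trans _ _ (\sum_(j < i) ((1 - al) / th - i%:R / th ^+ 2))).
      rewrite sumr_const card_ord -mulr_natr /t le_eqVlt; apply/orP; left; apply/eqP.
      by field; rewrite gt_eqF.
    apply: ler_sum => j _.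
    have ji : (j.+1%:R : R) <= i%:R by rewrite ler_nat.
    have cj : c j <= th + i%:R.
      rewrite /c -addrA lerD2l; apply: le_trans ji; rewrite -natr1 addrC lerD2r.
      by rewrite ler_piMr// ltW.
    apply: (@le_trans _ _ ((1 - al) / (th + i%:R))); last first.
      by rewrite ler_wpM2l ?(ltW a0)// lef_pV2 ?posrE// ltr_pwDl.
    have -> : (1 - al) / (th + i%:R) = (1 - al) / th - (1 - al) * i%:R / (th * (th + i%:R)).
      by field; rewrite !gt_eqF// ltr_pwDl.
    rewrite lerD2l lerN2 ler_pM//.
    - by rewrite mulr_ge0// ltW.
    - by rewrite invr_ge0 mulr_ge0 ?addr_ge0// ltW.
    - by rewrite ler_piMl//; have /andP[] := a01.
    - rewrite lef_pV2 ?posrE ?mulr_gt0 ?exprn_gt0// ?ltr_pwDl//.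
      by rewrite expr2 ler_wpM2l ?(ltW th0)// lerDl.
  have tit : t <= i%:R / th.
    by rewrite /t -mulrA ler_piMl ?divr_ge0 ?(ltW th0)//; have /andP[] := a01.
  have t0 : 0 <= t by apply: le_trans St.
  have S2 : S ^+ 2 <= (i%:R / th) ^+ 2.
    by rewrite lerXn2r ?nnegrE ?divr_ge0 ?(ltW th0)//; exact: le_trans tit.
  have rE : r = 1 - t + ((1 - al) * i%:R ^+ 2 + al * th) / (th * (th + i%:R)).
    rewrite /r /residual_limit /t -natr1; field.
    by rewrite !gt_eqF// ltr_pwDl.
  have N0 : 0 <= (1 - al) * i%:R ^+ 2 + al * th.
    by apply: addr_ge0; apply: mulr_ge0; rewrite ?sqr_ge0// ltW.
  have D0 : 0 < th * (th + i%:R) by apply: mulr_gt0 => //; rewrite ltr_pwDl.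
  have r0 : 0 <= ((1 - al) * i%:R ^+ 2 + al * th) / (th * (th + i%:R)).
    by rewrite divr_ge0 ?(ltW D0).
  have r1 : ((1 - al) * i%:R ^+ 2 + al * th) / (th * (th + i%:R)) <= (i%:R / th) ^+ 2 + th^-1.
    have -> : (i%:R / th) ^+ 2 + th^-1 = (i%:R ^+ 2 + th) / (th * th).
      by field; rewrite gt_eqF.
    rewrite ler_pM//.
    - by rewrite invr_ge0 ltW.
    - rewrite lerD//; first by rewrite ler_piMl ?sqr_ge0//; have /andP[] := a01.
      by rewrite ler_piMl ?(ltW th0) ?(ltW al1).
    - rewrite lef_pV2 ?posrE ?mulr_gt0// ?ltr_pwDl//.
      by rewrite ler_wpM2l ?(ltW th0)// lerDl.
  rewrite -[leLHS]ger0_norm ?sqr_ge0// normrX lerXn2r ?nnegrE//.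
    by rewrite addr_ge0 ?mulr_ge0 ?sqr_ge0 ?invr_ge0 ?(ltW th0).
  have thV : 0 <= th^-1 by rewrite invr_ge0 ltW.
  have q0 : 0 <= (i%:R / th) ^+ 2 by exact: sqr_ge0.
  rewrite ler_norml; apply/andP; split; rewrite rE; lra.
have -> : m2 - 2 * r * m1 + r ^+ 2 = (m2 - m1 ^+ 2) + (m1 - r) ^+ 2 by ring.
exact: lerD.
Qed.

Definition comparison_tail (i : nat) (x : R) : R :=
  fine (P [set w | (x < th * residual_limit i * Y i w)%R]).

Let mcomp i x : measurable [set w | (x < th * residual_limit i * Y i w)%R].
Proof. by apply: measurable_superlevel; apply: measurable_funM. Qed.

(** For [i >= I] the right-hand side is false, so every exceedance by a late weight counts as a
    discrepancy. *)
Definition discrepancy (I : nat) (x : R) : set T :=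
  [set w | exists i, (x < th * stick_breaking (Y^~ w) i)%R !=
                     ((i < I)%N && (x < th * residual_limit i * Y i w)%R)].

Lemma measurable_discrepancy I x : measurable (discrepancy I x).
Proof.
rewrite (_ : discrepancy I x = \bigcup_i
    [set w | (x < th * stick_breaking (Y^~ w) i)%R !=
             ((i < I)%N && (x < th * residual_limit i * Y i w)%R)]); last first.
  by apply/seteqP; split => w /=; [move=> [i h]; exists i|move=> [i _ h]; exists i].
apply: bigcup_measurable => i _.
have [iI|Ii] /= := ltnP i I; last first.
  rewrite (_ : [set w | _] = [set w | (x < th * stick_breaking (Y^~ w) i)%R])//.
  by apply/seteqP; split => w /=; case: ltP.
rewrite (_ : [set w | _] =
  ([set w | (x < th * stick_breaking (Y^~ w) i)%R] `\`
     [set w | (x < th * residual_limit i * Y i w)%R]) `|`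
  ([set w | (x < th * residual_limit i * Y i w)%R] `\`
     [set w | (x < th * stick_breaking (Y^~ w) i)%R])); last first.
  apply/seteqP; split => w /=; case: (x < _)%R; case: (x < _)%R => //=; intuition.
by apply: measurableU; apply: measurableD.
Qed.

(* Up to index [I] the residual is replaced by its deterministic limit: a threshold is
   crossed by only one of the two sequences if the comparison variable lies in a narrow
   band around it, or if a large factor comes with a large deviation of the residual. *)
Lemma discrepancy_le (I : nat) (x k : R) :
  1 <= x -> x <= 2 * th - 1 -> I%:R <= th -> 0 < k < 2^-1 ->
  (P (discrepancy I x) <=
   (th * expR (2 - x - (1 - al) * x * I%:R / (4 * th))
    + \sum_(i < I) (comparison_tail i (x / (1 + 2 * k)) - comparison_tail i (x / (1 - 2 * k)))
    + \sum_(i < I) fine (P [set w | (x / (th + 1) < Y i w)%R]) *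
        ((I%:R / th ^+ 2 + (2 * (I%:R / th) ^+ 2 + th^-1) ^+ 2) / k ^+ 2))%:E)%E.
Proof.
move=> x1 xth Ith /andP[k0 k1].
have x0 : 0 < x by lra.
pose tl := [set w | exists2 i, (I <= i)%N & (x < th * stick_breaking (Y^~ w) i)%R].
pose bd i := [set w | (x / (1 + 2 * k) < th * residual_limit i * Y i w)%R] `\`
             [set w | (x / (1 - 2 * k) < th * residual_limit i * Y i w)%R].
pose dv i := [set w | (x / (th + 1) < Y i w)%R /\ (k <= `|residual (Y^~ w) i - residual_limit i|)%R].
have mtl : measurable tl.
  rewrite (_ : tl = \bigcup_(i in [set i | (I <= i)%N])
    [set w | (x < th * stick_breaking (Y^~ w) i)%R]).
    by apply: bigcup_measurable => i _.
  by apply/seteqP; split => w /= [i]; exists i.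
have mbd i : measurable (bd i) by exact: measurableD.
have mdv i : measurable (dv i).
  rewrite (_ : dv i = [set w | (x / (th + 1) < Y i w)%R] `&`
     ((fun w => `|residual (Y^~ w) i - residual_limit i|) @^-1` `[k, +oo[)); last first.
    by apply/seteqP; split => w /=; rewrite in_itv/= andbT.
  apply: measurableI; first exact: mYgt.
  apply: measurable_preimage => //; apply: measurableT_comp; first exact: normr_measurable.
  by apply: measurable_funB => //; exact: measurable_residual.
have ith i : (i < I)%N -> i%:R <= th.
  by move=> iI; apply: le_trans Ith; rewrite ler_nat ltnW.
have k2 : 0 < 1 - 2 * k by lra.
have k3 : 0 < 1 + 2 * k by lra.
have sub : discrepancy I x `<=` tl `|` (\big[setU/set0]_(i < I) bd i `|` \big[setU/set0]_(i < I) dv i).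
  move=> w /= [i]; have [iI|Ii] /= := ltnP i I; last first.
    by move=> h; left; exists i => //; move: h; case: ltP.
  move=> h; right.
  have /andP[Y0 Y1] := Y01 i w.
  have /andP[R0 R1] := R01 i w.
  have /andP[l0 l1] := residual_limit_bounds (ith _ iI).
  set r := residual_limit i in h l0 l1; set Q := residual (Y^~ w) i in h R0 R1.
  have r0 : 0 < r by lra.
  have [kQ|Qk] := leP k `|Q - r|.
    right; rewrite -bigcup_mkord; exists i => //; split => //.
    (* One of the two variables exceeds [x]; as Q <= 1 and th r <= th + 1, the factor [Y i] exceeds
       x / (th + 1) in both cases. *)
    have : (x < th * (Q * Y i w)) || (x < th * r * Y i w).
      by move: h; rewrite /stick_breaking -/Q; case: ltP; case: ltP.
    move=> /orP[xv|xr].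
      rewrite ltr_pdivrMr; last by rewrite ltr_pwDl.
      apply: (lt_le_trans xv); rewrite mulrC ler_pM ?mulr_ge0 ?(ltW th0) ?(ltW R0) ?(ltW Y0)//.
        by rewrite ler_piMl ?(ltW Y0).
      by rewrite lerDl.
    rewrite ltr_pdivrMr; last by rewrite ltr_pwDl.
    apply: (lt_le_trans xr); rewrite mulrC ler_wpM2l ?(ltW Y0)//.
    by rewrite mulrC -ler_pdivlMr.
  left; rewrite -bigcup_mkord; exists i => //.
  move: Qk; rewrite ltr_distl => /andP[Q1 Q2].
  (* The doubling of [k] comes from [r >= 1/2]: an absolute error [k] is a relative error of at most
     [2 * k]. *)
  have Qu : Q <= (1 + 2 * k) * r by nra.
  have Ql : (1 - 2 * k) * r <= Q by nra.
  have tY : 0 < th * Y i w by rewrite mulr_gt0.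
  rewrite /bd /=; split.
    rewrite ltr_pdivrMr// -/r.
    have : (x < th * (Q * Y i w)) || (x < th * r * Y i w).
      by move: h; rewrite /stick_breaking -/Q; case: ltP; case: ltP.
    move=> /orP[xv|xr].
      apply: (lt_le_trans xv).
      have -> : th * (Q * Y i w) = Q * (th * Y i w) by ring.
      have -> : th * r * Y i w * (1 + 2 * k) = ((1 + 2 * k) * r) * (th * Y i w) by ring.
      by rewrite ler_wpM2r// ltW.
    apply: (lt_le_trans xr); rewrite ler_peMr//; last lra.
    exact/ltW/(lt_trans x0).
  apply/negP; rewrite -leNgt -/r ler_pdivlMr//.
  have : (th * (Q * Y i w) <= x) || (th * r * Y i w <= x).
    rewrite !leNgt; move: h; rewrite /stick_breaking -/Q.
    by case: (x < _); case: (x < _).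
  move=> /orP[xv|xr].
    apply: le_trans xv.
    have -> : th * (Q * Y i w) = Q * (th * Y i w) by ring.
    have -> : th * r * Y i w * (1 - 2 * k) = ((1 - 2 * k) * r) * (th * Y i w) by ring.
    by rewrite ler_wpM2r// ltW.
  apply: le_trans xr; rewrite ler_piMr//; last lra.
  have -> : th * r * Y i w = r * (th * Y i w) by ring.
  by rewrite mulr_ge0// ltW.
have mB : measurable (\big[setU/set0]_(i < I) bd i).
  by apply: bigsetU_measurable => i _.
have mV : measurable (\big[setU/set0]_(i < I) dv i).
  by apply: bigsetU_measurable => i _.
apply: (@le_trans _ _ (P (tl `|` (\big[setU/set0]_(i < I) bd i `|` \big[setU/set0]_(i < I) dv i)))).
  apply: le_measure; rewrite ?inE//; first exact: measurable_discrepancy.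
  by apply: measurableU => //; exact: measurableU.
apply: (le_trans (measureU2 _ _ _)) => //; first exact: measurableU.
rewrite -addrA EFinD; apply: leeD; first exact: tail_event.
apply: (le_trans (measureU2 _ _ _)) => //.
rewrite EFinD; apply: leeD.
  apply: (@le_trans _ _ (\sum_(i < I) P (bd i))%E).
    by apply: content_subadditive.
  rewrite -sumEFin; apply: lee_sum => i _.
  have -> : P (bd i) =
    (P [set w | (x / (1 + 2 * k) < th * residual_limit i * Y i w)%R] -
     P [set w | (x / (1 - 2 * k) < th * residual_limit i * Y i w)%R])%E.
    rewrite [LHS]measureD//; last by rewrite ltey_eq fin_num_measure.
    rewrite setIidr// => w /=; apply: le_lt_trans.
    by rewrite ler_wpM2l ?(ltW x0)// lef_pV2 ?posrE//; lra.
  by rewrite /comparison_tail EFinB -!fine_probE.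
apply: (@le_trans _ _ (\sum_(i < I) P (dv i))%E).
  by apply: content_subadditive.
rewrite -sumEFin; apply: lee_sum => i _.
have /andP[l0 l1] := residual_limit_bounds (ith _ (ltn_ord i)).
have r0 : 0 <= residual_limit i by lra.
apply: (le_trans (residual_deviation _ _ r0 k0)).
have iI : (i%:R : R) <= I%:R by rewrite ler_nat ltnW.
rewrite lee_fin ler_wpM2l ?fine_ge0// ler_wpM2r ?invr_ge0 ?sqr_ge0//.
apply: (le_trans (residual_square_deviation i)).
have thV : 0 <= th^-1 by rewrite invr_ge0 ltW.
have q0 (j : nat) : 0 <= j%:R / th by rewrite divr_ge0// ltW.
apply: lerD; first by rewrite ler_wpM2r ?invr_ge0 ?sqr_ge0.
rewrite lerXn2r ?nnegrE ?addr_ge0 ?mulr_ge0 ?sqr_ge0 ?q0//.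
rewrite lerD2r ler_wpM2l// lerXn2r ?nnegrE ?q0//.
by rewrite ler_wpM2r.
Qed.

End stick_breaking.

(** * Large parameter asymptotics *)

Section selection.
Context {R : realType}.

(* Uniformity over the finite range [i <= I th]: select, for each [th], an index
   violating the bound whenever there is one. *)
Lemma uniform_of_selection (I : R -> nat) (F : R -> nat -> R) (l : R) :
  (forall i : R -> nat, (forall th, (i th <= I th)%N) -> F th (i th) @[th --> +oo] --> l) ->
  forall e, 0 < e -> \forall th \near +oo, forall i, (i <= I th)%N -> `|F th i - l| <= e.
Proof.
move=> h e e0.
have /choice[i iP] th : exists i : nat, (i <= I th)%N /\
    ((exists2 j, (j <= I th)%N & ~ `|F th j - l| <= e) -> ~ `|F th i - l| <= e).
  have [[j jI jF]|nj] := pselect (exists2 j, (j <= I th)%N & ~ `|F th j - l| <= e).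
    by exists j; split.
  by exists 0%N; split.
have := h i (fun th => (iP th).1); move/cvgrPdist_le => /(_ e e0).
apply: filterS => th hth j jI; apply: contrapT => nj.
by apply: (iP th).2; [exists j|rewrite distrC].
Qed.

End selection.

(** * The logarithmic scale and the cutoff *)

Section scale.
Context {R : realType}.
Implicit Types th : R.

(* With [M = (ln th)^(1/4)] and the cutoff [I = th / M^3], the weights beyond [I] are
   negligible because [ln th * I / th = M] is large, while the squared error of the
   residual before [I], of order [(I / th)^4 = M^-12], is small against the squared
   relative width [(ln th)^-2 = M^-8] of a band of thresholds. *)
Definition scaleM (th : R) : R := ln th `^ 4^-1.
Definition cutoff (th : R) : nat := Num.truncn (th / scaleM th ^+ 3).

Lemma cvgy_ln : @ln R th @[th --> +oo] --> +oo.
Proof.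
apply/cvgryPge => A; near=> th.
have th0 : 0 < th by near: th; apply: nbhs_pinfty_gt; rewrite num_real.
by rewrite -(expRK A) ler_ln ?posrE ?expR_gt0//; near: th; apply: nbhs_pinfty_ge; rewrite num_real.
Unshelve. all: end_near. Qed.

Lemma near_ln (A : R) : \forall th \near +oo, A <= @ln R th.
Proof. by have /cvgryPge := cvgy_ln; apply. Qed.

Lemma cvg_expR_1 (f : R -> R) :
  f th @[th --> +oo] --> 0 -> expR (f th) @[th --> +oo] --> (1 : R).
Proof.
move=> h; have := continuous_cvg _ (@continuous_expR R 0) h.
by rewrite expR0; exact.
Qed.

Lemma near_scaleM (A : R) : \forall th \near +oo, A <= scaleM th.
Proof.
near=> th.
have L0 : (Num.max A 1) ^+ 4 <= ln th by near: th; exact: near_ln.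
have m0 : 0 <= Num.max A 1 by rewrite le_max ler01 orbT.
apply: (@le_trans _ _ (Num.max A 1)); first by rewrite le_max lexx.
have -> : Num.max A 1 = (Num.max A 1 ^+ 4) `^ 4^-1.
  by rewrite -powR_mulrn// -powRrM divff// powRr1.
by rewrite /scaleM ge0_ler_powR ?nnegrE ?exprn_ge0// (le_trans _ L0)// exprn_ge0.
Unshelve. all: end_near. Qed.

Definition scale_bounds th := [/\ 1 < th, 0 < scaleM th, ln th = scaleM th ^+ 4,
  ln (ln th) <= 4 * scaleM th & 0 <= ln (ln th)].

Lemma near_scale : \forall th \near +oo, scale_bounds th.
Proof.
near=> th.
have th1 : 1 < th by near: th; apply: nbhs_pinfty_gt; rewrite num_real.
have L1 : 1 <= ln th by near: th; exact: near_ln.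
have L0 : 0 < ln th by exact: lt_le_trans L1.
have M0 : 0 < scaleM th by rewrite powR_gt0.
have LM : ln th = scaleM th ^+ 4.
  by rewrite -powR_mulrn ?(ltW M0)// /scaleM -powRrM mulVf// powRr1// ltW.
split => //; last exact: ln_ge0.
rewrite [X in ln X]LM lnXn// -[leLHS]mulr_natl ler_wpM2l//.
exact/ltW/ln_sublinear.
Unshelve. all: end_near. Qed.

(** With M = [scaleM th], the parameter is e^(M^4), at least M^12 / 6 by the cubic term of the
    series; the spare power of M absorbs the 6. *)
Lemma near_theta_scaleM : \forall th \near +oo, scaleM th ^+ 11 <= th.
Proof.
near=> th.
have [th1 M0 LM _ _] : scale_bounds th by near: th; exact: near_scale.
have M6 : 6 <= scaleM th by near: th; exact: near_scaleM.
have th0 : 0 < th by lra.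
rewrite -[leRHS]lnK ?posrE// LM.
have := expR_ge1Dxn 2 (exprn_ge0 4 (ltW M0)).
rewrite -exprM (_ : (4 * 3)%N = 12%N)// (_ : 3`!%:R = 6 :> R)// => h.
apply: (@le_trans _ _ (scaleM th ^+ 12 / 6)); last lra.
by rewrite ler_pdivlMr// (exprS _ 11) mulrC ler_wpM2r// exprn_ge0// ltW.
Unshelve. all: end_near. Qed.

Lemma cutoff_le th : 0 < th -> 0 < scaleM th -> (cutoff th)%:R / th <= (scaleM th ^+ 3)^-1.
Proof.
move=> th0 M0; rewrite ler_pdivrMr// mulrC /cutoff.
by rewrite truncn_le// divr_ge0 ?exprn_ge0// ltW.
Qed.

Lemma cvg0_scaleM (f : R -> R) (C : R) :
  (\forall th \near +oo, `|f th| <= C / scaleM th) -> f th @[th --> +oo] --> 0.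
Proof.
move=> h; apply/cvgrPdist_le => e e0; near=> th.
rewrite sub0r normrN.
have hf : `|f th| <= C / scaleM th by near: th.
have M1 : 1 <= scaleM th by near: th; exact: near_scaleM.
have Mc : `|C| / e <= scaleM th by near: th; exact: near_scaleM.
have M0 : 0 < scaleM th by lra.
apply: (le_trans hf); rewrite ler_pdivrMr//.
apply: (le_trans (ler_norm C)).
by rewrite mulrC -ler_pdivrMr.
Unshelve. all: end_near. Qed.

End scale.

(** * Sharp tail of a single comparison variable *)

Section tail_asymptotics.
Context {R : realType}.
Variables (al z : R).
Hypothesis al01 : 0 <= al < 1.
Implicit Types th : R.

Let al0 : 0 <= al. Proof. by have /andP[] := al01. Qed.
Let a01 : 0 < 1 - al <= 1.
Proof. by have /andP[h1 h2] := al01; rewrite subr_gt0 h2 gerBl. Qed.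
Let g0 : 0 < Gamma_fun (1 - al). Proof. exact: Gamma_fun_gt0. Qed.

Definition level th : R := beta_const al th + z.

(** ln ln th is at most 4 M by [scale_bounds], so (al + 1) ln ln th costs at most 8 M, and one more
    M absorbs the constants. *)
Lemma near_level : \forall th \near +oo, `|level th - ln th| <= 9 * scaleM th.
Proof.
near=> th.
have [th1 M0 LM lnL lnL0] : scale_bounds th by near: th; exact: near_scale.
have MC : `|ln (Gamma_fun (1 - al))| + `|z| <= scaleM th by near: th; exact: near_scaleM.
rewrite /level /beta_const.
have -> : ln th - (al + 1) * ln (ln th) - ln (Gamma_fun (1 - al)) + z - ln th =
  (z - ln (Gamma_fun (1 - al))) - (al + 1) * ln (ln th) by ring.
apply: (le_trans (ler_normB _ _)).
have h1 : `|z - ln (Gamma_fun (1 - al))| <= scaleM th.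
  by apply: (le_trans (ler_normB _ _)); rewrite addrC.
have h2 : `|(al + 1) * ln (ln th)| <= 8 * scaleM th.
  have /andP[_ al1] := al01.
  by rewrite ger0_norm ?mulr_ge0 ?addr_ge0//; nra.
by lra.
Unshelve. all: end_near. Qed.

Definition level_bounds th :=
  [/\ ln th / 2 <= level th, level th <= 2 * ln th & 2 <= level th].

Lemma near_level_bounds : \forall th \near +oo, level_bounds th.
Proof.
near=> th.
have [th1 M0 LM _ _] : scale_bounds th by near: th; exact: near_scale.
have : `|level th - ln th| <= 9 * scaleM th by near: th; exact: near_level.
have M4 : 18 <= scaleM th by near: th; exact: near_scaleM.
have LM2 : 18 * scaleM th <= ln th.
  by rewrite LM (exprSr _ 3) ler_wpM2r ?(ltW M0)// (le_trans M4)// ler_eXnr//; lra.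
by rewrite ler_norml => /andP[h1 h2]; split; lra.
Unshelve. all: end_near. Qed.

Lemma cvg_level_ln : level th / ln th @[th --> +oo] --> (1 : R).
Proof.
rewrite -[X in _ --> X]add0r -(_ : (fun th => (level th / ln th - 1) + 1) = (fun th => level th / ln th)); last first.
  by apply/funext => th; rewrite subrK.
apply: cvgD; last exact: cvg_cst.
apply: (@cvg0_scaleM _ _ 9); near=> th.
have [th1 M0 LM _ _] : scale_bounds th by near: th; exact: near_scale.
have h : `|level th - ln th| <= 9 * scaleM th by near: th; exact: near_level.
have M1 : 1 <= scaleM th by near: th; exact: near_scaleM.
have L0 : 0 < ln th by rewrite LM exprn_gt0.
have -> : level th / ln th - 1 = (level th - ln th) / ln th by field; rewrite gt_eqF.
rewrite normrM [X in _ * X]gtr0_norm ?invr_gt0// ler_pdivrMr//.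
apply: (le_trans h); rewrite LM.
have -> : 9 / scaleM th * scaleM th ^+ 4 = 9 * scaleM th ^+ 3 by field; rewrite gt_eqF.
by rewrite ler_wpM2l// ler_eXnr.
Unshelve. all: end_near. Qed.

(* [th * residual_limit i * y] exceeds [level th] iff [y] exceeds [factor_level th i]. *)
Definition factor_exponent th (i : nat) : R := th + i.+1%:R * al.
Definition factor_level th (i : nat) : R :=
  level th * (th + i%:R) / (th * factor_exponent th i).
Definition tail_bound th i : R :=
  let b := factor_exponent th i in let u := factor_level th i in
  u `^ (- al) * (1 - u) `^ b / (b * Beta_fun (1 - al) b).
Definition tail_limit th (i : nat) : R :=
  expR (- z) * (ln th / th) * expR (- (ln th / th)) ^+ i.

(** [beta_const] is made for this identity: Gamma and (ln th)^al cancel what the beta tail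
    contributes, and ln th / th is the inverse of the effective number of indices. *)
Lemma expR_level th : 1 < th -> 1 < ln th ->
  expR (- level th) = expR (- z) * (ln th / th) * (Gamma_fun (1 - al) * ln th `^ al).
Proof.
move=> th1 L1; have th0 : 0 < th by lra.
have L0 : 0 < ln th by lra.
rewrite /level /beta_const !opprD !opprK expRD mulrC -mulrA; congr (_ * _).
rewrite !expRD lnK ?posrE// expRN lnK ?posrE//.
rewrite (mulrC (al + 1)) expRM lnK ?posrE// powRD; last by rewrite (gt_eqF L0) implybT.
by rewrite powRr1 ?(ltW L0)//; ring.
Qed.

Section selected_index.
(** One index per parameter, as in [uniform_of_selection]: uniform estimates become ordinary
    limits. *)
Variable i : R -> nat.
Hypothesis iI : forall th, (i th <= cutoff th)%N.

Let iM : \forall th \near +oo, 0 <= (i th)%:R / th <= (scaleM th ^+ 3)^-1.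
Proof.
near=> th.
have [th1 M0 LM _ _] : scale_bounds th by near: th; exact: near_scale.
have th0 : 0 < th by lra.
rewrite divr_ge0 ?(ltW th0)//=.
apply: le_trans (cutoff_le th0 M0); rewrite ler_wpM2r ?invr_ge0 ?(ltW th0)//.
by rewrite ler_nat.
Unshelve. all: end_near. Qed.

(** The product of the beta parameter and the threshold, see [factor_bounds]; the parameter itself
    has dropped out. *)
Let s th := level th * (1 + (i th)%:R / th).
Let b th := factor_exponent th (i th).
Let u th := factor_level th (i th).

Let factor_bounds th := [/\ 0 < u th < 1, th <= b th, b th * u th = s th,
  0 < s th & s th <= 4 * ln th].

Let ub : \forall th \near +oo, factor_bounds th.
Proof.
near=> th.
have [th1 M0 LM _ _] : scale_bounds th by near: th; exact: near_scale.
have th0 : 0 < th by lra.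
have [l1 l2 l3] : level_bounds th by near: th; exact: near_level_bounds.
have : 0 <= (i th)%:R / th <= (scaleM th ^+ 3)^-1 by near: th; exact: iM.
move=> /andP[i0 i1].
have M5 : 5 <= scaleM th by near: th; exact: near_scaleM.
have thM : scaleM th ^+ 11 <= th by near: th; exact: near_theta_scaleM.
have M31 : (scaleM th ^+ 3)^-1 <= 1.
  by rewrite invf_le1 ?exprn_gt0// exprn_ege1//; lra.
have bth : th <= b th by rewrite /b /factor_exponent lerDl mulr_ge0.
have b0 : 0 < b th by lra.
have bu : b th * u th = s th.
  by rewrite /u /factor_level -/(b th) /s; field; rewrite !gt_eqF.
have s0 : 0 < s th by rewrite /s mulr_gt0//; lra.
have s4 : s th <= 4 * ln th by rewrite /s; nra.
have u0 : 0 < u th by rewrite -(pmulr_rgt0 _ b0) bu.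
split => //; rewrite u0/= -(ltr_pM2l b0) bu mulr1.
apply: (le_lt_trans s4); apply: lt_le_trans bth; apply: lt_le_trans thM.
rewrite LM (exprD _ 7 4) ltr_pM2r ?exprn_gt0//.
apply: (@lt_le_trans _ _ (scaleM th)); first lra.
by rewrite ler_eXnr//; lra.
Unshelve. all: end_near. Qed.

Let cvg_i : (i th)%:R / th @[th --> +oo] --> (0 : R).
Proof.
apply: (@cvg0_scaleM _ _ 1); near=> th.
have : 0 <= (i th)%:R / th <= (scaleM th ^+ 3)^-1 by near: th; exact: iM.
move=> /andP[i0 i1].
have M1 : 1 <= scaleM th by near: th; exact: near_scaleM.
have M0 : 0 < scaleM th by lra.
rewrite ger0_norm// mul1r; apply: (le_trans i1).
by rewrite lef_pV2 ?posrE ?exprn_gt0// ler_eXnr.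
Unshelve. all: end_near. Qed.

Let cvg_s : s th / ln th @[th --> +oo] --> (1 : R).
Proof.
rewrite (_ : (fun th => s th / ln th) = (fun th => level th / ln th * (1 + (i th)%:R / th))); last first.
  by apply/funext => th; rewrite /s mulrAC.
have := cvgM cvg_level_ln (cvgD (cvg_cst (1 : R)) cvg_i); rewrite addr0 mulr1; exact.
Qed.

Let cvg_spow : (s th / ln th) `^ (- al) @[th --> +oo] --> (1 : R).
Proof.
have h : {for (1 : R), continuous (fun y : R => y `^ (- al))} by exact: continuous_powR_pos.
have := continuous_cvg _ h cvg_s; rewrite powR1; exact.
Qed.

Let cvg_b : b th @[th --> +oo] --> +oo.
Proof.
apply/cvgryPge => A; near=> th.
have [_ bth _ _ _] : factor_bounds th by near: th; exact: ub.
apply: le_trans bth; near: th; apply: nbhs_pinfty_ge; rewrite num_real//.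
Unshelve. all: end_near. Qed.

Let cvg_gamma :
  Gamma_fun (1 - al) / (b th `^ (1 - al) * Beta_fun (1 - al) (b th)) @[th --> +oo] --> (1 : R).
Proof.
rewrite -[X in _ --> X](@divff _ (Gamma_fun (1 - al))) ?gt_eqF//.
apply: cvgM; first exact: cvg_cst.
apply: cvgV; first by rewrite gt_eqF.
exact: (cvg_comp _ (fun b => b `^ (1 - al) * Beta_fun (1 - al) b) cvg_b (cvg_powR_Beta_fun a01)).
Qed.

(** With b u = s, [expR_le_onem] and 1 - u <= e^(-u) enclose the product between e^(-2 s^2 / b) and
    1, and s^2 / b is at most 16 (ln th)^2 / th. *)
Let cvg_onem : (1 - u th) `^ (b th) * expR (s th) @[th --> +oo] --> (1 : R).
Proof.
apply: (@squeeze_cvgr _ _ _ _ (fun th => expR (- (2 * (s th ^+ 2 / b th)))) (cst 1)); last exact: cvg_cst.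
- near=> th.
  have [/andP[u0 u1] bth bu s0 s4] : factor_bounds th by near: th; exact: ub.
  have [th1 M0 LM _ _] : scale_bounds th by near: th; exact: near_scale.
  have thM : scaleM th ^+ 11 <= th by near: th; exact: near_theta_scaleM.
  have M8 : 8 <= scaleM th by near: th; exact: near_scaleM.
  have b0 : 0 < b th by lra.
  have uh : u th <= 2^-1.
    rewrite -(ler_pM2l b0) bu; apply: (le_trans s4).
    rewrite ler_pdivlMr//; apply: le_trans bth; apply: le_trans thM.
    rewrite LM (exprD _ 7 4) mulrC mulrA ler_wpM2r ?exprn_ge0 ?(ltW M0)//.
    apply: (@le_trans _ _ (scaleM th)); first lra.
    by rewrite ler_eXnr//; lra.
  have e0 := expR_gt0 (s th).
  apply/andP; split.
    have -> : - (2 * (s th ^+ 2 / b th)) = - (u th + 2 * u th ^+ 2) * b th + s th.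
      by rewrite -bu; field; rewrite gt_eqF.
    rewrite expRD ler_wpM2r ?(ltW e0)// expRM ge0_ler_powR ?nnegrE ?(ltW b0) ?expR_ge0//.
      by rewrite subr_ge0 ltW.
    by apply: expR_le_onem; rewrite (ltW u0).
  apply: (@le_trans _ _ (expR (- u th) `^ (b th) * expR (s th))).
    rewrite ler_wpM2r ?(ltW e0)// ge0_ler_powR ?nnegrE ?(ltW b0) ?expR_ge0//.
      by rewrite subr_ge0 ltW.
    exact: expR_ge1Dx.
  by rewrite -expRM -expRD mulNr mulrC bu addNr expR0.
- apply: cvg_expR_1; apply: (@cvg0_scaleM _ _ 32); near=> th.
  have [_ bth bu s0 s4] : factor_bounds th by near: th; exact: ub.
  have [th1 M0 LM _ _] : scale_bounds th by near: th; exact: near_scale.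
  have thM : scaleM th ^+ 11 <= th by near: th; exact: near_theta_scaleM.
  have M1 : 1 <= scaleM th by near: th; exact: near_scaleM.
  have b0 : 0 < b th by lra.
  have q0 : 0 <= s th ^+ 2 / b th by exact: divr_ge0 (sqr_ge0 _) (ltW b0).
  have q1 : 0 <= 2 * (s th ^+ 2 / b th) by exact: mulr_ge0.
  rewrite normrN (ger0_norm q1).
  have -> : 32 / scaleM th = 2 * (16 / scaleM th) by ring.
  rewrite ler_wpM2l// ler_pdivrMr//.
  apply: (@le_trans _ _ (16 * ln th ^+ 2)).
    have -> : 16 * ln th ^+ 2 = (4 * ln th) ^+ 2 by ring.
    have s0' : 0 <= s th := ltW s0.
    have l4 : 0 <= 4 * ln th by exact: le_trans s4.
    by rewrite lerXn2r ?nnegrE.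
  rewrite -mulrA ler_wpM2l// ler_pdivlMl//.
  apply: le_trans bth; apply: le_trans thM.
  rewrite LM -exprM -exprS (_ : (4 * 2).+1 = 9%N)//.
  by apply: ler_weXn2l.
Unshelve. all: end_near. Qed.

(** In the decay along the index, the level is exchanged for ln th; the exponent changes by at most
    9 M times M^(-3). *)
Let cvg_shift : expR ((ln th - level th) * ((i th)%:R / th)) @[th --> +oo] --> (1 : R).
Proof.
apply: cvg_expR_1.
apply: (@cvg0_scaleM _ _ 9); near=> th.
have : 0 <= (i th)%:R / th <= (scaleM th ^+ 3)^-1 by near: th; exact: iM.
move=> /andP[i0 i1].
have h : `|level th - ln th| <= 9 * scaleM th by near: th; exact: near_level.
have M1 : 1 <= scaleM th by near: th; exact: near_scaleM.
have M0 : 0 < scaleM th by lra.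
rewrite normrM distrC [X in _ * X]ger0_norm//.
apply: (@le_trans _ _ (9 * scaleM th * (scaleM th ^+ 3)^-1)); first by rewrite ler_pM.
rewrite -mulrA ler_wpM2l// ler_pdivrMr ?exprn_gt0// mulrC ler_pdivlMr// -expr2.
by apply: ler_weXn2l.
Unshelve. all: end_near. Qed.

Let cvg_bound : tail_bound th (i th) / tail_limit th (i th) @[th --> +oo] --> (1 : R).
Proof.
have -> : (1 : R) = 1 * 1 * 1 * 1 by rewrite !mulr1.
(* Four factors tending to 1: the power of u, the beta function, (1 - u)^b, and the exchange of
   level and logarithm. That their product is the ratio is algebra through [expR_level]. *)
pose F th := (s th / ln th) `^ (- al) *
    (Gamma_fun (1 - al) / (b th `^ (1 - al) * Beta_fun (1 - al) (b th))) *
    ((1 - u th) `^ (b th) * expR (s th)) * expR ((ln th - level th) * ((i th)%:R / th)).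
have cF : F th @[th --> +oo] --> (1 * 1 * 1 * 1 : R) by exact: (cvgM (cvgM (cvgM cvg_spow cvg_gamma) cvg_onem) cvg_shift).
apply: cvg_trans cF; apply: near_eq_cvg; near=> th.
have [/andP[u0 u1] bth bu s0 s4] : factor_bounds th by near: th; exact: ub.
have [th1 M0 LM _ _] : scale_bounds th by near: th; exact: near_scale.
have M2 : 2 <= scaleM th by near: th; exact: near_scaleM.
have L1 : 1 < ln th by rewrite LM exprn_egt1//; lra.
have th0 : 0 < th by lra.
have L0 : 0 < ln th by lra.
have b0 : 0 < b th by lra.
have b1 : 1 < b th by lra.
have B0 : 0 < Beta_fun (1 - al) (b th) by exact: Beta_fun_gt0.
rewrite /F /tail_bound -/(u th) -/(b th) /tail_limit.
have us : u th `^ (- al) = (s th / ln th) `^ (- al) * (ln th `^ (- al) * b th `^ al).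
  have -> : b th `^ al = (b th)^-1 `^ (- al).
    rewrite -powR_inv1 ?(ltW b0)// -powRrM; congr (_ `^ _); ring.
  have h1 : 0 <= s th / ln th by exact: divr_ge0 (ltW s0) (ltW L0).
  have h2 : 0 <= (b th)^-1 by rewrite invr_ge0 ltW.
  rewrite -(powRM _ (ltW L0) h2) -(powRM _ h1 (mulr_ge0 (ltW L0) h2)).
  by congr (_ `^ _); rewrite -bu; field; rewrite !gt_eqF.
have bb : b th = b th `^ al * b th `^ (1 - al).
  rewrite -powRD; first by rewrite addrCA subrr addr0 powRr1// ltW.
  by rewrite (gt_eqF b0) implybT.
have LL : ln th `^ (- al) = (ln th `^ al)^-1 by rewrite powRN.
have ex : expR ((ln th - level th) * ((i th)%:R / th)) * expR (s th) *
    expR (- (ln th / th)) ^+ i th = expR (level th).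
  rewrite -expRM_natl -!expRD; congr expR; rewrite /s; ring.
have el := expR_level th1 L1.
have Lp : 0 < ln th `^ al by rewrite powR_gt0.
have bp1 : 0 < b th `^ al by rewrite powR_gt0.
have bp2 : 0 < b th `^ (1 - al) by rewrite powR_gt0.
have ez := expR_gt0 (- z).
have ei : 0 < expR (- (ln th / th)) ^+ i th by rewrite exprn_gt0 ?expR_gt0.
have elv : expR (- z) * (ln th / th) * (Gamma_fun (1 - al) * ln th `^ al) * expR (level th) = 1.
  by rewrite -el -expRD addNr expR0.
have D0 : ln th `^ al * expR (- z) * (ln th / th) * expR (- (ln th / th)) ^+ i th != 0.
  have Lt : 0 < ln th / th by exact: divr_gt0.
  exact: lt0r_neq0 (mulr_gt0 (mulr_gt0 (mulr_gt0 Lp ez) Lt) ei).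
have key : Gamma_fun (1 - al) * expR ((ln th - level th) * ((i th)%:R / th)) * expR (s th) =
    (ln th `^ al * expR (- z) * (ln th / th) * expR (- (ln th / th)) ^+ i th)^-1.
  rewrite -[LHS](mulfK D0) -[RHS]mul1r; congr (_ / _).
  by rewrite -[RHS]elv -ex; ring.
have -> : u th `^ (- al) * (1 - u th) `^ b th / (b th * Beta_fun (1 - al) (b th)) =
    (s th / ln th) `^ (- al) * (1 - u th) `^ b th /
      (ln th `^ al * b th `^ (1 - al) * Beta_fun (1 - al) (b th)).
  have -> : b th * Beta_fun (1 - al) (b th) =
      b th `^ al * b th `^ (1 - al) * Beta_fun (1 - al) (b th) by rewrite -bb.
  rewrite us LL.
  move: Lp bp1 bp2 B0.
  move: (ln th `^ al) (b th `^ al) (b th `^ (1 - al)) (Beta_fun (1 - al) (b th)).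
  move: (_ `^ (- al)) (_ `^ b th) => e1 e2 e3 e4 e5 e6 h1 h2 h3 h4.
  by field; rewrite !gt_eqF.
transitivity ((s th / ln th) `^ (- al) * (1 - u th) `^ b th /
   (b th `^ (1 - al) * Beta_fun (1 - al) (b th)) *
   (Gamma_fun (1 - al) * expR ((ln th - level th) * ((i th)%:R / th)) * expR (s th))).
  by ring.
rewrite key.
move: Lp bp2 B0 ez ei (divr_gt0 L0 th0).
move: (ln th `^ al) (b th `^ (1 - al)) (Beta_fun (1 - al) (b th)) (expR (- z)).
move: (expR (- (ln th / th)) ^+ i th) (ln th / th) ((s th / ln th) `^ (- al)) ((1 - u th) `^ b th).
move=> e0 e1 e2 e3 e4 e5 e6 e7 h1 h2 h3 h4 h5 h6.
by field; rewrite !gt_eqF.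
Unshelve. all: end_near. Qed.

(** The beta tail is known between two bounds; their ratio 1 + al / s tends to 1 because s grows
    like ln th. *)
Lemma cvg_tail_ratio (p : R -> R) :
  (\forall th \near +oo, 0 < u th < 1 ->
    tail_bound th (i th) / (1 + al / (b th * u th)) <= p th <= tail_bound th (i th)) ->
  p th / tail_limit th (i th) @[th --> +oo] --> (1 : R).
Proof.
move=> hp.
have cl : (1 + al / s th)^-1 @[th --> +oo] --> (1 : R).
  rewrite -[X in _ --> X]invr1; apply: cvgV => //.
  rewrite -[X in _ --> X]addr0; apply: cvgD; first exact: cvg_cst.
  apply: (@cvg0_scaleM _ _ 2); near=> th.
  have [_ _ _ s0 _] : factor_bounds th by near: th; exact: ub.
  have [l1 l2 l3] : level_bounds th by near: th; exact: near_level_bounds.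
  have [th1 M0 LM _ _] : scale_bounds th by near: th; exact: near_scale.
  have M1 : 1 <= scaleM th by near: th; exact: near_scaleM.
  have /andP[_ al1] := al01.
  rewrite ger0_norm ?divr_ge0 ?(ltW s0)// ler_pdivrMr// mulrAC ler_pdivlMr//.
  apply: (@le_trans _ _ (1 * scaleM th)); first by rewrite ler_wpM2r ?(ltW M0) ?(ltW al1).
  have ML : scaleM th <= ln th by rewrite LM ler_eXnr.
  have i0 : 0 <= (i th)%:R / th by rewrite divr_ge0//; lra.
  by rewrite /s; nra.
apply: (@squeeze_cvgr _ _ _ _
  (fun th => (1 + al / s th)^-1 * (tail_bound th (i th) / tail_limit th (i th)))
  (fun th => tail_bound th (i th) / tail_limit th (i th))).
- near=> th.
  have [u01 _ bu s0 _] : factor_bounds th by near: th; exact: ub.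
  have : 0 < u th < 1 ->
    tail_bound th (i th) / (1 + al / (b th * u th)) <= p th <= tail_bound th (i th) by near: th.
  move=> /(_ u01); rewrite bu => /andP[p1 p2].
  have [th1 M0 LM _ _] : scale_bounds th by near: th; exact: near_scale.
  have t0 : 0 < tail_limit th (i th).
    rewrite !mulr_gt0 ?exprn_gt0 ?expR_gt0// ?invr_gt0 ?LM ?exprn_gt0//; lra.
  rewrite mulrA ler_pM2r ?invr_gt0// ler_pM2r ?invr_gt0// p2 andbT.
  by rewrite mulrC.
- by have := cvgM cl cvg_bound; rewrite mulr1; exact.
- exact: cvg_bound.
Unshelve. all: end_near. Qed.

End selected_index.

End tail_asymptotics.

(** * Total mass of the limiting tails *)

Section geometric.
Context {R : realType}.
Implicit Types (th z : R).

(** A Riemann sum of e^(-t); the bounds come from 1 - y <= e^(-y) <= 1 / (1 + y) in the closed form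
    of the geometric sum. *)
Lemma geometric_expR_bounds (y : R) (n : nat) : 0 < y ->
  1 - expR (- (y * n%:R)) <= y * \sum_(i < n) expR (- y) ^+ i <= 1 + y.
Proof.
move=> y0; set q := expR (- y).
have q0 : 0 < q by exact: expR_gt0.
have qy : 1 - y <= q by exact: expR_ge1Dx.
have qy1 : q * (1 + y) <= 1.
  have qe : q * expR y = 1 by rewrite -expRD addNr expR0.
  by rewrite -[leRHS]qe ler_wpM2l ?(ltW q0)// expR_ge1Dx.
have qn : q ^+ n = expR (- (y * n%:R)) by rewrite -expRM_natr mulNr.
have qn0 : 0 < q ^+ n by rewrite exprn_gt0.
have S0 : 0 <= \sum_(i < n) q ^+ i by apply: sumr_ge0 => i _; rewrite exprn_ge0// ltW.
have Sq : (1 - q) * \sum_(i < n) q ^+ i = 1 - q ^+ n by rewrite -(opprB (q ^+ n) 1) subrX1; ring.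
rewrite -qn; move: S0 Sq; set S := \sum_(i < n) _ => S0 Sq.
apply/andP; split; first by rewrite -Sq ler_wpM2r//; lra.
have q1 : y <= (1 - q) * (1 + y) by lra.
have : y * S <= (1 - q) * (1 + y) * S by rewrite ler_wpM2r.
rewrite mulrAC Sq; nra.
Qed.

(** The step is ln th / th and the sum reaches ln th / th times the cutoff, about M, so the missing
    tail vanishes as well. *)
Lemma cvg_sum_tail_limit z :
  \sum_(i < cutoff th) tail_limit z th i @[th --> +oo] --> expR (- z).
Proof.
have -> : (fun th => \sum_(i < cutoff th) tail_limit z th i) =
  (fun th => expR (- z) * ((ln th / th) * \sum_(i < cutoff th) expR (- (ln th / th)) ^+ i)).
  by apply/funext => th; rewrite mulrA big_distrr.
rewrite -[X in _ --> X]mulr1; apply: cvgM; first exact: cvg_cst.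
apply: cvg_sub0; last exact: (cvg_cst (1 : R)).
apply: (@cvg0_scaleM _ _ 1); near=> th.
have [th1 M0 LM _ _] : scale_bounds th by near: th; exact: near_scale.
have thM : scaleM th ^+ 11 <= th by near: th; exact: near_theta_scaleM.
have M1 : 1 <= scaleM th by near: th; exact: near_scaleM.
have th0 : 0 < th by lra.
have y0 : 0 < ln th / th by rewrite divr_gt0// LM exprn_gt0.
have yM : ln th / th <= (scaleM th)^-1.
  rewrite ler_pdivrMr// ler_pdivlMl// LM -exprS; apply: le_trans thM.
  exact: ler_weXn2l.
have yI : scaleM th - (ln th / th) <= ln th / th * (cutoff th)%:R.
  have := truncnS_gt (th / scaleM th ^+ 3); rewrite -/(cutoff th) -natr1 => h.
  have : ln th / th * (th / scaleM th ^+ 3) <= ln th / th * ((cutoff th)%:R + 1).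
    by rewrite ler_wpM2l ?(ltW y0)// ltW.
  have -> : ln th / th * (th / scaleM th ^+ 3) = scaleM th.
    by rewrite LM; field; rewrite !gt_eqF.
  lra.
have /andP[h1 h2] := geometric_expR_bounds (cutoff th) y0.
rewrite -[_ + _]/(_ * _ - 1) div1r.
have h3 : expR (- (ln th / th * (cutoff th)%:R)) <= (scaleM th)^-1.
  rewrite expRN lef_pV2 ?posrE ?expR_gt0//; apply: le_trans (expR_ge1Dx _).
  have : (scaleM th)^-1 <= 1 by rewrite invf_le1.
  lra.
rewrite ler_norml; apply/andP; split; lra.
Unshelve. all: end_near. Qed.

Lemma tail_limit_gt0 z th (i : nat) : 1 < th -> 0 < tail_limit z th i.
Proof.
move=> th1; rewrite /tail_limit mulr_gt0 ?exprn_gt0 ?expR_gt0// mulr_gt0 ?expR_gt0//.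
by rewrite divr_gt0 ?ln_gt0//; lra.
Qed.

End geometric.

(** A relative error [k] in a level of size L = ln th is an absolute error of order k L, which is
    constant when k is a constant over ln th. *)
Lemma band_levels {R : realFieldType} (x k L : R) : 0 < k -> k <= 8^-1 -> L / 2 <= x -> x <= 2 * L ->
  (x - 4 * (k * L) <= x / (1 + 2 * k)) && (x / (1 - 2 * k) <= x + 8 * (k * L)).
Proof.
move=> k0 k8 xL Lx; apply/andP; split.
  by rewrite ler_pdivlMr; [nra|lra].
have L0 : 0 <= L by lra.
have h1 : k * x <= k * (2 * L) by rewrite ler_wpM2l// ltW.
have h2 : k * (k * L) <= 8^-1 * (k * L) by rewrite ler_wpM2r// mulr_ge0// ltW.
have h3 : 0 <= k * L by rewrite mulr_ge0// ltW.
by rewrite ler_pdivrMr; lra.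
Qed.

(** * Exceedances of the weights and of the comparison array *)

Section asymptotics.
Context {R : realType}.
Variables (al : R) (d : R -> measure_display) (T : forall th, measurableType (d th)).
Variables (P : forall th, probability (T th) R) (Y : forall th, nat -> T th -> R).
Arguments Y : clear implicits.
Hypothesis al01 : 0 <= al < 1.
Hypothesis indY : forall th, 1 < th -> mutually_independent (P th) (Y th).
Hypothesis betaY : forall th, 1 < th -> forall i,
  is_beta_rv (P th) (Y th i) (1 - al) (th + i.+1%:R * al).
Hypothesis Y01 : forall th, 1 < th -> forall i w, 0 < Y th i w < 1.

Let al0 : 0 <= al. Proof. by have /andP[] := al01. Qed.
Let al1 : al < 1. Proof. by have /andP[] := al01. Qed.
Let a01 : 0 < 1 - al <= 1.
Proof. by have /andP[h1 h2] := al01; rewrite subr_gt0 h2 gerBl. Qed.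

Definition comparison th z (i : nat) : R :=
  comparison_tail (P th) al th (Y th) i (level al z th).

Let comparison_event th i x (y : R) : 0 < th ->
  (x < th * residual_limit al th i * y) =
  (x * (th + i%:R) / (th * factor_exponent al th i) < y).
Proof.
move=> th0; rewrite /residual_limit -/(factor_exponent al th i).
have fe : 0 < factor_exponent al th i by rewrite /factor_exponent ltr_wpDr ?mulr_ge0.
have t0 : 0 < th + i%:R by rewrite ltr_wpDr.
rewrite mulrA -mulrAC ltr_pdivlMr// ltr_pdivrMr ?mulr_gt0//.
by congr (_ < _); ring.
Qed.

Lemma comparison_uniform z e : 0 < e -> \forall th \near +oo,
  forall i : nat, (i <= cutoff th)%N -> `|comparison th z i / tail_limit z th i - 1| <= e.
Proof.
move=> e0; apply: (uniform_of_selection _ e0) => i iI.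
apply: (cvg_tail_ratio al01 iI); near=> th => u01.
have th1 : 1 < th by near: th; apply: nbhs_pinfty_gt; rewrite num_real.
have th0 : 0 < th by lra.
have b1 : 1 < factor_exponent al th (i th) by rewrite /factor_exponent ltr_wpDr ?mulr_ge0.
rewrite /comparison /comparison_tail.
under [X in fine (P th X)]eq_set do rewrite comparison_event//.
have := beta_tail_bounds a01 b1 (betaY th1 (i th)) u01.
have -> : 1 - al - 1 = - al by rewrite addrAC subrr add0r.
have -> : 1 - (1 - al) = al by rewrite opprB addrC subrK.
by rewrite -/(factor_level al z th (i th)) -/(tail_bound al z th (i th)).
Unshelve. all: end_near. Qed.

(** The uniform relative error is summed against a bounded total, at most e^(-z) + 1 eventually;
    hence the choice of [e']. *)
Lemma cvg_sum_comparison z :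
  \sum_(i < cutoff th) comparison th z i @[th --> +oo] --> expR (- z).
Proof.
apply: cvg_sub0; last exact: cvg_sum_tail_limit.
apply/cvgrPdist_le => e e0; near=> th; rewrite sub0r normrN.
have th1 : 1 < th by near: th; apply: nbhs_pinfty_gt; rewrite num_real.
set e' := e / (expR (- z) + 1).
have z0 := expR_gt0 (- z).
have hu : forall i : nat, (i <= cutoff th)%N -> `|comparison th z i / tail_limit z th i - 1| <= e'.
  by near: th; apply: comparison_uniform; rewrite divr_gt0//; lra.
have hs : `|expR (- z) - \sum_(i < cutoff th) tail_limit z th i| <= 1.
  by near: th; move/cvgrPdist_le: (@cvg_sum_tail_limit R z); apply; exact: ltr01.
rewrite -[X in `|X|]/(_ - _) -sumrB; apply: (le_trans (ler_norm_sum _ _ _)).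
apply: (@le_trans _ _ (\sum_(i < cutoff th) e' * tail_limit z th i)).
  apply: ler_sum => i _; have t0 := tail_limit_gt0 z i th1.
  have := hu i (ltnW (ltn_ord i)); rewrite -(ler_pM2r t0) -{2}(gtr0_norm t0) -normrM.
  by rewrite mulrBl mul1r divfK// gt_eqF.
rewrite -big_distrr/= /e' mulrAC ler_pdivrMr; last lra.
rewrite ler_wpM2l ?(ltW e0)//; move: hs; rewrite ler_norml; lra.
Unshelve. all: end_near. Qed.

Lemma comparison_small z e : 0 < e -> \forall th \near +oo,
  forall i : nat, (i <= cutoff th)%N -> comparison th z i <= e.
Proof.
move=> e0; near=> th => i iI.
have [th1 M0 LM _ _] : scale_bounds th by near: th; exact: near_scale.
have thM : scaleM th ^+ 11 <= th by near: th; exact: near_theta_scaleM.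
have M1 : 1 <= scaleM th by near: th; exact: near_scaleM.
have Me : 2 * expR (- z) / e <= scaleM th by near: th; exact: near_scaleM.
have th0 : 0 < th by lra.
have z0 := expR_gt0 (- z).
have t0 := tail_limit_gt0 z i th1.
have hu : `|comparison th z i / tail_limit z th i - 1| <= 1.
  by move: iI; move: i {t0}; near: th; apply: comparison_uniform.
have yM : ln th / th <= (scaleM th)^-1.
  rewrite ler_pdivrMr// ler_pdivlMl// LM -exprS; apply: le_trans thM.
  exact: ler_weXn2l.
have y0 : 0 < ln th / th by rewrite divr_gt0// LM exprn_gt0.
have : comparison th z i / tail_limit z th i <= 2 by move: hu; rewrite ler_norml; lra.
rewrite ler_pdivrMr// => /le_trans; apply.
apply: (@le_trans _ _ (2 * (expR (- z) * (scaleM th)^-1))); last first.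
  by rewrite mulrA ler_pdivrMr// [leRHS]mulrC -ler_pdivrMr.
have ey : 0 <= expR (- z) * (ln th / th) by rewrite mulr_ge0 ?(ltW z0)// ltW.
rewrite ler_wpM2l// /tail_limit -[leRHS]mulr1 ler_pM ?exprn_ge0 ?expR_ge0//.
  by rewrite ler_wpM2l ?expR_ge0.
by rewrite exprn_ile1 ?expR_ge0// -expR0 ler_expR oppr_le0 ltW.
Unshelve. all: end_near. Qed.

(** Uniform in all [i], since the tail bound sees [b] only through b u and b^(1 - al) B(1 - al, b),
    and b u >= level - 1 when b >= th. The smaller threshold costs only a constant factor. *)
Lemma factor_tail_le z : exists C : R, \forall th \near +oo, forall i : nat,
  fine (P th [set w | level al z th / (th + 1) < Y th i w]) <= C * (ln th / th).
Proof.
have g0 : 0 < Gamma_fun (1 - al) by exact: Gamma_fun_gt0.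
have [A [_ hA]] : \forall b \near +oo, Gamma_fun (1 - al) / 2 <= b `^ (1 - al) * Beta_fun (1 - al) b.
  have /cvgrPdist_le := cvg_powR_Beta_fun a01.
  move=> /(_ (Gamma_fun (1 - al) / 2)) h; near=> b.
  have : `|Gamma_fun (1 - al) - b `^ (1 - al) * Beta_fun (1 - al) b| <= Gamma_fun (1 - al) / 2.
    by near: b; apply: h; rewrite divr_gt0.
  by rewrite ler_norml; lra.
exists (4 * 2 * expR 1 * expR (- z)); near=> th => i.
have [th1 M0 LM _ _] : scale_bounds th by near: th; exact: near_scale.
have thM : scaleM th ^+ 11 <= th by near: th; exact: near_theta_scaleM.
have M2 : 2 <= scaleM th by near: th; exact: near_scaleM.
have [l1 l2 l3] : level_bounds al z th by near: th; exact: near_level_bounds.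
have Ath : A < th by near: th; apply: nbhs_pinfty_gt; rewrite num_real.
have th0 : 0 < th by lra.
have L1 : 1 < ln th by rewrite LM exprn_egt1//; lra.
have L0 : 0 < ln th by lra.
have Lth : 2 * ln th <= th.
  rewrite LM; apply: le_trans thM; rewrite (exprD _ 7 4) ler_wpM2r ?exprn_ge0 ?(ltW M0)//.
  by apply: (le_trans M2); rewrite ler_eXnr//; lra.
set x := level al z th in l1 l2 l3 *; set b := factor_exponent al th i.
have bth : th <= b by rewrite /b /factor_exponent lerDl mulr_ge0.
have b1 : 1 < b by lra.
have b0 : 0 < b by lra.
set u := x / (th + 1).
have t10 : 0 < th + 1 by lra.
have u0 : 0 < u by rewrite divr_gt0//; lra.
have u1 : u < 1 by rewrite ltr_pdivrMr//; lra.
have bu : x - 1 <= b * u.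
  apply: (@le_trans _ _ (th * u)); last by rewrite ler_wpM2r// ltW.
  have : x = th * u + u by rewrite /u; field; rewrite gt_eqF.
  lra.
have u01 : 0 < u < 1 by rewrite u0.
have /andP[_ h] := beta_tail_bounds a01 b1 (betaY th1 i) u01.
apply: (le_trans h).
have -> : 1 - al - 1 = - al by rewrite addrAC subrr add0r.
have hB : Gamma_fun (1 - al) / 2 <= b `^ (1 - al) * Beta_fun (1 - al) b.
  by apply: hA; exact: lt_le_trans bth.
have -> : b * Beta_fun (1 - al) b = b `^ al * (b `^ (1 - al) * Beta_fun (1 - al) b).
  rewrite mulrA -powRD; last by rewrite (gt_eqF b0) implybT.
  by rewrite addrCA subrr addr0 powRr1// ltW.
have hbu : ln th / 4 <= b * u by lra.
have L4 : 0 <= ln th / 4 by lra.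
have p1 : u `^ (- al) / b `^ al <= 4 / ln th `^ al.
  rewrite -powRN -powRM ?(ltW u0) ?(ltW b0)// mulrC powRN.
  have -> : 4 / ln th `^ al = (ln th `^ al / 4)^-1 by rewrite invf_div.
  rewrite lef_pV2 ?posrE ?divr_gt0 ?powR_gt0 ?(mulr_gt0 b0 u0)//.
  apply: (@le_trans _ _ ((ln th / 4) `^ al)); last by rewrite ge0_ler_powR ?nnegrE// (le_trans L4).
  rewrite powRM ?(ltW L0)// ler_wpM2l ?powR_ge0//.
  by rewrite -[leLHS]powRr1 ?invr_ge0// ger_powR ?(ltW al1)// invr_gt0 ltr0n/= invf_le1// ler1n.
have p2 : (1 - u) `^ b <= expR (1 - x).
  apply: (@le_trans _ _ (expR (- u) `^ b)).
    rewrite ge0_ler_powR ?nnegrE ?(ltW b0) ?expR_ge0//; first by rewrite subr_ge0 ltW.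
    exact: expR_ge1Dx.
  by rewrite -expRM ler_expR mulNr mulrC; lra.
rewrite expRD (expR_level z al01 th1 L1) in p2.
have Lp : 0 < ln th `^ al by rewrite powR_gt0.
have bp : 0 < b `^ al by rewrite powR_gt0.
have Bp : 0 < b `^ (1 - al) * Beta_fun (1 - al) b by apply: lt_le_trans hB; rewrite divr_gt0.
rewrite invfM mulrACA mulrA.
apply: (@le_trans _ _ (4 / ln th `^ al * (expR 1 * (expR (- z) * (ln th / th) *
    (Gamma_fun (1 - al) * ln th `^ al))) * (Gamma_fun (1 - al) / 2)^-1)).
  rewrite ler_pM ?mulr_ge0 ?invr_ge0 ?powR_ge0 ?(ltW Bp)//.
    by rewrite ler_pM ?mulr_ge0 ?invr_ge0 ?powR_ge0.
  by rewrite lef_pV2 ?posrE// divr_gt0.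
rewrite le_eqVlt; apply/orP; left; apply/eqP.
move: Lp g0; move: (ln th `^ al) (Gamma_fun _) => e1 e2 h1 h2.
by field; rewrite !gt_eqF.
Unshelve. all: end_near. Qed.

(** th e^(-level) is of order (ln th)^(1 + al), at most M^8 up to a constant. Level times cutoff
    over th is at least M/2 - 1, so a factor e^(-c M) remains; bounding it by 9! / (c M)^9 leaves 1
    / M. *)
Lemma cvg_tail_term z : th * expR (2 - level al z th -
  (1 - al) * level al z th * (cutoff th)%:R / (4 * th)) @[th --> +oo] --> 0.
Proof.
have g0 : 0 < Gamma_fun (1 - al) by exact: Gamma_fun_gt0.
set c := (1 - al) / 8; have c0 : 0 < c by rewrite divr_gt0// subr_gt0.
apply: (@cvg0_scaleM _ _ (expR 3 * expR (- z) * Gamma_fun (1 - al) * (9`!%:R / c ^+ 9))).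
near=> th.
have [th1 M0 LM _ _] : scale_bounds th by near: th; exact: near_scale.
have thM : scaleM th ^+ 11 <= th by near: th; exact: near_theta_scaleM.
have M2 : 2 <= scaleM th by near: th; exact: near_scaleM.
have [l1 l2 l3] : level_bounds al z th by near: th; exact: near_level_bounds.
have th0 : 0 < th by lra.
have L1 : 1 < ln th by rewrite LM exprn_egt1//; lra.
have L0 : 0 < ln th by lra.
have Lth : 2 * ln th <= th.
  rewrite LM; apply: le_trans thM; rewrite (exprD _ 7 4) ler_wpM2r ?exprn_ge0 ?(ltW M0)//.
  by apply: (le_trans M2); rewrite ler_eXnr//; lra.
set x := level al z th in l1 l2 l3 *.
have xI : scaleM th / 2 - 1 <= x * (cutoff th)%:R / th.
  have hI := truncnS_gt (th / scaleM th ^+ 3).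
  rewrite -/(cutoff th) -natr1 in hI.
  have h1 : (ln th / 2) * (th / scaleM th ^+ 3 - 1) <= x * (cutoff th)%:R.
    rewrite ler_pM//; [lra| |lra].
    rewrite subr_ge0 ler_pdivlMr ?exprn_gt0// mul1r; apply: le_trans thM.
    by apply: ler_weXn2l => //; lra.
  rewrite ler_pdivlMr//; apply: le_trans h1.
  have -> : ln th / 2 * (th / scaleM th ^+ 3 - 1) = scaleM th / 2 * th - ln th / 2.
    by rewrite LM; field; rewrite gt_eqF.
  lra.
have ex : expR (2 - x - (1 - al) * x * (cutoff th)%:R / (4 * th)) <=
    expR 3 * expR (- x) * expR (- (c * scaleM th)).
  rewrite -!expRD ler_expR.
  have : (1 - al) / 4 * (scaleM th / 2 - 1) <= (1 - al) / 4 * (x * (cutoff th)%:R / th).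
    by rewrite ler_wpM2l// divr_ge0// subr_ge0 ltW.
  have -> : (1 - al) / 4 * (x * (cutoff th)%:R / th) = (1 - al) * x * (cutoff th)%:R / (4 * th).
    by field; rewrite gt_eqF.
  rewrite /c; have : (1 - al) / 4 <= 1 by move: al0; lra.
  lra.
have cM : 0 <= c * scaleM th by rewrite mulr_ge0 ?ltW.
have e9 : expR (- (c * scaleM th)) <= 9`!%:R / (c * scaleM th) ^+ 9.
  have cM9 : 0 < (c * scaleM th) ^+ 9 by rewrite exprn_gt0// mulr_gt0.
  have f9 : 0 < 9`!%:R :> R by rewrite ltr0n fact_gt0.
  rewrite expRN -[leRHS]invrK invf_div lef_pV2 ?posrE ?expR_gt0 ?divr_gt0//.
  by have := expR_ge1Dxn 8 cM; lra.
rewrite ger0_norm ?mulr_ge0 ?expR_ge0 ?(ltW th0)//.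
apply: (@le_trans _ _ (th * (expR 3 * expR (- x) * (9`!%:R / (c * scaleM th) ^+ 9)))).
  rewrite ler_wpM2l ?(ltW th0)//; apply: (le_trans ex).
  by rewrite ler_wpM2l// mulr_ge0 ?expR_ge0.
rewrite (expR_level z al01 th1 L1).
have La : ln th `^ al <= ln th.
  by rewrite -[leRHS]powRr1 ?(ltW L0)// ler_powR ?(ltW L1)// ltW.
have K0 : 0 <= 9`!%:R / (c * scaleM th) ^+ 9 :> R by rewrite divr_ge0// exprn_ge0.
apply: (@le_trans _ _ (th * (expR 3 * (expR (- z) * (ln th / th) *
   (Gamma_fun (1 - al) * ln th)) * (9`!%:R / (c * scaleM th) ^+ 9)))).
  have z1 : 0 <= expR (- z) * (ln th / th).
    by rewrite mulr_ge0 ?expR_ge0// divr_ge0 ?(ltW L0) ?(ltW th0).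
  rewrite ler_wpM2l ?(ltW th0)// ler_wpM2r// ler_wpM2l ?expR_ge0// ler_wpM2l//.
  by rewrite ler_wpM2l ?(ltW g0).
rewrite le_eqVlt; apply/orP; left; apply/eqP.
rewrite LM; move: c0 M0 th0; move: (scaleM th) (9`!%:R : R) => M f h1 h2 h3.
by field; rewrite !gt_eqF.
Unshelve. all: end_near. Qed.

(** Powers of M, with I the cutoff: I terms of order ln th / th = M^4 / th, a squared deviation of
    order M^(-12) and a squared inverse width of order M^8 leave I / th <= M^(-3). *)
Lemma cvg_deviation_term z (dl : R) : 0 < dl ->
  \sum_(i < cutoff th) fine (P th [set w | (level al z th / (th + 1) < Y th i w)%R]) *
   (((cutoff th)%:R / th ^+ 2 + (2 * ((cutoff th)%:R / th) ^+ 2 + th^-1) ^+ 2) /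
    (dl / ln th) ^+ 2) @[th --> +oo] --> 0.
Proof.
move=> dl0; have [C hC] := factor_tail_le z.
apply: (@cvg0_scaleM _ _ (`|C| * 10 / dl ^+ 2)); near=> th.
have [th1 M0 LM _ _] : scale_bounds th by near: th; exact: near_scale.
have thM : scaleM th ^+ 11 <= th by near: th; exact: near_theta_scaleM.
have M1 : 1 <= scaleM th by near: th; exact: near_scaleM.
have hP : forall i : nat,
  fine (P th [set w | level al z th / (th + 1) < Y th i w]) <= C * (ln th / th) by near: th.
have th0 : 0 < th by lra.
have hI := cutoff_le th0 M0.
have ti : th^-1 <= (scaleM th ^+ 11)^-1 by rewrite lef_pV2 ?posrE ?exprn_gt0.
have I0 : 0 <= (cutoff th)%:R / th by rewrite divr_ge0// ltW.
have M30 : 0 < (scaleM th ^+ 3)^-1 by rewrite invr_gt0 exprn_gt0.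
have Mm (j k : nat) : (j <= k)%N -> (scaleM th ^+ k)^-1 <= (scaleM th ^+ j)^-1.
  by move=> jk; rewrite lef_pV2 ?posrE ?exprn_gt0//; exact: ler_weXn2l.
have D1 : (cutoff th)%:R / th ^+ 2 <= (scaleM th ^+ 12)^-1.
  apply: (@le_trans _ _ ((scaleM th ^+ 3)^-1 * (scaleM th ^+ 11)^-1)).
    by rewrite expr2 invfM mulrA ler_pM ?invr_ge0 ?(ltW th0).
  by rewrite -invfM -exprD; exact: Mm.
have D2 : 2 * ((cutoff th)%:R / th) ^+ 2 + th^-1 <= 3 * (scaleM th ^+ 6)^-1.
  have h1 : ((cutoff th)%:R / th) ^+ 2 <= (scaleM th ^+ 6)^-1.
    have -> : (scaleM th ^+ 6)^-1 = (scaleM th ^+ 3)^-1 ^+ 2 by rewrite exprVn -exprM.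
    by rewrite lerXn2r ?nnegrE// ltW.
  have h2 : (scaleM th ^+ 11)^-1 <= (scaleM th ^+ 6)^-1 by exact: Mm.
  lra.
have D3 : (2 * ((cutoff th)%:R / th) ^+ 2 + th^-1) ^+ 2 <= 9 * (scaleM th ^+ 12)^-1.
  have -> : 9 * (scaleM th ^+ 12)^-1 = (3 * (scaleM th ^+ 6)^-1) ^+ 2.
    by field; rewrite gt_eqF.
  rewrite lerXn2r ?nnegrE ?addr_ge0 ?mulr_ge0 ?sqr_ge0 ?invr_ge0 ?exprn_ge0 ?(ltW th0) ?(ltW M0)//.
set D := _ / th ^+ 2 + _.
have D0 : 0 <= D by rewrite addr_ge0 ?sqr_ge0// divr_ge0 ?sqr_ge0.
have DM : D <= 10 * (scaleM th ^+ 12)^-1 by rewrite /D; lra.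
have y0 : 0 < ln th / th by rewrite divr_gt0// LM exprn_gt0.
have k2 : 0 <= (dl / ln th) ^+ 2 by rewrite sqr_ge0.
have S0 : 0 <= \sum_(i < cutoff th) fine (P th [set w | level al z th / (th + 1) < Y th i w]) * (D / (dl / ln th) ^+ 2).
  by apply: sumr_ge0 => i _; rewrite mulr_ge0 ?divr_ge0// fine_ge0.
rewrite ger0_norm//.
apply: (@le_trans _ _ (\sum_(i < cutoff th) `|C| * (ln th / th) * (10 * (scaleM th ^+ 12)^-1 / (dl / ln th) ^+ 2))).
  apply: ler_sum => i _; rewrite ler_pM ?fine_ge0 ?divr_ge0//.
    by apply: (le_trans (hP _)); rewrite ler_wpM2r ?(ltW y0)// ler_norm.
  by rewrite ler_wpM2r ?invr_ge0.
rewrite sumr_const card_ord -[leLHS]mulr_natl.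
have -> : (cutoff th)%:R * (`|C| * (ln th / th) * (10 * (scaleM th ^+ 12)^-1 / (dl / ln th) ^+ 2)) =
  (cutoff th)%:R / th * (`|C| * 10 / dl ^+ 2).
  rewrite LM; move: M0 th0 dl0; move: (scaleM th) `|C| ((cutoff th)%:R : R) => M c q h1 h2 h3.
  by field; rewrite !gt_eqF.
rewrite mulrC ler_wpM2l ?divr_ge0 ?mulr_ge0 ?exprn_ge0 ?(ltW dl0)//.
by apply: (le_trans hI); have := Mm 1%N 3%N isT; rewrite expr1.
Unshelve. all: end_near. Qed.

Lemma le_comparison_tail th i (x y : R) : 1 < th -> x <= y ->
  comparison_tail (P th) al th (Y th) i y <= comparison_tail (P th) al th (Y th) i x.
Proof.
move=> th1 xy; have [mY _] := betaY th1 i.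
have mcomp u : measurable [set w | u < th * residual_limit al th i * Y th i w].
  by apply: measurable_superlevel; apply: measurable_funM.
by rewrite /comparison_tail le_fine_prob// => w /=; exact: le_lt_trans.
Qed.

(** The bands have relative width k = dl / ln th with [dl] fixed: their total probability is bounded
    by sums converging to the difference of e^(-y) between two levels 12 dl apart, small by the
    choice of [dl]. The other two terms vanish. *)
Lemma cvg_discrepancy z :
  fine (P th (discrepancy al th (Y th) (cutoff th) (level al z th))) @[th --> +oo] --> 0.
Proof.
apply/cvgrPdist_le => e e0.
have closing (a b c f t t' : R) : t <= e / 4 -> t' <= e / 4 -> a - b <= e / 4 ->
    `|a - c| <= e / 8 -> `|b - f| <= e / 8 -> t + (c - f) + t' <= e.
  by move=> t1 t2 t3; rewrite !ler_norml => /andP[h4 h4'] /andP[h5 h5']; lra.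
have [dl dl0 hdl] : exists2 dl : R, 0 < dl &
    expR (- (z - 4 * dl)) - expR (- (z + 8 * dl)) <= e / 4.
  have c1 : expR (- (z - 4 * dl)) - expR (- (z + 8 * dl)) @[dl --> (0 : R)] --> (0 : R).
    rewrite -[X in _ --> X](subrr (expR (- z))); apply: cvgB.
      rewrite -[X in expR (- X)](_ : z - 4 * 0 = z); last by rewrite mulr0 subr0.
      apply: (continuous_cvg _ (@continuous_expR R _)); apply: cvgN; apply: cvgB; first exact: cvg_cst.
      by apply: cvgM; [exact: cvg_cst|exact: cvg_id].
    rewrite -[X in expR (- X)](_ : z + 8 * 0 = z); last by rewrite mulr0 addr0.
    apply: (continuous_cvg _ (@continuous_expR R _)); apply: cvgN; apply: cvgD; first exact: cvg_cst.
    by apply: cvgM; [exact: cvg_cst|exact: cvg_id].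
  move/cvgrPdist_le: c1 => /(_ (e / 4)).
  rewrite divr_gt0// => /(_ isT) /nbhs_ballP[r /= r0 hr].
  exists (r / 2); first by rewrite divr_gt0.
  have := hr (r / 2); rewrite sub0r normrN => h.
  apply: le_trans (h _); first exact: ler_norm.
  rewrite /ball/= sub0r normrN ger0_norm; lra.
near=> th; rewrite sub0r normrN.
have [th1 M0 LM _ _] : scale_bounds th by near: th; exact: near_scale.
have thM : scaleM th ^+ 11 <= th by near: th; exact: near_theta_scaleM.
have M2 : 2 <= scaleM th by near: th; exact: near_scaleM.
have Ldl : 8 * dl + 1 <= ln th by near: th; exact: near_ln.
have [l1 l2 l3] : level_bounds al z th by near: th; exact: near_level_bounds.
have th0 : 0 < th by lra.
have L0 : 0 < ln th by lra.
have Lth : 4 * ln th <= th.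
  rewrite LM; apply: le_trans thM; rewrite (exprD _ 7 4) ler_wpM2r ?exprn_ge0 ?(ltW M0)//.
  apply: (@le_trans _ _ (scaleM th ^+ 2)); last by apply: ler_weXn2l => //; lra.
  by rewrite -(_ : 2 * 2 = 4 :> R) ?expr2 ?ler_pM//; lra.
have th2 : 2 <= th by lra.
have cI : (cutoff th)%:R <= th.
  have hc := cutoff_le th0 M0; move: hc; rewrite ler_pdivrMr// => /le_trans; apply.
  rewrite ger_pMl// invf_le1 ?exprn_gt0// exprn_ege1//; lra.
have x1 : 1 <= level al z th by lra.
have x2 : level al z th <= 2 * th - 1 by lra.
have h1 : `|0 - th * expR (2 - level al z th -
    (1 - al) * level al z th * (cutoff th)%:R / (4 * th))| <= e / 4.
  by near: th; move/cvgrPdist_le: (@cvg_tail_term z); apply; rewrite divr_gt0.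
have h3 : `|0 - \sum_(i < cutoff th) fine (P th [set w | (level al z th / (th + 1) < Y th i w)%R]) *
   (((cutoff th)%:R / th ^+ 2 + (2 * ((cutoff th)%:R / th) ^+ 2 + th^-1) ^+ 2) /
    (dl / ln th) ^+ 2)| <= e / 4.
  by near: th; move/cvgrPdist_le: (@cvg_deviation_term z dl dl0); apply; rewrite divr_gt0.
rewrite !sub0r !normrN in h1 h3.
have {}h1 := le_trans (ler_norm _) h1; have {}h3 := le_trans (ler_norm _) h3.
have h4 : `|expR (- (z - 4 * dl)) - \sum_(i < cutoff th) comparison th (z - 4 * dl) i| <= e / 8.
  by near: th; move/cvgrPdist_le: (@cvg_sum_comparison (z - 4 * dl)); apply; rewrite divr_gt0.
have h5 : `|expR (- (z + 8 * dl)) - \sum_(i < cutoff th) comparison th (z + 8 * dl) i| <= e / 8.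
  by near: th; move/cvgrPdist_le: (@cvg_sum_comparison (z + 8 * dl)); apply; rewrite divr_gt0.
set k := dl / ln th in h3 *.
have k0 : 0 < k by rewrite divr_gt0.
have k8 : k <= 8^-1 by rewrite ler_pdivrMr//; lra.
have kL : k * ln th = dl by rewrite /k divfK// gt_eqF.
set x := level al z th in h1 h3 l1 l2 l3 x1 x2 *.
have k12 : 0 < k < 2^-1 by rewrite k0; lra.
have := discrepancy_le al01 th1 (indY th1) (betaY th1) (Y01 th1) x1 x2 cI k12.
have mD := measurable_discrepancy (betaY th1) (cutoff th) x.
set t1 := th * _ in h1 *; set t2 := \sum_(i < _) _; set t3 := \sum_(i < _) _ in h3 *.
rewrite -[X in (X <= _)%E]fineK ?fin_num_measure// lee_fin => h.
rewrite ger0_norm ?fine_ge0//; apply: (le_trans h).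
have h2 : t2 <= \sum_(i < cutoff th) comparison th (z - 4 * dl) i -
                \sum_(i < cutoff th) comparison th (z + 8 * dl) i.
  rewrite -sumrB; apply: ler_sum => i _; apply: lerB; apply: le_comparison_tail => //.
    have -> : level al (z - 4 * dl) th = x - 4 * dl by rewrite /x /level addrA.
    by have /andP[] := band_levels k0 k8 l1 l2; rewrite kL.
  have -> : level al (z + 8 * dl) th = x + 8 * dl by rewrite /x /level addrA.
  by have /andP[] := band_levels k0 k8 l1 l2; rewrite kL.
apply: le_trans (closing _ _ _ _ _ _ h1 h3 hdl h4 h5).
by rewrite lerD2r lerD2l.
Unshelve. all: end_near. Qed.

End asymptotics.

(** * Order statistics and hit cells of a grid *)

Section order_statistics.
Context {R : realType}.
Implicit Types (x : nat -> R) (Z t : R) (k : nat).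

(* The only property of the k-th largest point that is used; it is stable under
   increasing affine maps without any boundedness assumption. *)
Definition is_kth x Z k := forall t t' : R,
  (exists s : seq nat, [/\ uniq s, size s = k.+1 & forall i, i \in s -> t <= x i]) ->
  ~ (exists s : seq nat, [/\ uniq s, size s = k.+1 & forall i, i \in s -> t' < x i]) ->
  t <= Z <= t'.

(** The two hypotheses make the set under the supremum nonempty and bounded above, which is when
    [sup] is meaningful. *)
Lemma is_kth_largest x k : is_kth x (kth_largest x k) k.
Proof.
rewrite /is_kth /kth_largest => t t' ht ht'; set E := [set t | _].
have ubE : ubound E t'.
  move=> u [s [us ss hs]]; rewrite leNgt; apply/negP => tu; apply: ht'.
  by exists s; split=> // i /hs; exact: lt_le_trans.
apply/andP; split; first by apply: sup_ubound => //; exists t'.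
by apply: ge_sup => //; exists t.
Qed.

Lemma is_kth_affine x Z k (c b : R) : 0 < c -> is_kth x Z k ->
  is_kth (fun i => c * x i - b) (c * Z - b) k.
Proof.
move=> c0 h t t' [s [us ss hs]] ht'.
have /andP[h1 h2] : (t + b) / c <= Z <= (t' + b) / c.
  apply: h.
    by exists s; split => // i /hs; rewrite ler_pdivrMr// mulrC lerBrDr.
  move=> [r [ur sr hr]]; apply: ht'; exists r; split => // i /hr.
  by rewrite ltr_pdivrMr// mulrC ltrBrDr.
by move: h1 h2; rewrite ler_pdivrMr// ler_pdivlMr// mulrC lerBrDr lerBlDr => -> ->.
Qed.

End order_statistics.

Section grid.
Context {R : realType}.
Variables (a : nat -> R) (m : nat).
Hypothesis a_mono : forall i j, (i <= j)%N -> a i <= a j.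

(** Half-open intervals, except that the last cell [j = m] is a ray: it signals points above the
    window. *)
Definition cell (j : nat) : set R :=
  [set y | (a j < y) && ((j < m)%N ==> (y <= a j.+1))].

Lemma measurable_cell j : measurable (cell j).
Proof.
rewrite (_ : cell j = if (j < m)%N then `]a j, a j.+1] else `]a j, +oo[)%classic.
  by case: ifP => _; exact: measurable_itv.
by apply/seteqP; split => y; rewrite /cell/=; case: ifP => _; rewrite /= in_itv/= ?andbT.
Qed.

Lemma cell_inj (i j : 'I_m.+1) y : cell i y -> cell j y -> i = j.
Proof.
wlog ij : i j / (i < j)%N => [hw ci cj|/andP[_ h] /andP[ajy _]].
  by have [ij|ji|/val_inj//] := ltngtP i j; [exact: hw|apply/esym/hw].
have im : (i < m)%N by rewrite (leq_trans ij)// -ltnS.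
move: h; rewrite im/= => h.
by have := lt_le_trans ajy (le_trans h (a_mono ij)); rewrite ltxx.
Qed.

Lemma cell_cover (q : nat) y : (q <= m)%N -> a q < y ->
  exists2 j : 'I_m.+1, (q <= j)%N & cell j y.
Proof.
move=> qm aqy; pose q' : 'I_m.+1 := Ordinal (qm : (q < m.+1)%N).
case: (@arg_maxnP _ q' (fun j : 'I_m.+1 => a j < y) (@nat_of_ord _) aqy) => j ajy jmax.
exists j; first exact: (jmax q').
rewrite /cell/= ajy/=; apply/implyP => jm; rewrite leNgt; apply/negP => aj1.
by have := jmax (Ordinal (jm : (j.+1 < m.+1)%N)) aj1; rewrite /= ltnn.
Qed.

Definition hits (x : nat -> R) : {set 'I_m.+1} := [set j : 'I_m.+1 | `[< exists i, cell j (x i) >]]%SET.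

Definition doubled (x : nat -> R) (j : nat) : Prop :=
  exists i i', [/\ i <> i', cell j (x i) & cell j (x i')].

(** In the absence of doubled cells, sending a point to its cell is injective. *)
Lemma size_above_le x (q : nat) (s : seq nat) : (q <= m)%N ->
  (forall j : 'I_m.+1, ~ doubled x j) -> uniq s -> (forall i, i \in s -> a q < x i) ->
  (size s <= #|[set j in hits x | (q <= j)%N]%SET|)%N.
Proof.
move=> qm nd us hs.
have /choice[g hg] i : exists j : 'I_m.+1, i \in s -> (q <= j)%N /\ cell j (x i).
  have [/hs/(cell_cover qm)[j qj cj]|] := boolP (i \in s); last by exists ord0.
  by exists j.
have ug : uniq (map g s).
  rewrite map_inj_in_uniq// => i i' si si' gii'; apply: contrapT => ii'.
  apply: (nd (g i)); exists i, i'; split => //; first exact: (hg i si).2.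
  by rewrite gii'; exact: (hg i' si').2.
rewrite -(size_map g) -(card_uniqP ug); apply/subset_leq_card/fintype.subsetP => j /mapP[i si ->].
by rewrite !inE (hg i si).1 andbT; apply/asboolP; exists i; exact: (hg i si).2.
Qed.

(** Conversely, one point chosen in each hit cell gives distinct indices, the cells being
    disjoint. *)
Lemma size_above_ge x (q k : nat) : (k < #|[set j in hits x | (q <= j)%N]%SET|)%N ->
  exists s : seq nat, [/\ uniq s, size s = k.+1 & forall i, i \in s -> a q < x i].
Proof.
set A := [set j in _ | _]%SET => kA.
have /choice[g hg] (j : 'I_m.+1) : exists i, j \in A -> cell j (x i).
  have [|] := boolP (j \in A); last by exists 0%N.
  by rewrite !inE => /andP[/asboolP[i ci] _]; exists i.
have ug : uniq (map g (enum A)).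
  rewrite map_inj_in_uniq ?enum_uniq// => j j'; rewrite !mem_enum => jA jA' e.
  by apply: (cell_inj (hg j jA)); rewrite e; exact: hg.
exists (take k.+1 (map g (enum A))); split.
- exact: take_uniq.
- by rewrite size_takel// size_map -cardE.
- move=> i /mem_take /mapP[j]; rewrite mem_enum => jA ->.
  have /andP[aj _] := hg j jA; apply: le_lt_trans aj; apply: a_mono.
  by move: jA; rewrite !inE => /andP[].
Qed.

(** [q.+1] is the least grid index with at most [k] hit cells from there on. The ray being missed
    bounds that index by [m], and [k < #|S|] makes it positive. *)
Lemma kth_position (S : {set 'I_m.+1}) (k : nat) : ord_max \notin S -> (k < #|S|)%N ->
  exists2 q, (q < m)%N & (#|[set j in S | (q.+1 <= j)%N]%SET| <= k < #|[set j in S | (q <= j)%N]%SET|)%N.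
Proof.
move=> tS kS.
pose Q q := (#|[set j in S | (q <= j)%N]%SET| <= k)%N.
have Qm : Q m.
  rewrite /Q.
  rewrite (_ : [set j in S | _]%SET = finset.set0).
    by rewrite cards0.
  apply/setP => j; rewrite !inE; apply/negbTE/negP => /andP[jS mj].
  have jm : j = ord_max by apply/val_inj/eqP; rewrite /= eqn_leq mj -ltnS ltn_ord.
  by move: tS; rewrite -jm jS.
have exQ : exists q, Q q by exists m.
case: (ex_minnP exQ) => -[|q] Qq qmin.
  exfalso; move: Qq; rewrite /Q; apply/negP; rewrite -ltnNge.
  rewrite (_ : [set j in S | _]%SET = S) //.
  by apply/setP => j; rewrite !inE leq0n andbT.
exists q; first exact: qmin.
apply/andP; split; first exact: Qq.
by rewrite ltnNge; apply/negP => /qmin; rewrite ltnn.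
Qed.

Lemma kth_in_cell x Z k (q : nat) : is_kth x Z k -> (q < m)%N ->
  (forall j : 'I_m.+1, ~ doubled x j) ->
  (#|[set j in hits x | (q.+1 <= j)%N]%SET| <= k < #|[set j in hits x | (q <= j)%N]%SET|)%N ->
  a q <= Z <= a q.+1.
Proof.
move=> hZ qm nd /andP[h1 h2]; apply: hZ.
  have [s [us ss hs]] := size_above_ge h2.
  by exists s; split=> // i /hs/ltW.
move=> [s [us ss hs]]; have := size_above_le qm nd us hs.
by rewrite ss => /leq_trans/(_ h1); rewrite ltnn.
Qed.

(** Links patterns to counts in the window, whose law is Poisson for the limit process; this bounds
    the probability of few hit cells. *)
Lemma count_eq_hits x : (forall j : 'I_m.+1, ~ doubled x j) -> ord_max \notin hits x ->
  count_eq x [set y | (a 0 < y) && (y <= a m)] #|hits x|.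
Proof.
move=> nd tx.
have /choice[g hg] (j : 'I_m.+1) : exists i, j \in hits x -> cell j (x i).
  have [jh|_] := boolP (j \in hits x); last by exists 0%N.
  by move: jh; rewrite inE => /asboolP[i ci]; exists i.
have ug : uniq (map g (enum (hits x))).
  rewrite map_inj_in_uniq ?enum_uniq// => j j'; rewrite !mem_enum => jA jA' e.
  by apply: (cell_inj (hg j jA)); rewrite e; exact: hg.
exists (map g (enum (hits x))); split => //; first by rewrite size_map -cardE.
move=> i; split.
  move=> /mapP[j]; rewrite mem_enum => jh ->.
  have := hg j jh; rewrite /cell/= => /andP[aj].
  have [jm/= h|mj _] := ltnP j m.
    by rewrite (le_lt_trans (a_mono (leq0n j)))//= (le_trans h)// a_mono.
  have jmax : j = ord_max by apply/val_inj/eqP; rewrite /= eqn_leq mj -ltnS ltn_ord.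
  by move: tx; rewrite -jmax jh.
move=> /= /andP[a0x xam]; have [j _ cj] := cell_cover (leq0n m) a0x.
have jh : j \in hits x by rewrite inE; apply/asboolP; exists i.
apply/mapP; exists j; first by rewrite mem_enum.
apply: contrapT => ig; apply: (nd j); exists i, (g j); split => //; exact: hg.
Qed.

End grid.

(** * Integrals enclosed between step functions *)

Section sandwich.
Context {R : realType} {d : measure_display} {T : measurableType d}.
Variable P : probability T R.

(* No measurability is required: the integral of a nonnegative function is a
   supremum over the simple functions below it. *)
Lemma ge0_le_integral_any (f g : T -> \bar R) : (forall w, 0 <= f w <= g w)%E ->
  (\int[P]_w f w <= \int[P]_w g w)%E.
Proof.
move=> fg; have f0 w : (0 <= f w)%E by have /andP[] := fg w.
have g0 w : (0 <= g w)%E by have /andP[h1 h2] := fg w; exact: le_trans h1 h2.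
rewrite !ge0_integralTE//; apply: le_ereal_sup => _ [h hf <-]; exists h => // w.
by have /andP[_] := fg w; exact: le_trans.
Qed.

Lemma le_integral_any (f g : T -> \bar R) : (forall w, f w <= g w)%E ->
  (\int[P]_w f w <= \int[P]_w g w)%E.
Proof.
move=> fg; rewrite integralE [leRHS]integralE; apply: leeB; apply: ge0_le_integral_any => w.
  by rewrite funepos_ge0/= !funeposE ge_max !le_max fg/= lexx orbT.
by rewrite funeneg_ge0/= !funenegE ge_max !le_max leeN2 fg/= lexx orbT.
Qed.

Lemma integral_step (J : Type) (s : seq J) (c : J -> R) (A : J -> set T) :
  (forall j, measurable (A j)) ->
  P.-integrable setT (fun w => (\sum_(j <- s) c j * \1_(A j) w)%:E) /\
  (\int[P]_w (\sum_(j <- s) c j * \1_(A j) w)%:E =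
    (\sum_(j <- s) c j * fine (P (A j)))%:E)%E.
Proof.
move=> mA; elim: s => [|j r [ir vr]].
  have -> : (fun w : T => (\sum_(j <- [::]) c j * \1_(A j) w)%:E) = cst 0%E.
    by apply/funext => w /=; rewrite big_nil.
  by split; [exact: integrable0|rewrite integral0 big_nil].
have ij : P.-integrable setT (fun w => (c j)%:E * (\1_(A j) w)%:E)%E.
  by apply: integrableZl => //; exact: integrable_indic.
have -> : (fun w : T => (\sum_(i <- j :: r) c i * \1_(A i) w)%:E) =
    (fun w => (c j)%:E * (\1_(A j) w)%:E + (\sum_(i <- r) c i * \1_(A i) w)%:E)%E.
  by apply/funext => w /=; rewrite big_cons EFinD EFinM.
split; first exact: integrableD.
rewrite integralD//= integralZl//; last exact: integrable_indic.
rewrite integral_indic// setIT vr big_cons EFinD EFinM -fine_probE//.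
Qed.

(** An infinite integral of [F], which the real-valued integral would read as 0, is excluded by the
    two bounds. *)
Lemma Rintegral_sandwich (J K : Type) (s : seq J) (r : seq K) (c : J -> R) (e : K -> R)
    (A : J -> set T) (B : K -> set T) (F : T -> R) :
  (forall j, measurable (A j)) -> (forall j, measurable (B j)) ->
  (forall w, \sum_(j <- s) c j * \1_(A j) w <= F w <= \sum_(j <- r) e j * \1_(B j) w) ->
  \sum_(j <- s) c j * fine (P (A j)) <= Rintegral P setT F <= \sum_(j <- r) e j * fine (P (B j)).
Proof.
move=> mA mB h; have [_ vA] := integral_step s c mA; have [_ vB] := integral_step r e mB.
have h1 : ((\sum_(j <- s) c j * fine (P (A j)))%:E <= \int[P]_w (F w)%:E)%E.
  by rewrite -vA; apply: le_integral_any => w; rewrite lee_fin; have /andP[] := h w.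
have h2 : (\int[P]_w (F w)%:E <= (\sum_(j <- r) e j * fine (P (B j)))%:E)%E.
  by rewrite -vB; apply: le_integral_any => w; rewrite lee_fin; have /andP[] := h w.
rewrite /Rintegral; move: h1 h2; case: (\int[P]_w _)%E => //= v.
by rewrite !lee_fin => -> ->.
Qed.

Lemma measurable_exists2 (J : finType) (Q : pred J) (A : J -> set T) :
  (forall j, measurable (A j)) -> measurable [set w | exists2 j, Q j & A j w].
Proof.
move=> mA; rewrite (_ : [set w | _] = \bigcup_(j in [set j | Q j]) A j).
  by apply: fin_bigcup_measurable => // S _; exact: mA.
by apply/seteqP; split => w [j Qj Aj]; exists j.
Qed.

Lemma fine_prob_disjoint_sum (J : finType) (Q : pred J) (A : J -> set T) :
  (forall j, measurable (A j)) -> (forall i j w, A i w -> A j w -> i = j) ->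
  fine (P [set w | exists2 j, Q j & A j w]) = \sum_(j | Q j) fine (P (A j)).
Proof.
move=> mA dA; set B := [set w | _].
have mB : measurable B by exact: measurable_exists2.
have [_ v] := integral_step [seq S <- index_enum J | Q S] (fun=> 1) mA.
apply: EFin_inj; rewrite -big_filter (eq_bigr (fun S => 1 * fine (P (A S)))); last first.
  by move=> S _; rewrite mul1r.
rewrite -v -fine_probE// -[in LHS](setIT B) -integral_indic//.
apply: eq_integral => w _; congr (_%:E); rewrite big_filter.
have [[j Qj Aj]|nB] := pselect (B w).
  rewrite (bigD1 j)//= big1 => [|S /andP[_ Sh]].
    by rewrite addr0 mul1r !indicE !mem_set//; exists j.
  rewrite mul1r indicE memNset// => AS; move/negP: Sh; apply; apply/eqP.
  exact: dA AS Aj.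
rewrite indicE memNset// big1// => S QS; rewrite mul1r indicE memNset// => AS.
by apply: nB; exists S.
Qed.

Lemma fine_prob_close (A B D : set T) : measurable A -> measurable B -> measurable D ->
  (forall w, ~ D w -> (A w <-> B w)) -> `|fine (P A) - fine (P B)| <= fine (P D).
Proof.
move=> mA mB mD h; rewrite ler_norml lerBrDl lerBlDl; apply/andP; split.
  rewrite addrC; apply: le_trans (fine_probU P mA mD).
  apply: le_fine_prob => //; first exact: measurableU.
  by move=> w Bw; have [Dw|/h[_ /(_ Bw)]] := pselect (D w); [right|left].
rewrite lerBlDr [leRHS]addrC; apply: le_trans (fine_probU P mB mD).
apply: le_fine_prob => //; first exact: measurableU.
by move=> w Aw; have [Dw|/h[/(_ Aw)]] := pselect (D w); [right|left].
Qed.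

End sandwich.

(** * Random patterns and their void probabilities *)

Section random_pattern.
Context {R : realType} {d : measure_display} {T : measurableType d}.
Variables (I : finType) (h : T -> {set I}).
Hypothesis mh : forall j, measurable [set w | j \in h w].

Lemma measurable_pattern (S : {set I}) : measurable [set w | h w = S].
Proof.
have -> : [set w | h w = S] = \bigcap_(j in [set: I]) [set w | (j \in h w) = (j \in S)].
  apply/seteqP; split => w /=; first by move=> <-.
  by move=> hw; apply/setP => j; exact: hw.
apply: fin_bigcap_measurable => // j _; case: (j \in S); first exact: mh.
rewrite (_ : [set w | _] = ~` [set w | j \in h w]); first exact: measurableC.
by apply/seteqP; split => w /=; [move=> ->|move/negP/negbTE].
Qed.

Lemma measurable_pattern_event (Q : pred {set I}) : measurable [set w | Q (h w)].
Proof.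
have -> : [set w | Q (h w)] = \bigcup_(S in [set S | Q S]) [set w | h w = S].
  by apply/seteqP; split => w /=; [exists (h w)|move=> [S /= QS ->]].
by apply: fin_bigcup_measurable => // S _; exact: measurable_pattern.
Qed.

Variable P : probability T R.

Lemma prob_pattern_event (Q : pred {set I}) :
  fine (P [set w | Q (h w)]) = \sum_(S : {set I} | Q S) fine (P [set w | h w = S]).
Proof.
have [_ v] := integral_step P [seq S <- index_enum {set I} | Q S] (fun=> 1) measurable_pattern.
have mQ := measurable_pattern_event Q.
apply: EFin_inj; rewrite -big_filter (eq_bigr (fun S => 1 * fine (P [set w | h w = S]))).
  rewrite -v -fine_probE// -[in LHS](setIT [set w | Q (h w)]) -integral_indic//.
  apply: eq_integral => w _; congr (_%:E); rewrite big_filter.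
  have [Qw|Qw] := boolP (Q (h w)).
    rewrite (bigD1 (h w))//= big1 => [|S /andP[_ Sh]].
      by rewrite addr0 mul1r !indicE !mem_set.
    by rewrite mul1r indicE memNset// => /esym/eqP; exact/negP.
  rewrite indicE memNset; last exact/negP.
  rewrite big1// => S QS; rewrite mul1r indicE memNset// => /= hS.
  by move: Qw; rewrite hS QS.
by move=> S _; rewrite mul1r.
Qed.

End random_pattern.

Section pattern_convergence.
Context {R : realType} {I : finType}.
Variables (d : R -> measure_display) (T : forall th, measurableType (d th)).
Variables (P : forall th, probability (T th) R) (h : forall th, T th -> {set I}).
Arguments h : clear implicits.
Variables (d' : measure_display) (T' : measurableType d') (P' : probability T' R).
Variable h' : T' -> {set I}.
Hypothesis mh : forall th j, measurable [set w | j \in h th w].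
Hypothesis mh' : forall j, measurable [set w | j \in h' w].
Hypothesis cvg_void : forall U : {set I},
  fine (P th [set w | (U \subset ~: h th w)]) @[th --> +oo] -->
  fine (P' [set w | (U \subset ~: h' w)]).

Let avoid_hit (U : {set I}) (W : seq I) (S : {set I}) : bool :=
  (U \subset ~: S) && all (fun j => j \in S) W.

(** One step of inclusion-exclusion: hitting [j] is the complement of avoiding it. *)
Let avoid_hit_cons d0 (T0 : measurableType d0) (P0 : probability T0 R) (h0 : T0 -> {set I}) U j W :
  (forall j, measurable [set w | j \in h0 w]) ->
  fine (P0 [set w | avoid_hit U (j :: W) (h0 w)]) =
  fine (P0 [set w | avoid_hit U W (h0 w)]) - fine (P0 [set w | avoid_hit (j |: U) W (h0 w)]).
Proof.
move=> m0; apply/eqP; rewrite eq_sym subr_eq; apply/eqP.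
rewrite (@fine_prob_split _ _ _ P0 _ [set w | j \in h0 w]); [|exact: measurable_pattern_event|exact: m0].
congr (fine (P0 _) + fine (P0 _)).
  apply/seteqP; split => w /=; rewrite /avoid_hit/=; first by move=> [/andP[-> ->] ->].
  by move=> /andP[-> /andP[-> ->]].
apply/seteqP; split => w /=; rewrite /avoid_hit/=.
  by move=> [/andP[hU ->] /negP jh]; rewrite andbT finset.subUset finset.sub1set inE jh.
rewrite finset.subUset finset.sub1set inE => /andP[/andP[jh ->] ->].
by split => //; exact/negP.
Qed.

(* Inclusion-exclusion over the cells that have to be hit. *)
Lemma cvg_pattern (S : {set I}) :
  fine (P th [set w | h th w = S]) @[th --> +oo] --> fine (P' [set w | h' w = S]).
Proof.
have key W : forall U, fine (P th [set w | avoid_hit U W (h th w)]) @[th --> +oo] -->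
    fine (P' [set w | avoid_hit U W (h' w)]).
  elim: W => [|j W ih] U.
    have e d0 (T0 : measurableType d0) (P0 : probability T0 R) (h0 : T0 -> {set I}) :
        fine (P0 [set w | avoid_hit U [::] (h0 w)]) = fine (P0 [set w | (U \subset ~: h0 w)]).
      by congr (fine (P0 _)); apply/seteqP; split => w /=; rewrite /avoid_hit/= andbT.
    rewrite e; under eq_fun do rewrite e; exact: cvg_void.
  rewrite avoid_hit_cons//; under eq_fun do rewrite avoid_hit_cons//.
  exact: cvgB.
have e d0 (T0 : measurableType d0) (P0 : probability T0 R) (h0 : T0 -> {set I}) :
    fine (P0 [set w | h0 w = S]) = fine (P0 [set w | avoid_hit (~: S) (enum S) (h0 w)]).
  congr (fine (P0 _)); apply/seteqP; split => w /=; rewrite /avoid_hit.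
    move=> ->; rewrite subxx/=.
    by apply/allP => j; rewrite mem_enum.
  rewrite finset.setCS => /andP[h1 /allP h2]; apply/eqP; rewrite finset.eqEsubset h1/=.
  by apply/fintype.subsetP => j jS; apply: h2; rewrite mem_enum.
rewrite e; under eq_fun do rewrite e; exact: key.
Qed.

End pattern_convergence.

(** * Discretization of the expectation by hit patterns *)

Section discretization.
Context {R : realType} {d : measure_display} {T : measurableType d}.
Variables (P : probability T R) (x : T -> nat -> R) (Z : T -> nat -> R).
Hypothesis mx : forall i, measurable_fun setT (fun w => x w i).
Hypothesis xZ : forall w k, is_kth (x w) (Z w k) k.
Variables (a : nat -> R) (m : nat).
Hypothesis a_mono : forall i j, (i <= j)%N -> a i <= a j.

Let mcell i j : measurable [set w | cell a m j (x w i)].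
Proof. exact: measurable_preimage (mx i) (measurable_cell a m j). Qed.

Lemma measurable_hit (j : 'I_m.+1) : measurable [set w | j \in hits a m (x w)].
Proof.
rewrite (_ : [set w | _] = \bigcup_i [set w | cell a m j (x w i)]).
  exact: bigcupT_measurable.
apply/seteqP; split => w /=; rewrite inE; first by move=> /asboolP[i ci]; exists i.
by move=> [i _ ci]; apply/asboolP; exists i.
Qed.

Lemma measurable_doubled j : measurable [set w | doubled a m (x w) j].
Proof.
rewrite (_ : [set w | _] = \bigcup_i \bigcup_(i' in [set i' | i <> i'])
    ([set w | cell a m j (x w i)] `&` [set w | cell a m j (x w i')])).
  by apply: bigcupT_measurable => i; apply: bigcup_measurable => i' _; exact: measurableI.
apply/seteqP; split => w /=; first by move=> [i [i' [ii' h1 h2]]]; exists i => //; exists i'.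
by move=> [i _ [i' /= ii' [h1 h2]]]; exists i, i'.
Qed.

(** Patterns that fail to place the [n] largest points inside the window: a point above it, or too
    few hit cells. *)
Definition irregular (n : nat) (S : {set 'I_m.+1}) := (ord_max \in S) || (#|S| < n)%N.

(** Only bounded cells are tested for doubling: a doubled ray is hit, hence already irregular. *)
Definition bad_event n : set T :=
  [set w | irregular n (hits a m (x w))] `|` \big[setU/set0]_(j < m) [set w | doubled a m (x w) j].

Lemma measurable_bad_event n : measurable (bad_event n).
Proof.
apply: measurableU; first exact: (measurable_pattern_event measurable_hit).
by apply: bigsetU_measurable => j _; exact: measurable_doubled.
Qed.

Lemma bad_event_le n : fine (P (bad_event n)) <=
  \sum_(S : {set 'I_m.+1} | irregular n S) fine (P [set w | hits a m (x w) = S]) +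
  \sum_(j < m) fine (P [set w | doubled a m (x w) j]).
Proof.
apply: le_trans (fine_probU _ _ _) _.
- exact: (measurable_pattern_event measurable_hit).
- by apply: bigsetU_measurable => j _; exact: measurable_doubled.
rewrite (prob_pattern_event measurable_hit) lerD2l.
by apply: fine_prob_bigU => j; exact: measurable_doubled.
Qed.

Variables (n : nat) (f : 'rV[R]_n -> R) (C e : R) (c : {set 'I_m.+1} -> R).
Hypothesis fC : forall z, `|f z| <= C.
Hypothesis cC : forall S, `|c S| <= C.
Hypothesis e0 : 0 <= e.
Hypothesis fc : forall (S : {set 'I_m.+1}) (z : 'rV[R]_n), ~~ irregular n S ->
  (forall (k : 'I_n) (q : nat), (q < m)%N ->
    (#|[set j in S | (q.+1 <= j)%N]%SET| <= k < #|[set j in S | (q <= j)%N]%SET|)%N ->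
    a q <= z ord0 k <= a q.+1) -> `|f z - c S| <= e.

(** Off the bad event the pattern confines each of the [n] largest points to a cell, so [f] is
    within [e] of the value attached to the pattern; on the bad event the difference is at most
    2C. *)
Lemma discretization_error :
  `|Rintegral P setT (fun w => f (\row_(k < n) Z w k)) -
    \sum_(S : {set 'I_m.+1}) c S * fine (P [set w | hits a m (x w) = S])| <=
  e + 2 * C * fine (P (bad_event n)).
Proof.
(* One index type for three kinds of step: the whole space with height e, the bad event with height
   2C, and the patterns. The sign [b] in [g] selects the upper or the lower step function. *)
pose J := option (option {set 'I_m.+1}).
pose s : seq J := None :: Some None :: map (Some \o Some) (index_enum {set 'I_m.+1}).
pose A (j : J) := match j with None => [set: T] | Some None => bad_event n
  | Some (Some V) => [set w | hits a m (x w) = V] end.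
have mA j : measurable (A j).
  case: j => [[V|]|]//=; first exact: (measurable_pattern measurable_hit).
  exact: measurable_bad_event.
pose g (b : R) (j : J) := match j with None => b * e | Some None => b * (2 * C)
  | Some (Some V) => c V end.
have sumE b (F : J -> R) : \sum_(j <- s) g b j * F j =
    b * (e * F None + 2 * C * F (Some None)) + \sum_(S : {set 'I_m.+1}) c S * F (Some (Some S)).
  by rewrite /s !big_cons big_map/= mulrDr !mulrA addrA.
have hw w : `|f (\row_(k < n) Z w k) - \sum_(S : {set 'I_m.+1}) c S * \1_(A (Some (Some S))) w| <=
    e * \1_(A None) w + 2 * C * \1_(A (Some None)) w.
  have -> : \sum_(S : {set 'I_m.+1}) c S * \1_(A (Some (Some S))) w = c (hits a m (x w)).
    rewrite (bigD1 (hits a m (x w)))//= big1 => [|S /negP Sh].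
      by rewrite addr0 indicE mem_set// mulr1.
    by rewrite indicE memNset ?mulr0// => /= hS; apply: Sh; rewrite hS.
  rewrite /= indicT mulr1.
  have C0 : 0 <= C by exact: le_trans (fC 0).
  have [bw|gw] := pselect (bad_event n w).
    rewrite indicE mem_set// mulr1; apply: (le_trans (ler_normB _ _)).
    apply: (@le_trans _ _ (C + C)); first exact: lerD.
    by rewrite mulr_natl mulr2n lerDr.
  rewrite indicE memNset// mulr0 addr0.
  have irr : ~~ irregular n (hits a m (x w)) by apply/negP => h; apply: gw; left.
  have nd (j : 'I_m.+1) : ~ doubled a m (x w) j.
    have [jm dj|mj [i [i' [_ ci _]]]] := ltnP j m.
      by apply: gw; right; rewrite -(bigcup_mkord m (fun j => [set w | doubled a m (x w) j])); exists j.
    move/negP: irr; apply; apply/orP; left; rewrite inE; apply/asboolP; exists i.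
    rewrite (_ : nat_of_ord ord_max = j)//.
    by apply/eqP; rewrite /= eqn_leq mj -ltnS ltn_ord.
  apply: fc => // k q qm hq; rewrite mxE.
  exact: (kth_in_cell a_mono (@xZ w k) qm nd hq).
have mm w : \sum_(j <- s) g (-1) j * \1_(A j) w <= f (\row_(k < n) Z w k) <=
    \sum_(j <- s) g 1 j * \1_(A j) w.
  by rewrite !sumE; have := hw w; rewrite ler_norml; lra.
have := Rintegral_sandwich P mA mA mm; rewrite !sumE /= probability_setT /= !mulr1.
by rewrite ler_norml; lra.
Qed.

End discretization.

(** * Void probabilities of the rescaled weights *)

Section rare_events.
Context {R : realType}.
Variables (I : R -> nat) (p : R -> nat -> R) (mu : R).
Hypothesis p0 : forall th i, 0 <= p th i.
Hypothesis p_small : forall e, 0 < e -> \forall th \near +oo, forall i, (i < I th)%N -> p th i <= e.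
Hypothesis cvg_sum : \sum_(i < I th) p th i @[th --> +oo] --> mu.

Let cvg_sum_sqr : \sum_(i < I th) p th i ^+ 2 @[th --> +oo] --> (0 : R).
Proof.
apply/cvgrPdist_le => e e0; near=> th; rewrite sub0r normrN.
have mu1 : 0 < `|mu| + 1 by rewrite ltr_wpDl.
have hS : `|mu - \sum_(i < I th) p th i| <= 1.
  by near: th; move/cvgrPdist_le: cvg_sum; apply.
have hp : forall i, (i < I th)%N -> p th i <= e / (`|mu| + 1).
  by near: th; apply: p_small; rewrite divr_gt0.
rewrite ger0_norm; last by apply: sumr_ge0 => i _; rewrite sqr_ge0.
apply: (@le_trans _ _ (\sum_(i < I th) e / (`|mu| + 1) * p th i)).
  by apply: ler_sum => i _; rewrite expr2 ler_wpM2r// hp.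
rewrite -big_distrr/= mulrAC ler_pdivrMr// ler_wpM2l ?(ltW e0)//.
have := ler_norm mu; move: hS; rewrite ler_norml; lra.
Unshelve. all: end_near. Qed.

(** Each 1 - p lies between e^(-p - 2p^2) and e^(-p); the sum of squares vanishes, being at most the
    largest p times a bounded sum. *)
Lemma cvg_prod_onem : \prod_(i < I th) (1 - p th i) @[th --> +oo] --> expR (- mu).
Proof.
apply: (@squeeze_cvgr _ _ _ _
  (fun th => expR (- (\sum_(i < I th) p th i + 2 * \sum_(i < I th) p th i ^+ 2)))
  (fun th => expR (- \sum_(i < I th) p th i))).
- near=> th.
  have hp : forall i, (i < I th)%N -> p th i <= 2^-1.
    by near: th; apply: p_small; rewrite invr_gt0.
  rewrite big_distrr/= -big_split/= -!sumrN !expR_sum; apply/andP; split.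
    apply: ler_prod => i _; rewrite expR_ge0/=; apply: expR_le_onem.
    by rewrite p0 hp.
  apply: ler_prod => i _; rewrite expR_ge1Dx andbT subr_ge0.
  by have := hp i (ltn_ord i); lra.
- apply: (continuous_cvg _ (@continuous_expR R _)); apply: cvgN.
  rewrite -[X in _ --> X]addr0 -[X in _ --> _ + X](mulr0 2); apply: cvgD => //.
  by apply: cvgM => //; exact: cvg_cst.
- by apply: (continuous_cvg _ (@continuous_expR R _)); exact: cvgN.
Unshelve. all: end_near. Qed.

End rare_events.

(** * Cells hit by the rescaled weights *)

Section cells.
Context {R : realType}.
Variables (al : R) (d : R -> measure_display) (T : forall th, measurableType (d th)).
Variables (P : forall th, probability (T th) R) (Y : forall th, nat -> T th -> R).
Arguments Y : clear implicits.
Hypothesis al01 : 0 <= al < 1.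
Hypothesis mY : forall th i, measurable_fun setT (Y th i).
Hypothesis indY : forall th, 1 < th -> mutually_independent (P th) (Y th).
Hypothesis betaY : forall th, 1 < th -> forall i,
  is_beta_rv (P th) (Y th i) (1 - al) (th + i.+1%:R * al).
Hypothesis Y01 : forall th, 1 < th -> forall i w, 0 < Y th i w < 1.

Definition weights th (w : T th) (i : nat) : R :=
  th * stick_breaking (Y th ^~ w) i - beta_const al th.

Lemma measurable_weights th i : measurable_fun setT (fun w => @weights th w i).
Proof.
apply: measurable_funB; last exact: measurable_cst.
apply: measurable_funM; first exact: measurable_cst.
apply: measurable_funM => //.
elim: i => [|i ih]; first by under eq_fun do rewrite big_ord0; exact: measurable_cst.
under eq_fun do rewrite big_ord_recr/=; apply: measurable_funM => //.
by apply: measurable_funB => //; exact: measurable_cst.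
Qed.

Let X th (i : nat) (y : R) : R := th * residual_limit al th i * y - beta_const al th.

Let mX th i : measurable_fun setT (X th i).
Proof.
by apply: measurable_funB; [apply: measurable_funM|exact: measurable_cst].
Qed.

Variables (a : nat -> R) (m : nat).
Hypothesis a_mono : forall i j, (i <= j)%N -> a i <= a j.

Let D th : set (T th) := \big[setU/set0]_(j < m.+1) discrepancy al th (Y th) (cutoff th) (level al (a j) th).

Let mdisc th z : 1 < th -> measurable (discrepancy al th (Y th) (cutoff th) (level al z th)).
Proof. by move=> th1; exact: (measurable_discrepancy (betaY th1)). Qed.

Let mD th : 1 < th -> measurable (@D th).
Proof. by move=> th1; apply: bigsetU_measurable => j _; exact: mdisc. Qed.

Let cvgD0 : \sum_(j < m.+1) fine (P th (discrepancy al th (Y th) (cutoff th) (level al (a j) th)))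
  @[th --> +oo] --> (0 : R).
Proof.
rewrite -[X in _ --> X](_ : \sum_(j < m.+1) (0 : R) = 0); last by rewrite big1_eq.
by apply: cvg_big => [|j _]; [exact: add_continuous|exact: cvg_discrepancy].
Qed.

(** Membership in a cell is decided by exceedances at its end points, on which weights and
    comparison variables agree off [D]; weights from the cutoff on hit no cell. *)
Let cell_weights th w i (j : nat) : ~ @D th w -> (j <= m)%N ->
  cell a m j (@weights th w i) <-> (i < cutoff th)%N /\ cell a m j (X th i (Y th i w)).
Proof.
move=> nD jm.
have h l : (l <= m)%N -> (a l < @weights th w i) = (i < cutoff th)%N && (a l < X th i (Y th i w)).
  move=> lm; rewrite /weights /X !ltrBrDl -/(level al (a l) th).
  apply/eqP/negPn/negP => hn; apply: nD.
  rewrite /D -(bigcup_mkord m.+1 (fun j => discrepancy al th (Y th) (cutoff th) (level al (a j) th))).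
  by exists l => //; exists i.
rewrite /cell/= h//; split.
  move=> /andP[/andP[iI ->] hj]; split => //=; move: hj.
  by case: (ltnP j m) => //= jm'; rewrite leNgt h// iI/= -leNgt.
move=> [iI /andP[aj hj]]; rewrite iI aj/=; move: hj.
by case: (ltnP j m) => //= jm'; rewrite (leNgt (@weights th w i)) h// iI/= -leNgt.
Qed.

Let q th (j i : nat) : R := fine (P th [set w | cell a m j (X th i (Y th i w))]).

Let mcellX th i j : measurable [set w | cell a m j (X th i (Y th i w))].
Proof.
apply: (measurable_preimage (X := X th i \o Y th i)); last exact: measurable_cell.
exact: measurableT_comp.
Qed.

Let mexc th i (x : R) : measurable [set w | x < X th i (Y th i w)].
Proof. by apply: measurable_superlevel; exact: measurableT_comp. Qed.

Let comparisonE th z i : comparison al P Y th z i = fine (P th [set w | z < X th i (Y th i w)]).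
Proof.
rewrite /comparison /comparison_tail; congr (fine (P th _)).
by apply/seteqP; split => w /=; rewrite /X /level ltrBrDl.
Qed.

Let qE th j i : q th j i = comparison al P Y th (a j) i -
  (if (j < m)%N then comparison al P Y th (a j.+1) i else 0).
Proof.
rewrite comparisonE /q; case: ltnP => jm; last first.
  rewrite subr0; congr (fine (P th _)); apply/seteqP; split => w /=; rewrite /cell/= ltnNge jm/=.
    by rewrite andbT.
  by rewrite andbT.
rewrite comparisonE (@fine_prob_split _ _ _ (P th) [set w | a j < X th i (Y th i w)]
  [set w | a j.+1 < X th i (Y th i w)])//.
rewrite [X in fine (P th X) + _](_ : _ = [set w | a j.+1 < X th i (Y th i w)]); last first.
  apply/seteqP; split => w /=; first by case.
  by move=> h; split => //; apply: le_lt_trans h; exact: a_mono.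
rewrite addrAC subrr add0r; congr (fine (P th _)); apply/seteqP; split => w /=; rewrite /cell/= jm/=.
  by move=> /andP[-> h]; split => //; apply/negP; rewrite -leNgt.
by move=> [-> /negP]; rewrite -leNgt.
Qed.

(** The mass of the cell for e^(-z) dz; the ray [j = m] has no upper end point to subtract. *)
Definition cell_mass (j : nat) : R := expR (- a j) - (if (j < m)%N then expR (- a j.+1) else 0).

Let cvg_sum_q j : \sum_(i < cutoff th) q th j i @[th --> +oo] --> cell_mass j.
Proof.
rewrite /cell_mass; under eq_fun do under eq_bigr do rewrite qE.
case: ifP => jm; under eq_fun do rewrite sumrB.
  by apply: cvgB; exact: cvg_sum_comparison.
by rewrite subr0; under eq_fun do rewrite big1_eq subr0; exact: cvg_sum_comparison.
Qed.

(** Avoiding [U] is one event per index [i], hence a product; within an index the cells are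
    disjoint, so their probabilities add. *)
Let indep_union (U : {set 'I_m.+1}) th : 1 < th ->
  fine (P th [set w | forall i, (i < cutoff th)%N -> forall j, j \in U -> ~ cell a m j (X th i (Y th i w))]) =
  \prod_(i < cutoff th) (1 - \sum_(j in U) q th j i).
Proof.
move=> th1.
pose B i : set R := [set y | forall j, j \in U -> ~ cell a m j (X th i y)].
have mB i : measurable (B i).
  rewrite (_ : B i = \bigcap_(j in [set j | j \in U]) ~` (X th i @^-1` cell a m j)).
    apply: fin_bigcap_measurable => // j _; apply: measurableC.
    exact: measurable_preimage (mX th i) (measurable_cell a m j).
  by apply/seteqP; split => w h j; exact: h.
have PB i : P th (Y th i @^-1` B i) = (1 - \sum_(j in U) q th j i)%:E.
  rewrite -(fine_prob_disjoint_sum (P th) (mem U) (fun j : 'I_m.+1 => mcellX th i j)).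
    have mU := measurable_exists2 (mem U) (fun j : 'I_m.+1 => mcellX th i j).
    rewrite EFinB -fine_probE// -probability_setC//.
    congr (P th _); apply/seteqP; split => w /=; first by move=> h [j jU cj]; exact: (h j jU).
    by move=> h j jU cj; apply: h; exists j.
  by move=> j j' w /=; exact: cell_inj.
have := indY th1 (iota_uniq 0 (cutoff th)) mB.
rewrite (_ : \bigcap_(i in _) _ = [set w | forall i, (i < cutoff th)%N -> forall j, j \in U -> ~ cell a m j (X th i (Y th i w))]); last first.
  apply/seteqP; split => w h.
    by move=> i iI j jU; apply: (h i) => //=; rewrite mem_iota.
  by move=> i /=; rewrite mem_iota add0n => iI j jU; exact: h.
move=> ->; under eq_bigr do rewrite PB.
rewrite -/(index_iota 0 (cutoff th)) (_ : iota 0 _ = index_iota 0 (cutoff th)); last by rewrite /index_iota subn0.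
by rewrite big_mkord prodEFin.
Qed.

Let q0 th j i : 0 <= q th j i. Proof. exact: fine_ge0. Qed.

Let q_le th (U : {set 'I_m.+1}) i : \sum_(j in U) q th j i <= comparison al P Y th (a 0%N) i.
Proof.
rewrite -(fine_prob_disjoint_sum (P th) (mem U) (fun j : 'I_m.+1 => mcellX th i j)); last first.
  by move=> j j' w /=; exact: cell_inj.
rewrite comparisonE; apply: le_fine_prob => //.
  exact: (measurable_exists2 (mem U) (fun j : 'I_m.+1 => mcellX th i j)).
move=> w [j _ /andP[aj _]] /=; apply: le_lt_trans aj; exact: a_mono.
Qed.

Let mW th i := @measurable_weights th i.

(** For the comparison array [cvg_prod_onem] applies; passing to the weights costs at most the sum
    of the discrepancy probabilities at the grid points. *)
Lemma cvg_weights_void (U : {set 'I_m.+1}) :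
  fine (P th [set w | U \subset ~: hits a m (@weights th w)]) @[th --> +oo] -->
  expR (- \sum_(j in U) cell_mass j).
Proof.
apply: cvg_sub0; last first.
  apply: (@cvg_prod_onem _ cutoff (fun th i => \sum_(j in U) q th j i)).
  - by move=> th i; apply: sumr_ge0.
  - move=> e e0; near=> th => i iI; apply: (le_trans (q_le _ _ _)).
    move: (ltnW iI); move: i {iI}; near: th; exact: comparison_small.
  - under eq_fun do rewrite exchange_big/=.
    by apply: cvg_big => [|j _]; [exact: add_continuous|exact: cvg_sum_q].
apply: norm_cvg0; apply: (@squeeze_cvgr _ _ _ _ (cst 0)
  (fun th => \sum_(j < m.+1) fine (P th (discrepancy al th (Y th) (cutoff th) (level al (a j) th))))); last 2 first.
- exact: cvg_cst.
- exact: cvgD0.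
near=> th; have th1 : 1 < th by near: th; apply: nbhs_pinfty_gt; rewrite num_real.
rewrite normr_ge0/= -[X in `|X|]/(_ - _) -(indep_union U th1).
apply: le_trans (fine_prob_bigU _ _ _ _) => //; last by move=> j; exact: mdisc.
apply: fine_prob_close; last 1 first.
- move=> w nD; split => [/fintype.subsetP Uh i iI j jU cj|h].
    have := Uh j jU; rewrite !inE => /asboolP; apply; exists i.
    have jm : (j <= m)%N by rewrite -ltnS.
    exact: (cell_weights i nD jm).2 (conj iI cj).
  apply/fintype.subsetP => j jU; rewrite !inE; apply/asboolP => -[i ci].
  have jm : (j <= m)%N by rewrite -ltnS.
  by have [iI cX] := (cell_weights i nD jm).1 ci; exact: (h i iI j jU cX).
- exact: (measurable_pattern_event (@measurable_hit _ _ _ (@weights th) (@mW th) a m) (fun S => U \subset ~: S)).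
- rewrite (_ : [set w | _] = \bigcap_(i in [set i | (i < cutoff th)%N]) \bigcap_(j in [set j | j \in U])
     ~` [set w | cell a m j (X th i (Y th i w))]).
    apply: bigcap_measurableType => i _; apply: fin_bigcap_measurable => // j _; exact: measurableC.
  by apply/seteqP; split => w h i iI j jU; exact: (h i iI j jU).
- exact: mD.
Unshelve. all: end_near. Qed.

(** Union bound over ordered pairs: distinct indices of the comparison array are independent, so the
    pairs in one cell contribute at most the square of the sum of hit probabilities. *)
Lemma near_weights_doubled (j : 'I_m.+1) e : 0 < e -> \forall th \near +oo,
  fine (P th [set w | doubled a m (@weights th w) j]) <= cell_mass j ^+ 2 + e.
Proof.
move=> e0.
have cS : (\sum_(i < cutoff th) q th j i) ^+ 2 @[th --> +oo] --> cell_mass j ^+ 2.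
  by rewrite expr2; under eq_fun do rewrite expr2; apply: cvgM; exact: cvg_sum_q.
near=> th; have th1 : 1 < th by near: th; apply: nbhs_pinfty_gt; rewrite num_real.
have h1 : `|cell_mass j ^+ 2 - (\sum_(i < cutoff th) q th j i) ^+ 2| <= e / 2.
  by near: th; move/cvgrPdist_le: cS; apply; rewrite divr_gt0.
have h2 : `|0 - \sum_(j < m.+1) fine (P th (discrepancy al th (Y th) (cutoff th) (level al (a j) th)))| <= e / 2.
  by near: th; move/cvgrPdist_le: cvgD0; apply; rewrite divr_gt0.
pose c i := [set w | cell a m j (X th i (Y th i w))].
pose pairs := \big[setU/set0]_(i < cutoff th) \big[setU/set0]_(i' < cutoff th | i' != i) (c i `&` c i').
have mc i : measurable (c i) by exact: mcellX.
have mpairs : measurable pairs.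
  by apply: bigsetU_measurable => i _; apply: bigsetU_measurable => i' _; exact: measurableI.
have Ppairs : fine (P th pairs) <= (\sum_(i < cutoff th) q th j i) ^+ 2.
  apply: le_trans (fine_prob_bigU _ _ _ _) _.
    by move=> i; apply: bigsetU_measurable => i' _; exact: measurableI.
  rewrite expr2 big_distrl/=; apply: ler_sum => i _.
  apply: le_trans (fine_prob_bigU _ _ _ _) _; first by move=> i'; exact: measurableI.
  rewrite big_distrr/=; apply: (@le_trans _ _ (\sum_(i' < cutoff th | i' != i) q th j i * q th j i')).
    apply: ler_sum => i' ii'; rewrite le_eqVlt; apply/orP; left; apply/eqP.
    pose B (l : nat) := X th l @^-1` cell a m j.
    have mB l : measurable (B l) by exact: measurable_preimage (mX th l) (measurable_cell a m j).
    have us : uniq [:: nat_of_ord i; nat_of_ord i'] by rewrite /= inE eq_sym ii'.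
    have := indY th1 us mB; rewrite !big_cons big_nil mule1.
    rewrite (_ : \bigcap_(l in _) _ = c i `&` c i'); last first.
      apply/seteqP; split => w; last by move=> [h h'] l /=; rewrite !inE => /orP[/eqP->|/eqP->].
      by move=> h; split; apply: h => /=; rewrite !inE eqxx ?orbT.
    move=> ->; rewrite fineM ?fin_num_measure//; apply: measurable_preimage => //; exact: (mB _).
  rewrite [leRHS](bigID (fun i' => i' != i))/= lerDl; apply: sumr_ge0 => i' _.
  by rewrite mulr_ge0.
have mdb := @measurable_doubled _ _ _ (@weights th) (@mW th) a m j.
apply: (@le_trans _ _ (fine (P th (pairs `|` @D th)))).
  apply: le_fine_prob => //; first exact: measurableU _ _ mpairs (mD th1).
  move=> w [i [i' [ii' ci ci']]]; have [Dw|nD] := pselect (@D th w); first by right.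
  left; have jm : (j <= m)%N by rewrite -ltnS.
  have [iI cX] := (cell_weights i nD jm).1 ci; have [iI' cX'] := (cell_weights i' nD jm).1 ci'.
  rewrite /pairs -bigcup_seq; exists (Ordinal iI); first by rewrite /= mem_index_enum.
  rewrite -bigcup_seq_cond; exists (Ordinal iI') => //=; rewrite mem_index_enum/=.
  by apply/eqP => -[/esym].
apply: (le_trans (fine_probU _ mpairs (mD th1))).
have hD : fine (P th (@D th)) <= \sum_(j < m.+1) fine (P th (discrepancy al th (Y th) (cutoff th) (level al (a j) th))).
  by apply: fine_prob_bigU => l; exact: mdisc.
rewrite sub0r normrN in h2; have {}h2 := le_trans (ler_norm _) h2.
have {}h1 : (\sum_(i < cutoff th) q th j i) ^+ 2 <= cell_mass j ^+ 2 + e / 2.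
  by move: h1; rewrite ler_norml lerBlDr lerBrDr; lra.
have -> : cell_mass j ^+ 2 + e = cell_mass j ^+ 2 + e / 2 + e / 2 by lra.
exact: lerD (le_trans Ppairs h1) (le_trans hD h2).
Unshelve. all: end_near. Qed.

End cells.

(** * The limiting Poisson process *)

Section gumbel_intensity.
Context {R : realType}.
Implicit Types a b : R.

Lemma measurable_expRN (D : set R) : measurable_fun D (fun z : R => (expR (- z))%:E).
Proof.
apply/measurable_EFinP; apply/measurable_funTS; apply: measurableT_comp => //.
Qed.

Lemma gumbel_intensity_ray a : gumbel_intensity `]a, +oo[ = (expR (- a))%:E.
Proof.
rewrite /gumbel_intensity integral_itv_obnd_cbnd; last exact: measurable_expRN.
have cF : continuous (fun z : R => - expR (- z)).
  move=> z; apply: cvgN; apply: (continuous_cvg _ (@continuous_expR R _)); exact: cvgN.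
rewrite (@ge0_continuous_FTC2y _ _ (fun z => - expR (- z)) a 0).
- by rewrite -EFinB sub0r opprK.
- by move=> x _; exact: expR_ge0.
- apply: continuous_subspaceT => z; apply: (continuous_cvg _ (@continuous_expR R _)); exact: cvgN.
- rewrite -[X in _ --> X]oppr0; apply: cvgN; exact: cvgr_expR.
- by move=> x _; exact: ex_derive.
- by apply: cvg_at_right_filter; exact: cF.
- move=> z _; rewrite derive1E; have hd : is_derive z 1 (fun z : R => - expR (- z)) (expR (- z)).
    have hN : is_derive z (1 : R) (fun z : R => - z) (- 1) by exact: is_deriveN.
    have h := is_derive1_comp (is_derive_expR (- z)) hN.
    by apply: (is_derive_eq (is_deriveN h)); rewrite mulrN1 opprK.
  exact: derive_val.
Qed.

Lemma gumbel_intensity_itv a b : a <= b ->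
  gumbel_intensity `]a, b] = (expR (- a) - expR (- b))%:E.
Proof.
move=> ab; have := gumbel_intensity_ray a; rewrite /gumbel_intensity.
have -> : `]a, +oo[%classic = `]a, b] `|` `]b, +oo[ :> set R.
  apply/seteqP; split => z /=; rewrite !in_itv/= ?andbT.
    by move=> ->/=; case: (leP z b); [left|right].
  by case => [/andP[]//|]; exact: le_lt_trans.
have dab : [disjoint `]a, b]%classic & `]b, +oo[%classic].
  apply/disj_setPLR => z /=; rewrite !in_itv/= andbT => /andP[_ zb].
  by apply/negP; rewrite -leNgt.
have e0 z : (`]a, b]%classic `|` `]b, +oo[%classic) z -> (0 <= (expR (- z))%:E)%E.
  by move=> _; rewrite lee_fin expR_ge0.
have -> : (\int[lebesgue_measure]_(z in `]a, b]%classic `|` `]b, +oo[%classic) (expR (- z))%:E =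
    \int[lebesgue_measure]_(z in `]a, b]) (expR (- z))%:E +
    \int[lebesgue_measure]_(z in `]b, +oo[) (expR (- z))%:E)%E.
  by apply: ge0_integral_setU => //; exact: measurable_expRN.
have := gumbel_intensity_ray b; rewrite /gumbel_intensity => ->.
move=> h; rewrite EFinB -h addeK//.
Qed.

End gumbel_intensity.

Section poisson.
Context {R : realType}.

(** From e^r >= r^(k+1) / (k+1)!. It makes a given small count improbable when the mean is large. *)
Lemma poisson_mass_le (r : R) k : 0 < r -> poisson_mass r k <= k.+1%:R / r.
Proof.
move=> r0; rewrite /poisson_mass expRN ler_pdivlMr// mulrAC ler_pdivrMr ?expR_gt0//.
have := expR_ge1Dxn k (ltW r0) => h.
have f0 : 0 < k.+1`!%:R :> R by rewrite ltr0n fact_gt0.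
have -> : r ^+ k / k`!%:R * r = k.+1%:R * (r ^+ k.+1 / k.+1`!%:R).
  have kn : k.+1%:R != 0 :> R by rewrite pnatr_eq0.
  have fn : k`!%:R != 0 :> R by rewrite pnatr_eq0 -lt0n fact_gt0.
  rewrite factS natrM exprSr; move: (k.+1%:R : R) (k`!%:R : R) kn fn => u v kn fn.
  by field; rewrite kn fn.
by rewrite ler_wpM2l//; lra.
Qed.

(** By e^(-r) >= 1 - r, the left side 1 - (1 + r) e^(-r) is at most 1 - (1 + r)(1 - r). *)
Lemma poisson_two_le (r : R) : 0 <= r -> 1 - poisson_mass r 0 - poisson_mass r 1 <= r ^+ 2.
Proof.
move=> r0; rewrite /poisson_mass !expr0 expr1 fact0 divr1 mul1r divr1.
have h := expR_ge1Dx (- r).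
have : (1 + r) * (1 - r) <= (1 + r) * expR (- r) by rewrite ler_wpM2l//; lra.
lra.
Qed.

End poisson.

(** * Cells hit by the Poisson process *)

Section poisson_process.
Context {R : realType} {d : measure_display} {T : measurableType d}.
Variables (P : probability T R) (pts : T -> nat -> R).
Hypothesis hpts : is_PPP P pts gumbel_intensity.

Let mp : forall i, measurable_fun setT (fun w => pts w i). Proof. by have [] := hpts. Qed.

(** Only countably many finite lists of indices can witness the count. *)
Lemma measurable_count_eq (A : set R) n : measurable A ->
  measurable [set w | count_eq (pts w) A n].
Proof.
move=> mA.
pose F (s : seq nat) : set T := if uniq s && (size s == n) then
  \bigcap_i [set w | (i \in s) <-> A (pts w i)] else set0.
rewrite (_ : [set w | _] = \bigcup_s F s).
  apply: countable_bigcupT_measurable => // s; rewrite /F; case: ifP => _ //.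
  apply: bigcapT_measurable => i.
  have mAi : measurable [set w | A (pts w i)] by exact: measurable_preimage (mp i) mA.
  case: (i \in s).
    rewrite (_ : [set w | _] = [set w | A (pts w i)])//.
    by apply/seteqP; split => w /=; [case=> h _; exact: h|split].
  rewrite (_ : [set w | _] = ~` [set w | A (pts w i)]); first exact: measurableC.
  apply/seteqP; split => w /=; first by move=> h /h.
  by move=> h; split.
apply/seteqP; split => w.
  by move=> [s [us ss hs]]; exists s => //; rewrite /F us ss eqxx/= => i _; exact: hs.
move=> [s _]; rewrite /F; case: ifP => // /andP[us /eqP ss] hs; exists s; split => // i.
exact: hs.
Qed.

Lemma prob_count_eq (A : set R) n : measurable A -> (gumbel_intensity A < +oo)%E ->
  fine (P [set w | count_eq (pts w) A n]) = poisson_mass (fine (gumbel_intensity A)) n.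
Proof.
move=> mA fA; have [_ h] := hpts.
have dA (j k : 'I_1) : j != k -> A `&` A = set0 by rewrite !ord1 eqxx.
have := h 1%N (fun=> A) (fun=> n) (fun=> mA) dA (fun=> fA).
rewrite big_ord1 => hP; rewrite -[RHS]/(fine (poisson_mass (fine (gumbel_intensity A)) n)%:E) -hP.
congr (fine (P _)).
apply/seteqP; split => w /=; first by move=> hw j _.
by move=> /(_ ord0); exact.
Qed.

Variables (a : nat -> R) (m : nat).
Hypothesis a_mono : forall i j, (i <= j)%N -> a i <= a j.

Lemma gumbel_intensity_cell j : gumbel_intensity (cell a m j) = (cell_mass a m j)%:E.
Proof.
rewrite /cell_mass; case: ltnP => jm.
  rewrite -gumbel_intensity_itv ?a_mono//; congr gumbel_intensity.
  by apply/seteqP; split => y; rewrite /cell/= jm in_itv.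
rewrite subr0 -gumbel_intensity_ray; congr gumbel_intensity.
by apply/seteqP; split => y; rewrite /cell/= ltnNge jm/= in_itv.
Qed.

Lemma cell_mass_ge0 j : 0 <= cell_mass a m j.
Proof.
rewrite -lee_fin -gumbel_intensity_cell; apply: integral_ge0 => z _.
by rewrite lee_fin expR_ge0.
Qed.

Let mhit := measurable_hit mp a (m := m).

Lemma prob_void (U : {set 'I_m.+1}) :
  fine (P [set w | U \subset ~: hits a m (pts w)]) = expR (- \sum_(j in U) cell_mass a m j).
Proof.
have [_ h] := hpts.
(* Cells outside [U] become the empty set, of count 0 and mass 0, so that the family is indexed by
   all cells. *)
pose A (j : 'I_m.+1) : set R := if j \in U then cell a m j else set0.
have mA j : measurable (A j) by rewrite /A; case: ifP => _ //; exact: measurable_cell.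
have gA j : gumbel_intensity (A j) = (if j \in U then cell_mass a m j else 0)%:E.
  rewrite /A; case: ifP => _; first exact: gumbel_intensity_cell.
  by rewrite /gumbel_intensity integral_set0.
have dA j k : j != k -> A j `&` A k = set0.
  move=> jk; rewrite /A; case: ifP => _; last by rewrite set0I.
  case: ifP => _; last by rewrite setI0.
  apply/seteqP; split => // y [cj ck]; move/eqP: jk; apply; exact: cell_inj cj ck.
have := h _ A (fun=> 0%N) mA dA (fun j => _); rewrite (_ : \bigcap_(j in _) _ =
    [set w | U \subset ~: hits a m (pts w)]); last first.
  apply/seteqP; split => w.
    move=> hw; apply/fintype.subsetP => j jU; rewrite !inE; apply/asboolP => -[i ci].
    have [s [_ /size0nil -> /(_ i)]] := hw j Logic.I; rewrite /A jU in_nil => -[_ hi].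
    by have := hi ci.
  move=> /= /fintype.subsetP hw j _; exists [::]; split => // i; split => //.
  rewrite /A; case: ifP => // jU ci; have := hw j jU; rewrite !inE => /asboolP; case.
  by exists i.
move=> ->; last by move=> j; rewrite gA ltry.
rewrite /= [X in - X]big_mkcond/= -sumrN expR_sum; apply: eq_bigr => j _.
by rewrite /poisson_mass expr0 fact0 divr1 mul1r gA.
Qed.

(** A doubled cell has neither count 0 nor count 1 in the sense of [count_eq], so [poisson_two_le]
    applies. *)
Lemma prob_doubled_le (j : nat) :
  fine (P [set w | doubled a m (pts w) j]) <= cell_mass a m j ^+ 2.
Proof.
have mc := measurable_cell a m j.
have fc : (gumbel_intensity (cell a m j) < +oo)%E by rewrite gumbel_intensity_cell ltry.
have m0 := measurable_count_eq 0 mc; have m1 := measurable_count_eq 1 mc.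
have md := measurable_doubled mp a m j.
set C0 := [set w | count_eq _ _ 0] in m0; set C1 := [set w | count_eq _ _ 1] in m1.
have d01 : C0 `&` C1 = set0.
  apply/seteqP; split => // w [[s [_ /size0nil -> h0]] [r [_ sr h1]]].
  case: r sr h1 => // i r _ h1.
  by have /h0 : cell a m j (pts w i) by apply/h1; rewrite mem_head.
have hs : [set w | doubled a m (pts w) j] `<=` ~` (C0 `|` C1).
  move=> w [i [i' [ii' ci ci']]] [[s [_ /size0nil -> h0]]|[r [_ sr h1]]].
    by have /h0 := ci.
  case: r sr h1 => // k [|//] _ h1; apply: ii'.
  have /h1 := ci; have /h1 := ci'; rewrite !inE => /eqP -> /eqP ->.
  by [].
have mU := measurableU _ _ m0 m1.
apply: (le_trans (le_fine_prob P md (measurableC mU) hs)).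
rewrite probability_setC// fineB ?fin_num_measure// measureU// fineD ?fin_num_measure//.
rewrite !prob_count_eq// gumbel_intensity_cell/= opprD addrA.
exact: poisson_two_le (cell_mass_ge0 _).
Qed.

(** Three causes: a point above the window, a doubled cell, or fewer than [n] points in the window.
    The mean number in the window is e^(-a 0) - e^(-a m), and [poisson_mass_le] bounds each of the
    [n] small counts by n over it. *)
Lemma prob_irregular_le n : a 0%N < a m ->
  fine (P [set w | irregular n (hits a m (pts w))]) <=
  2 * expR (- a m) + \sum_(j < m.+1) cell_mass a m j ^+ 2 +
    n%:R ^+ 2 / (expR (- a 0%N) - expR (- a m)).
Proof.
move=> a0m.
pose top := [set w | ord_max \in hits a m (pts w)].
have mtop : measurable top by exact: mhit.
have Ptop : fine (P top) <= expR (- a m).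
  have := prob_void [set ord_max]; rewrite finset.big_set1 /cell_mass/= ltnn subr0 => pv.
  have -> : top = ~` [set w | [set ord_max]%SET \subset ~: hits a m (pts w)].
    apply/seteqP; split => w /=; rewrite finset.sub1set inE; first by move=> ->.
    by move/negP; rewrite negbK.
  rewrite probability_setC; last first.
    exact: (measurable_pattern_event mhit (fun V : {set 'I_m.+1} => [set ord_max]%SET \subset ~: V)).
  rewrite fineB ?fin_num_measure ?pv//; last first.
    exact: (measurable_pattern_event mhit (fun V : {set 'I_m.+1} => [set ord_max]%SET \subset ~: V)).
  have := expR_ge1Dx (- expR (- a m)); rewrite /=; lra.
pose dbl := \big[setU/set0]_(j < m.+1) [set w | doubled a m (pts w) j].
have mdbl : measurable dbl by apply: bigsetU_measurable => j _; exact: (measurable_doubled mp).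
pose B : set R := [set y | (a 0%N < y) && (y <= a m)].
have BE : B = `]a 0%N, a m]%classic by apply/seteqP; split => y /=; rewrite in_itv.
have mB : measurable B by rewrite BE.
have gB : gumbel_intensity B = (expR (- a 0%N) - expR (- a m))%:E.
  by rewrite BE gumbel_intensity_itv// ltW.
pose few := \big[setU/set0]_(k < n) [set w | count_eq (pts w) B k].
have mfew : measurable few by apply: bigsetU_measurable => k _; exact: measurable_count_eq.
have sub : [set w | irregular n (hits a m (pts w))] `<=` (top `|` dbl) `|` few.
  move=> w /orP[tw|hn]; first by left; left.
  have [tw|ntw] := boolP (ord_max \in hits a m (pts w)); first by left; left.
  have [dw|ndw] := pselect (dbl w); first by left; right.
  right; rewrite /few -(bigcup_mkord n (fun k => [set w | count_eq (pts w) B k])).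
  exists #|hits a m (pts w)| => //=; apply: count_eq_hits => // j dj; apply: ndw.
  by rewrite /dbl -(bigcup_mkord m.+1 (fun j => [set w | doubled a m (pts w) j])); exists j => /=.
have mirr := measurable_pattern_event mhit (@irregular m n).
apply: (le_trans (le_fine_prob P mirr (measurableU _ _ (measurableU _ _ mtop mdbl) mfew) sub)).
apply: (le_trans (fine_probU P (measurableU _ _ mtop mdbl) mfew)); apply: lerD.
  apply: (le_trans (fine_probU P mtop mdbl)); apply: lerD.
    by apply: (le_trans Ptop); rewrite ler_peMl ?expR_ge0// ler1n.
  apply: le_trans (fine_prob_bigU _ _ _ _) _; first by move=> j; exact: (measurable_doubled mp).
  by apply: ler_sum => j _; exact: prob_doubled_le.
apply: le_trans (fine_prob_bigU _ _ _ _) _; first by move=> j; exact: measurable_count_eq.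
have r0 : 0 < expR (- a 0%N) - expR (- a m) by rewrite subr_gt0 ltr_expR ltrN2.
apply: (@le_trans _ _ (\sum_(k < n) n%:R / (expR (- a 0%N) - expR (- a m)))).
  apply: ler_sum => k _; rewrite prob_count_eq ?gB ?ltry//=.
  apply: (le_trans (poisson_mass_le _ r0)); rewrite ler_wpM2r ?invr_ge0 ?(ltW r0)//.
  by rewrite ler_nat.
by rewrite sumr_const card_ord -[leLHS]mulr_natl mulrA -expr2.
Qed.

End poisson_process.

(** * Convergence of the order statistics *)

Section uniform_grid.
Context {R : realType}.

(** Compactness of the box in its near-covering form: half of each radius is spent on moving the
    centre, the other half on [dl]. *)
Lemma uniform_on_box (n : nat) (f : 'rV[R]_n -> R) (K e : R) : continuous f -> 0 < e ->
  exists2 dl : R, 0 < dl & forall x y : 'rV[R]_n, (forall k, `|x ord0 k| <= K) ->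
    (forall k, `|x ord0 k - y ord0 k| <= dl) -> `|f x - f y| <= e.
Proof.
move=> cf e0.
pose box : set 'rV[R]_n := [set v | forall k, `[- K, K]%classic (v ord0 k)].
have cbox : compact box.
  apply: (@rV_compact _ _ (fun=> `[- K, K]%classic)).
  by move=> _; exact: segment_compact.
pose Q (dl : R) (x : 'rV[R]_n) := forall y : 'rV[R]_n,
  (forall k, `|x ord0 k - y ord0 k| <= dl) -> `|f x - f y| <= e.
have /compact_near_coveringP cov := cbox.
have h : \forall dl \near (0 : R)^'+, forall x, box x -> Q dl x.
  apply: (cov R ((0 : R)^'+) Q) => x bx.
  have /cvgrPdist_le /(_ (e / 2)) := cf x; rewrite divr_gt0// => /(_ isT).
  move=> /nbhs_ballP[r /= r0 hr].
  exists (ball x (r / 2), [set dl | dl < r / 2]).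
    split => /=; first by apply: nbhsx_ballx; rewrite divr_gt0.
    by apply: nbhs_right_lt; rewrite divr_gt0.
  move=> [x' dl] /= [xx' dlr] y xy.
  have b1 : ball x r x' by apply: le_ball xx'; lra.
  have b2 : ball x r y.
    rewrite (splitr r); apply: ball_triangle xx' _; split => [|i j]; first by rewrite divr_gt0.
    by rewrite !ord1 /ball/=; apply: le_lt_trans (xy j) dlr.
  rewrite (_ : f x' - f y = (f x - f y) - (f x - f x')); last by ring.
  apply: (le_trans (ler_normB _ _)); rewrite (splitr e); apply: lerD; exact: hr.
near ((0 : R)^'+) => dl; exists dl => // x y xK xy.
have hQ : forall x, box x -> Q dl x by near: dl.
apply: hQ xy => k /=; rewrite in_itv/=; by rewrite -ler_norml.
Unshelve. all: end_near. Qed.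

(** Largest mass times total mass: a cell of width at most eta has mass at most e^(-a 0) eta, and
    the masses telescope to at most e^(-a 0). *)
Lemma sum_cell_mass_sqr_le (a : nat -> R) (m : nat) (eta : R) :
  (forall i j, (i <= j)%N -> a i <= a j) -> (forall j, a j.+1 - a j <= eta) ->
  \sum_(j < m) cell_mass a m j ^+ 2 <= expR (- a 0%N) ^+ 2 * eta.
Proof.
move=> am ae.
have h j : (j < m)%N -> 0 <= cell_mass a m j <= expR (- a 0%N) * eta.
  move=> jm; rewrite cell_mass_ge0//= /cell_mass jm.
  have -> : expR (- a j.+1) = expR (- a j) * expR (- (a j.+1 - a j)).
    by rewrite -expRD; congr expR; ring.
  rewrite -{1}[expR (- a j)]mulr1 -mulrBr ler_pM ?expR_ge0//.
  - by rewrite subr_ge0 -expR0 ler_expR oppr_le0 subr_ge0 am.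
  - by rewrite ler_expR lerN2 am.
  - by have := expR_ge1Dx (- (a j.+1 - a j)); have := ae j; lra.
have tel : \sum_(j < m) cell_mass a m j <= expR (- a 0%N).
  rewrite (eq_bigr (fun j : 'I_m => - (expR (- a j.+1) - expR (- a j)))); last first.
    by move=> j _; rewrite /cell_mass ltn_ord opprB.
  rewrite sumrN -(big_mkord xpredT (fun j => expR (- a j.+1) - expR (- a j))).
  rewrite telescope_sumr// opprB gerBl expR_ge0//.
apply: (@le_trans _ _ (\sum_(j < m) expR (- a 0%N) * eta * cell_mass a m j)).
  apply: ler_sum => j _; have /andP[h0 h1] := h j (ltn_ord j).
  by rewrite expr2 ler_wpM2r.
have eta0 : 0 <= eta by apply: le_trans (ae 0%N); rewrite subr_ge0 am.
by rewrite -big_distrr/= expr2 [leRHS]mulrAC ler_wpM2l ?mulr_ge0 ?expR_ge0.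
Qed.

(** The representative of a pattern lists the lower end points of the cells that [kth_position]
    assigns to the [n] largest points. *)
Lemma pattern_selector (n m : nat) (a : nat -> R) (f : 'rV[R]_n -> R) (K dl e : R) :
  (forall j, (j <= m)%N -> `|a j| <= K) -> (forall j, 0 <= a j.+1 - a j <= dl) ->
  (forall x y : 'rV[R]_n, (forall k, `|x ord0 k| <= K) ->
    (forall k, `|x ord0 k - y ord0 k| <= dl) -> `|f x - f y| <= e) ->
  exists r : {set 'I_m.+1} -> 'rV[R]_n, forall (S : {set 'I_m.+1}) (z : 'rV[R]_n),
  ~~ irregular n S ->
  (forall (k : 'I_n) (q : nat), (q < m)%N ->
    (#|[set j in S | (q.+1 <= j)%N]%SET| <= k < #|[set j in S | (q <= j)%N]%SET|)%N ->
    a q <= z ord0 k <= a q.+1) -> `|f z - f (r S)| <= e.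
Proof.
move=> aK ad fu.
have /choice[g hg] (Sk : {set 'I_m.+1} * 'I_n) : exists q, ~~ irregular n Sk.1 -> (q < m)%N /\
    (#|[set j in Sk.1 | (q.+1 <= j)%N]%SET| <= Sk.2 < #|[set j in Sk.1 | (q <= j)%N]%SET|)%N.
  have [irr|] := boolP (irregular n Sk.1); first by exists 0%N.
  rewrite /irregular negb_or -leqNgt => /andP[h1 h2].
  have [q q1 q2] := kth_position h1 (leq_trans (ltn_ord Sk.2) h2).
  by exists q.
exists (fun S => \row_k a (g (S, k))) => S z irr hz.
rewrite distrC; apply: fu => k; rewrite mxE; have [/= q1 q2] := hg (S, k) irr.
  exact: aK (ltnW q1).
have /andP[z1 z2] := hz k _ q1 q2; have /andP[d0 d1] := ad (g (S, k)).
by rewrite ler_norml; apply/andP; split; lra.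
Qed.

End uniform_grid.

Section convergence.
Context {R : realType}.
Variables (al : R) (d : R -> measure_display) (T : forall th, measurableType (d th)).
Variables (P : forall th, probability (T th) R) (Y : forall th, nat -> T th -> R).
Arguments Y : clear implicits.
Hypothesis al01 : 0 <= al < 1.
Hypothesis mY : forall th i, measurable_fun setT (Y th i).
Hypothesis indY : forall th, 1 < th -> mutually_independent (P th) (Y th).
Hypothesis betaY : forall th, 1 < th -> forall i,
  is_beta_rv (P th) (Y th i) (1 - al) (th + i.+1%:R * al).
Hypothesis Y01 : forall th, 1 < th -> forall i w, 0 < Y th i w < 1.
Variables (d' : measure_display) (T' : measurableType d') (P' : probability T' R).
Variable pts : T' -> nat -> R.
Hypothesis hpts : is_PPP P' pts gumbel_intensity.

Let mp : forall i, measurable_fun setT (fun w => pts w i). Proof. by have [] := hpts. Qed.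

Let W th := @weights R al d T Y th.
Arguments W : clear implicits.
Let mW th i : measurable_fun setT (fun w => W th w i). Proof. exact: measurable_weights. Qed.

Let Z th (w : T th) (k : nat) : R :=
  th * kth_largest (stick_breaking (Y th ^~ w)) k - beta_const al th.
Arguments Z : clear implicits.

Let WZ th w k : 0 < th -> is_kth (W th w) (Z th w k) k.
Proof. by move=> th0; apply: is_kth_affine => //; exact: is_kth_largest. Qed.

Let ptsZ w k : is_kth (pts w) (kth_largest (pts w) k) k.
Proof. exact: is_kth_largest. Qed.

Section fixed_grid.
Variables (a : nat -> R) (m : nat).
Hypothesis a_mono : forall i j, (i <= j)%N -> a i <= a j.

Lemma cvg_weights_pattern (S : {set 'I_m.+1}) :
  fine (P th [set w | hits a m (W th w) = S]) @[th --> +oo] -->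
  fine (P' [set w | hits a m (pts w) = S]).
Proof.
apply: (@cvg_pattern R _ d T P (fun th w => hits a m (W th w)) d' T' P' (fun w => hits a m (pts w))).
- by move=> th j; exact: (measurable_hit (@mW th)).
- by move=> j; exact: (measurable_hit mp).
- move=> U; rewrite (prob_void hpts a_mono).
  exact: (cvg_weights_void al01 mY indY betaY Y01 a_mono).
Qed.

(** Irregular patterns are finitely many, so their total probability converges; for doubled cells
    the error is shared among m + 1 of them. *)
Lemma near_weights_bad n e : 0 < e -> \forall th \near +oo,
  fine (P th (bad_event (W th) a m n)) <=
  fine (P' [set w | irregular n (hits a m (pts w))]) + \sum_(j < m) cell_mass a m j ^+ 2 + e.
Proof.
move=> e0.
have c1 : \sum_(S : {set 'I_m.+1} | irregular n S) fine (P th [set w | hits a m (W th w) = S])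
    @[th --> +oo] --> fine (P' [set w | irregular n (hits a m (pts w))]).
  rewrite (prob_pattern_event (measurable_hit mp a (m := m))).
  by apply: cvg_big => [|S _]; [exact: add_continuous|exact: cvg_weights_pattern].
near=> th.
have h1 : `|fine (P' [set w | irregular n (hits a m (pts w))]) -
    \sum_(S : {set 'I_m.+1} | irregular n S) fine (P th [set w | hits a m (W th w) = S])| <= e / 2.
  by near: th; move/cvgrPdist_le: c1; apply; rewrite divr_gt0.
have h2 : forall j : 'I_m.+1, fine (P th [set w | doubled a m (W th w) j]) <=
    cell_mass a m j ^+ 2 + e / 2 / m.+1%:R.
  near: th; apply: filter_forall => j.
  apply: (near_weights_doubled al01 mY indY betaY Y01 a_mono).
  by rewrite !divr_gt0.
apply: (le_trans (bad_event_le (P th) (@mW th) a m n)).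
have h3 : \sum_(j < m) fine (P th [set w | doubled a m (W th w) j]) <=
    \sum_(j < m) cell_mass a m j ^+ 2 + e / 2.
  apply: (@le_trans _ _ (\sum_(j < m) (cell_mass a m j ^+ 2 + e / 2 / m.+1%:R))).
    by apply: ler_sum => j _; exact: (h2 (widen_ord (leqnSn m) j)).
  rewrite big_split/= lerD2l sumr_const card_ord -[leLHS]mulr_natr mulrAC ler_pdivrMr//.
  by rewrite ler_wpM2l ?divr_ge0 ?(ltW e0)// ler_nat.
have h4 : \sum_(S : {set 'I_m.+1} | irregular n S) fine (P th [set w | hits a m (W th w) = S]) <=
    fine (P' [set w | irregular n (hits a m (pts w))]) + e / 2.
  by rewrite -lerBlDl; apply: le_trans h1; rewrite distrC ler_norm.
by apply: (le_trans (lerD h4 h3)); lra.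
Unshelve. all: end_near. Qed.

End fixed_grid.

(** Both expectations are within e / 8 plus a bad-event term of a sum over patterns with the same
    fixed coefficients, and the pattern probabilities converge. The window is fixed first, then the
    mesh; only then does [th] grow. *)
Lemma cvg_order_statistics (n : nat) (f : 'rV[R]_n -> R) (C : R) :
  continuous f -> (forall x, `|f x| <= C) ->
  Rintegral (P th) setT (fun w => f (\row_(k < n) Z th w k)) @[th --> +oo] -->
  Rintegral P' setT (fun w => f (\row_(k < n) kth_largest (pts w) k)).
Proof.
move=> cf fC; apply/cvgrPdist_le => e e0.
have closing (u v s t p q : R) : `|u - s| <= e / 8 + p -> `|v - t| <= e / 8 + q -> `|s - t| <= e / 4 ->
    p + q <= e / 4 -> `|u - v| <= e.
  rewrite !ler_norml => /andP[h1 h2] /andP[h3 h4] /andP[h5 h6] h7.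
  by apply/andP; split; lra.
have C0 : 0 <= C by exact: le_trans (fC 0).
(* The bad events have probability at most 3b and 4b, so 2C times their sum is 14 C b, below e /
   4. *)
pose b := e / (64 * (C + 1)).
have b0 : 0 < b by rewrite divr_gt0// mulr_gt0//; lra.
have Cb : 16 * C * b <= e / 4.
  rewrite /b mulrA ler_pdivrMr ?mulr_gt0//; last lra.
  have := ltW e0; nra.
(* Half-width of the window: in [prob_irregular_le] the terms 2 e^(-K), the squared mass of the ray
   and the few-points term are at most 2 / K, 1 / K and n^2 / K. *)
pose K := (3 + n%:R ^+ 2) / b + 1.
have n0 : 0 <= n%:R ^+ 2 :> R by rewrite sqr_ge0.
have K0 : 1 <= K by rewrite lerDr divr_ge0 ?(ltW b0)//; lra.
have K0' : 0 < K by lra.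
have Kb : (3 + n%:R ^+ 2) / K <= b.
  by rewrite ler_pdivrMr// /K mulrDr mulr1 mulrC divfK ?gt_eqF//; lra.
have e8 : 0 < e / 8 by rewrite divr_gt0.
have [dl dl0 hdl] := uniform_on_box K cf e8.
(* The two summands bring the mesh [eta] below [dl] and the sum of squared cell masses below [b]. *)
pose A := (2 * K) / dl + expR K ^+ 2 * (2 * K) / b.
pose m := (Num.truncn A).+1.
have Am : A <= m%:R by apply/ltW/truncnS_gt.
have m0 : 0 < m%:R :> R by rewrite ltr0n.
have A1 : 0 <= (2 * K) / dl by rewrite divr_ge0 ?mulr_ge0 ?(ltW dl0) ?(ltW K0').
have A2 : 0 <= expR K ^+ 2 * (2 * K) / b 
  by apply: divr_ge0 (ltW b0); apply: mulr_ge0; [exact: sqr_ge0|lra].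
pose eta := 2 * K / m%:R.
have eta0 : 0 <= eta by rewrite divr_ge0 ?mulr_ge0 ?(ltW K0').
have eta_dl : eta <= dl by rewrite ler_pdivrMr// [leRHS]mulrC -ler_pdivrMr//; apply: le_trans Am; rewrite lerDl.
have eta_b : expR K ^+ 2 * eta <= b.
  by rewrite mulrA ler_pdivrMr// [leRHS]mulrC -ler_pdivrMr//; apply: le_trans Am; rewrite lerDr.
pose a (j : nat) := j%:R * eta - K.
have a_mono i j : (i <= j)%N -> a i <= a j by move=> ij; rewrite lerD2r ler_wpM2r// ler_nat.
have aS j : a j.+1 - a j = eta by rewrite /a -natr1; ring.
have a0 : a 0%N = - K by rewrite /a mul0r sub0r.
have am : a m = K by rewrite /a /eta mulrC divfK ?gt_eqF//; lra.
have aK j : (j <= m)%N -> `|a j| <= K.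
  by move=> jm; rewrite ler_norml -a0 a_mono//= -am a_mono.
have ad j : 0 <= a j.+1 - a j <= dl by rewrite aS eta0.
have [r hr] := pattern_selector aK ad hdl.
have S2 : \sum_(j < m) cell_mass a m j ^+ 2 <= b.
  apply: le_trans eta_b; rewrite -[X in expR X]opprK -a0.
  by apply: sum_cell_mass_sqr_le => // j; rewrite aS.
have irr : fine (P' [set w | irregular n (hits a m (pts w))]) <= 2 * b.
  have a0m : a 0%N < a m by rewrite a0 am; lra.
  apply: (le_trans (prob_irregular_le hpts a_mono n a0m)).
  rewrite big_ord_recr/= {2}/cell_mass ltnn subr0 a0 am opprK.
  have eK : expR (- K) <= 1 / K.
    rewrite expRN div1r lef_pV2 ?posrE ?expR_gt0//.
    by have := expR_ge1Dx K; lra.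
  have eK1 : 1 / K <= 1 by rewrite ler_pdivrMr// mul1r.
  have eK0 := expR_gt0 (- K).
  have eK2 : expR (- K) ^+ 2 <= 1 / K.
    by apply: (le_trans _ eK); rewrite expr2 ger_pMr//; exact: le_trans eK eK1.
  have eKK : n%:R ^+ 2 / (expR K - expR (- K)) <= n%:R ^+ 2 / K.
    have := expR_ge1Dx K => h.
    rewrite ler_wpM2l// lef_pV2 ?posrE//; lra.
  have -> : 2 * b = b + b by ring.
  have : (3 + n%:R ^+ 2) / K = 3 * (1 / K) + n%:R ^+ 2 / K by field; rewrite gt_eqF.
  lra.
pose SL := \sum_(S : {set 'I_m.+1}) f (r S) * fine (P' [set w | hits a m (pts w) = S]).
have cS : \sum_(S : {set 'I_m.+1}) f (r S) * fine (P th [set w | hits a m (W th w) = S])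
    @[th --> +oo] --> SL.
  apply: cvg_big => [|S _]; first exact: add_continuous.
  by apply: cvgM; [exact: cvg_cst|exact: cvg_weights_pattern].
have bad' : fine (P' (bad_event pts a m n)) <= 3 * b.
  apply: (le_trans (bad_event_le P' mp a m n)).
  rewrite -(prob_pattern_event (measurable_hit mp a (m := m))).
  have : \sum_(j < m) fine (P' [set w | doubled a m (pts w) j]) <= b.
    by apply: le_trans S2; apply: ler_sum => j _; exact: (prob_doubled_le hpts).
  lra.
have e8' : 0 <= e / 8 by exact: ltW.
have E' := discretization_error P' mp ptsZ a_mono fC (fun S => fC (r S)) e8' hr.
near=> th.
have th0 : 0 < th by near: th; apply: nbhs_pinfty_gt; rewrite num_real.
have E := discretization_error (P th) (@mW th) (fun w k => @WZ th w k th0) a_mono fC (fun S => fC (r S)) e8' hr.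
have bad : fine (P th (bad_event (W th) a m n)) <=
  fine (P' [set w | irregular n (hits a m (pts w))]) + \sum_(j < m) cell_mass a m j ^+ 2 + b.
  by near: th; exact: near_weights_bad.
have hS : `|SL - \sum_(S : {set 'I_m.+1}) f (r S) * fine (P th [set w | hits a m (W th w) = S])| <= e / 4.
  by near: th; move/cvgrPdist_le: cS; apply; rewrite divr_gt0.
have B1 : 2 * C * fine (P th (bad_event (W th) a m n)) <= 2 * C * (4 * b).
  by rewrite ler_wpM2l ?mulr_ge0//; lra.
have B2 : 2 * C * fine (P' (bad_event pts a m n)) <= 2 * C * (3 * b).
  by rewrite ler_wpM2l ?mulr_ge0.
apply: (closing _ _ _ _ _ _ E' E hS).
apply: (le_trans (lerD B2 B1)).
have Cb0 : 0 <= C * b by rewrite mulr_ge0// ltW.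
by apply: le_trans Cb; lra.
Unshelve. all: end_near. Qed.

End convergence.

(** * Removal of a null set *)

Section null_set.
Context {R : realType} {d : measure_display} {T : measurableType d}.
Variables (P : probability T R) (N : set T).
Hypotheses (mN : measurable N) (PN : P N = 0%E).

Import HBNNSimple.

(** For arbitrary [f] and [g] the comparison is made on simple functions below [f]: cutting them off
    on [N] keeps their integral and puts them below [g]. *)
Lemma ge0_le_integral_off_null (f g : T -> \bar R) :
  (forall w, 0 <= f w)%E -> (forall w, 0 <= g w)%E -> (forall w, ~ N w -> (f w <= g w)%E) ->
  (\int[P]_w f w <= \int[P]_w g w)%E.
Proof.
move=> f0 g0 fg; rewrite (ge0_integralTE P f0); apply: ge_ereal_sup => _ [h /= hf <-].
rewrite -integralT_nnsfun.
have -> : (\int[P]_w (h w)%:E = \int[P]_w (h w * \1_(~` N) w)%:E)%E.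
  apply: ae_eq_integral => //.
  - exact/measurable_EFinP.
  - apply/measurable_EFinP; apply: measurable_funM => //.
    apply: measurable_indic; exact: measurableC.
  - exists N; split => // w /= hw; apply: contrapT => nN; apply: hw => _.
    by rewrite indicE mem_set// mulr1.
apply: ge0_le_integral_any => w; rewrite indicE.
have [nw|Nw] := pselect (N w).
  by rewrite memNset ?mulr0 ?lexx ?g0//=; apply.
by rewrite mem_set// mulr1 lee_fin fun_ge0/= (le_trans (hf w))// fg.
Qed.

Lemma eq_Rintegral_off_null (f g : T -> R) :
  (forall w, ~ N w -> f w = g w) -> Rintegral P setT f = Rintegral P setT g.
Proof.
move=> fg; rewrite /Rintegral; congr fine; rewrite integralE [RHS]integralE.
congr (_ - _)%E; apply/eqP; rewrite eq_le; apply/andP; split;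
  apply: ge0_le_integral_off_null => // w nw; by rewrite ?funeposE ?funenegE fg.
Qed.

End null_set.

Section clip.
Context {R : realType}.

(* Beta variables lie in ]0, 1[ only almost surely: the exceptional values are replaced
   by 1/2. *)
Definition clip (y : R) : R := if 0 < y < 1 then y else 2^-1.

Lemma clip01 y : 0 < clip y < 1.
Proof. by rewrite /clip; case: ifP => // _; lra. Qed.

Lemma measurable_clip : measurable_fun setT clip.
Proof.
apply: measurable_fun_ifT => //.
rewrite (_ : (fun y : R => 0 < y < 1) = (fun y => (0 < y) && (y < 1)))//.
by apply: measurable_and; apply: measurable_fun_ltr.
Qed.

Lemma measurable_preimage_clip (B : set R) : measurable B -> measurable (clip @^-1` B).
Proof. by move=> mB; exact: measurable_preimage measurable_clip mB. Qed.

Variables (d : measure_display) (T : measurableType d) (P : probability T R).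

(** The law is given by a density on ]0, 1[, where [clip] is the identity, so clipping leaves it
    unchanged. *)
Lemma clip_beta (Y : T -> R) a b : is_beta_rv P Y a b -> is_beta_rv P (clip \o Y) a b.
Proof.
move=> [mY hY]; split; first exact: measurableT_comp measurable_clip mY.
move=> B mB; rewrite comp_preimage hY; last exact: measurable_preimage_clip.
congr (integral _ _ _); apply/seteqP; split => y /=; rewrite /clip in_itv/=.
  by move=> [+ y01]; rewrite y01.
by move=> [By y01]; rewrite y01.
Qed.

Lemma clip_independent (Y : nat -> T -> R) :
  mutually_independent P Y -> mutually_independent P (fun i => clip \o Y i).
Proof.
move=> h s B us mB; apply: (h s (fun i => clip @^-1` B i) us) => i.
exact: measurable_preimage_clip.
Qed.

Lemma beta_off01 (Y : T -> R) a b : is_beta_rv P Y a b -> P [set w | ~ 0 < Y w < 1] = 0%E.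
Proof.
move=> [mY hY]; rewrite (_ : [set w | _] = Y @^-1` (~` `]0, 1[%classic)); last first.
  by apply/seteqP; split => w /=; rewrite in_itv.
by rewrite hY ?setICl ?integral_set0//; exact: measurableC.
Qed.

End clip.

Theorem theorem6p1 (R : realType) (alpha : R) (halpha0 : 0 <= alpha)
  (halpha1 : alpha < 1)
  (* for each theta: a probability space carrying Y_1, Y_2, ... *)
  (d : R -> measure_display) (Omega : forall theta : R, measurableType (d theta))
  (P : forall theta : R, probability (Omega theta) R)
  (Y : forall theta : R, nat -> Omega theta -> R)
  (hY : forall theta : R, 1 < theta ->
     mutually_independent (P theta) (Y theta) /\
     forall i : nat, is_beta_rv (P theta) (Y theta i)
                       (1 - alpha) (theta + (i.+1)%:R * alpha))
  (* a Poisson point process on R with mean measure e^{-z} dz *)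
  (d' : measure_display) (Omega' : measurableType d')
  (P' : probability Omega' R) (pts : Omega' -> nat -> R)
  (hpts : is_PPP P' pts gumbel_intensity) :
  forall (n : nat) (f : 'rV[R]_n -> R),
    continuous f -> (exists M : R, forall x, `|f x| <= M) ->
    (fun theta : R =>
       Rintegral (P theta) setT
         (fun w => f (\row_(k < n)
            (theta * kth_largest (stick_breaking (fun i => Y theta i w)) k
             - beta_const alpha theta))))
      @ +oo --> Rintegral P' setT (fun w => f (\row_(k < n) kth_largest (pts w) k)).
Proof.
move=> n f cf [M fM].
have al01 : 0 <= alpha < 1 by rewrite halpha0.
(* For [theta <= 1] the constant 1/2 makes [Y'] measurable for every parameter; the limit only sees
   large ones. *)
pose Y' theta i (w : Omega theta) : R := if 1 < theta then clip (Y theta i w) else 2^-1.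
have mY theta i : 1 < theta -> measurable_fun setT (Y theta i).
  by move=> th1; have [_ /(_ i) []] := hY theta th1.
have Y'E theta i : 1 < theta -> Y' theta i = clip \o Y theta i.
  by move=> th1; apply/funext => w; rewrite /Y' th1.
have mY' theta i : measurable_fun setT (Y' theta i).
  have [th1|] := boolP (1 < theta); last first.
    by move=> /negbTE th1; rewrite /Y' th1; exact: measurable_cst.
  by rewrite Y'E//; apply: measurableT_comp measurable_clip _; exact: mY.
have indY' theta : 1 < theta -> mutually_independent (P theta) (Y' theta).
  move=> th1; rewrite (_ : Y' theta = fun i => clip \o Y theta i).
    by apply: clip_independent; have [] := hY theta th1.
  by apply/funext => i; exact: Y'E.
have betaY' theta : 1 < theta -> forall i, is_beta_rv (P theta) (Y' theta i) (1 - alpha) (theta + i.+1%:R * alpha).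
  by move=> th1 i; rewrite Y'E//; apply: clip_beta; have [_] := hY theta th1; apply.
have Y'01 theta : 1 < theta -> forall i w, 0 < Y' theta i w < 1.
  by move=> th1 i w; rewrite /Y' th1 clip01.
apply: cvg_trans (cvg_order_statistics al01 mY' indY' betaY' Y'01 hpts cf fM).
apply: near_eq_cvg; near=> theta.
have th1 : 1 < theta by near: theta; apply: nbhs_pinfty_gt; rewrite num_real.
(* Off this null set clipping changes none of the factors, so the two integrands coincide there. *)
pose N := \bigcup_i [set w | ~ 0 < Y theta i w < 1].
have mNi i : measurable [set w | ~ 0 < Y theta i w < 1].
  rewrite (_ : [set w | _] = Y theta i @^-1` (~` `]0, 1[%classic)).
    by apply: measurable_preimage; [exact: mY|exact: measurableC].
  by apply/seteqP; split => w /=; rewrite in_itv.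
have mN : measurable N by exact: bigcupT_measurable.
have PN : P theta N = 0%E.
  apply/eqP; rewrite eq_le measure_ge0 andbT.
  apply: (le_trans (generalized_Boole_inequality (P theta) mNi mN)).
  rewrite eseries0// => i _ _; apply: (@beta_off01 _ _ _ (P theta)).
  by have [_] := hY theta th1; apply.
apply/esym; apply: (eq_Rintegral_off_null mN PN) => w nw.
congr (f _); apply/rowP => k; rewrite !mxE.
rewrite (_ : Y theta ^~ w = Y' theta ^~ w)//; apply/funext => i.
rewrite /Y' th1 /clip ifT//; apply: contrapT => h; apply: nw; exists i => //.
Unshelve. all: end_near. Qed.
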